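(* Let $\alpha\in(1,2)$ and let $X=(X_t)_{t\ge0}$ be a stable process with index $\alpha$ such that $\mathbb{E}(e^{-qX_t})=\exp(tq^\alpha)$ for all $t>0$, $q\ge0$. Then for all $x<1$ and $t>0$, $$h_1(x,t)=\frac1\pi\int_0^\infty e^{-st-(1-x)s^{1/\alpha}\cos(\pi/\alpha)}\,\sin\!\big((1-x)s^{1/\alpha}\sin(\pi/\alpha)\big)\,E_{\alpha,\alpha}(-s)\,ds.$$
   Context: $X$ is a Lévy process with $X_0=0$; under the stated normalization it is spectrally positive and strictly stable. $\overline X_t=\sup_{0\le s\le t}X_s$. For $c>0$, $t>0$, $x\in(-\infty,c)$, $h_c(x,t)=\mathbb{P}\{X_t\in dx,\ \overline X_t\le c\}/dx$, i.e. $h_c(\cdot,t)$ is the density on $(-\infty,c)$ of $A\mapsto\mathbb{P}\{X_t\in A,\ \overline X_t\le c\}$ (the version continuous in $x$). The Mittag-Leffler function is $E_{a,d}(z)=\sum_{n=0}^\infty z^n/\Gamma(an+d)$. *)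

(* Defs.v *)
From HB Require Import structures.
From mathcomp Require Import all_boot all_order all_algebra.
From mathcomp Require Import all_classical all_reals all_analysis.

Set Implicit Arguments.
Unset Strict Implicit.
Unset Printing Implicit Defensive.

Import Order.TTheory GRing.Theory Num.Theory.
Import numFieldNormedType.Exports.

Local Open Scope classical_set_scope.
Local Open Scope ring_scope.

(* A process is a family X : R -> {RV P >-> R}, of which only the times t >= 0
   are ever used. *)

Section processes.
Context {d : measure_display} {T : measurableType d} {R : realType}.
Variable P : probability T R.

(* The sets A i range over all Borel sets, including setT, so the product rule
   over all n increments is full mutual independence. *)
Definition independent_increments (X : R -> {RV P >-> R}) : Prop :=
  forall (n : nat) (t : nat -> R) (A : nat -> set R),
    0 <= t 0%N -> (forall i, t i <= t i.+1) ->
    (forall i, measurable (A i)) ->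
    P [set w | forall i, (i < n)%N -> A i (X (t i.+1) w - X (t i) w)] =
    (\prod_(i < n) P [set w | A i (X (t i.+1) w - X (t i) w)%R])%E.

Definition stationary_increments (X : R -> {RV P >-> R}) : Prop :=
  forall (s t : R) (A : set R), 0 <= s -> 0 <= t -> measurable A ->
    P [set w | A (X (s + t) w - X s w)] = P [set w | A (X t w)].

Definition cadlag (f : R -> R) : Prop :=
  (forall t, 0 <= t -> f s @[s --> t^'+] --> f t) /\
  (forall t, 0 < t -> cvg (f s @[s --> t^'-])).

Definition levy_process (X : R -> {RV P >-> R}) : Prop :=
  [/\ P [set w | X 0 w = 0] = 1%E,
      independent_increments X,
      stationary_increments X &
      forall w, cadlag (fun t => X t w)].

Definition same_fdd (X Y : R -> T -> R) : Prop :=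
  forall (n : nat) (t : 'I_n -> R) (A : 'I_n -> set R),
    (forall i, 0 <= t i) -> (forall i, measurable (A i)) ->
    P [set w | forall i, A i (X (t i) w)] =
    P [set w | forall i, A i (Y (t i) w)].

(* Stable in the wide sense: a drift is allowed in the scaling relation; the
   process is strictly stable when b can be taken to be 0 for every a. *)
Definition stable_process (alpha : R) (X : R -> {RV P >-> R}) : Prop :=
  levy_process X /\
  forall a : R, 0 < a -> exists b : R,
    same_fdd (fun t w => X (a * t) w)
             (fun t w => a `^ alpha^-1 * X t w + b * t).

Definition running_sup (X : R -> {RV P >-> R}) (t : R) (w : T) : \bar R :=
  ereal_sup [set (X s w)%:E | s in `[0, t]].

(* g is the continuous version on ]-oo, c[ of the density of
   A |-> P (X_t \in A, sup_(s <= t) X_s <= c); the values of g outside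
   ]-oo, c[ are irrelevant. *)
Definition killed_density (X : R -> {RV P >-> R}) (c t : R) (g : R -> R) :
    Prop :=
  [/\ forall x, x < c -> {for x, continuous g},
      forall x, x < c -> 0 <= g x &
      forall A : set R, measurable A -> A `<=` `]-oo, c[ ->
        P [set w | A (X t w) /\ (running_sup X t w <= c%:E)%E] =
        (\int[lebesgue_measure]_(x in A) (g x)%:E)%E].

End processes.

Section special_functions.
Context {R : realType}.

(* Euler's integral, meaningful for 0 < z only. *)
Definition Gamma (z : R) : R :=
  Rintegral lebesgue_measure `]0, +oo[ (fun u => u `^ (z - 1) * expR (- u)).

(* Meaningful for 0 < a and 0 < b, where Gamma is only taken at positive
   arguments and the series converges for every z. *)
Definition mittag_leffler (a b z : R) : R :=
  limn (series (fun n => z ^+ n / Gamma (a * n%:R + b))).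

End special_functions.

(* Main.v *)
(* Let b = 1 / alpha and g_y(u) = exp (- y u^b cos (pi b)) sin (y u^b sin (pi b)).
   On a skeleton of step delta, c - X killed below 0 is dual to y + X killed below
   0, and one step of the latter maps exp (- theta y) to
   exp (delta theta^alpha) exp (- theta y) minus the Laplace transform of the
   undershoot. The undershoot disappears when delta tends to 0, because X has no
   negative jumps; therefore the exit times of y + X have Laplace transform
   exp (- y lambda^b) in the limit, for every lambda, and converge to the density
   pi^-1 int exp (- u s) g_y(u) du. Summing over the exits after time t and using
   duality,
     int exp (- theta c) h_c(c - y, t) dc
       = pi^-1 int exp (- u t) g_y(u) / (u + theta^alpha) du.
   Since 1 / (u + theta^alpha) is the Laplace transform of
   c |-> c^(alpha - 1) E_(alpha, alpha)(- u c^alpha), this is inverted in c, and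
   c = 1 gives the formula. *)

Require Import Defs.
From HB Require Import structures.
From mathcomp Require Import all_boot all_order all_algebra.
From mathcomp Require Import all_classical all_reals all_analysis.
From mathcomp Require Import measurable_realfun ring lra.

Import Order.TTheory GRing.Theory Num.Theory.
Import numFieldNormedType.Exports.

Local Open Scope classical_set_scope.
Local Open Scope ring_scope.

Set Implicit Arguments.
Unset Strict Implicit.
Unset Printing Implicit Defensive.

(** * Integrals of real functions *)

(** Two growth obstacles shape the proof. Since 1/2 < b < 1, cos (pi b) is negative and the envelope
    of g_y grows like exp (y u^b |cos (pi b)|). The Laplace transform in s of the candidate density
    cannot be taken under the integral sign, because it turns exp (- u s) into 1 / (u + lambda),
    which does not absorb this growth. The integral is first rotated from the negative real axis to
    the imaginary axis, where exp (- y z^b) decays; Cauchy's formula then gives exp (- y lambda^b).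
    Likewise the bound exp ((c + 1) (u + 1)^b) for c^(alpha - 1) E_(alpha, alpha)(- u c^alpha) gives
    its transform only for theta above a multiple of (u + 1)^b, never for all u at once. Truncating
    at c <= 4 leaves an error O(exp (- 3 theta / 2)), and a function whose transform is that small
    vanishes on ]0, 3/2], which contains c = 1. No density is presupposed: positions are tested
    against the indicator of [y1, y2[, and the unknown is the probability K(c) that the killed path
    ends there, a right-continuous function of the level. Existence, sign and formula of h_1 are
    read off from K(1). *)

Section real_integrals.
Context d (T : measurableType d) (R : realType).
Variables (mu : {measure set T -> \bar R}) (D : set T).
Hypothesis mD : measurable D.
Implicit Types f g : T -> R.

Lemma integrable_le f g : measurable_fun setT f ->
  (forall x, D x -> `|f x| <= g x) ->
  mu.-integrable D (EFin \o g) -> mu.-integrable D (EFin \o f).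
Proof.
move=> mf fg; apply: le_integrable => //.
  by apply/measurable_EFinP; exact: measurable_funTS.
by move=> x Dx; rewrite /= lee_fin (le_trans (fg _ Dx)) ?ler_norm.
Qed.

Lemma Rintegral_norm_le f g : measurable_fun setT f ->
  (forall x, D x -> `|f x| <= g x) -> mu.-integrable D (EFin \o g) ->
  `|\int[mu]_(x in D) f x| <= \int[mu]_(x in D) g x.
Proof.
move=> mf fg ig; have if_ := integrable_le mf fg ig.
apply: le_trans (le_normr_Rintegral mD if_) _.
by apply: le_Rintegral => //; exact: integrable_norm.
Qed.

Lemma Rdominated_cvg (f_ : nat -> T -> R) f g :
  (forall n, measurable_fun setT (f_ n)) -> measurable_fun setT f ->
  (forall x, D x -> f_ n x @[n --> \oo] --> f x) ->
  (forall n x, D x -> `|f_ n x| <= g x) -> mu.-integrable D (EFin \o g) ->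
  mu.-integrable D (EFin \o f) /\
  \int[mu]_(x in D) f_ n x @[n --> \oo] --> \int[mu]_(x in D) f x.
Proof.
move=> mf_ mf f_f f_g ig.
have [|||||if_ _ cf] := @dominated_convergence _ _ _ mu D mD
  (fun n => EFin \o f_ n) (EFin \o f) (EFin \o g) => //.
- by move=> n; apply/measurable_EFinP; exact: measurable_funTS.
- by apply/measurable_EFinP; exact: measurable_funTS.
- by apply: aeW => x Dx; apply: cvg_EFin; [exact: nearW|exact: f_f].
- by apply: aeW => x n Dx; rewrite /= lee_fin f_g.
split=> //; apply: fine_cvg; rewrite fineK //.
exact: integrable_fin_num if_.
Qed.

End real_integrals.

Section real_fubini.
Context d1 d2 (T1 : measurableType d1) (T2 : measurableType d2) (R : realType).
Variables (m1 : {sigma_finite_measure set T1 -> \bar R}).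
Variables (m2 : {sigma_finite_measure set T2 -> \bar R}).
Variables (D1 : set T1) (D2 : set T2).
Hypothesis mD1 : measurable D1.
Hypothesis mD2 : measurable D2.
Variables (f : T1 -> T2 -> R) (h1 : T1 -> R) (h2 : T2 -> R).
Hypothesis mf : measurable_fun setT (fun z : T1 * T2 => f z.1 z.2).
Hypothesis ih1 : m1.-integrable D1 (EFin \o h1).
Hypothesis ih2 : m2.-integrable D2 (EFin \o h2).
Hypothesis fh : forall x y, D1 x -> D2 y -> `|f x y| <= h1 x * h2 y.

(** The indicators extend [f] by zero, so that Fubini's theorem on the whole product space covers
    integrals over [D1] and [D2]. *)
Let F (z : T1 * T2) : \bar R := (f z.1 z.2 * \1_D1 z.1 * \1_D2 z.2)%:E.

Let mF : measurable_fun setT F.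
Proof.
apply/measurable_EFinP; apply: measurable_funM; first apply: measurable_funM => //.
  by apply: measurableT_comp => //; exact: measurable_indic.
by apply: measurableT_comp => //; exact: measurable_indic.
Qed.

Let mf1 x : measurable_fun setT (f x).
Proof. exact: (measurable_fun_pair2 x mf). Qed.

Let mf2 y : measurable_fun setT (f ^~ y).
Proof. exact: (measurable_fun_pair1 y mf). Qed.

Let if1 x : D1 x -> m2.-integrable D2 (EFin \o f x).
Proof.
move=> D1x; apply: (@integrable_le _ _ _ _ _ mD2 _ (fun y => h1 x * h2 y)) => //.
  by move=> y D2y; exact: fh.
rewrite [X in integrable _ _ X](_ : _ = (fun y => (h1 x)%:E * (EFin \o h2) y)%E).
  exact: integrableZl.
by apply/funext => y; rewrite /= EFinM.
Qed.

Let if2 y : D2 y -> m1.-integrable D1 (EFin \o f ^~ y).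
Proof.
move=> D2y; apply: (@integrable_le _ _ _ _ _ mD1 _ (fun x => h1 x * h2 y)) => //.
  by move=> x D1x; exact: fh.
rewrite [X in integrable _ _ X](_ : _ = (fun x => (h2 y)%:E * (EFin \o h1) x)%E).
  exact: integrableZl.
by apply/funext => x; rewrite /= EFinM muleC.
Qed.

Let FE x : (\int[m2]_y F (x, y))%E =
  ((\int[m2]_(y in D2) f x y) * \1_D1 x)%:E.
Proof.
rewrite /F /= indicE; case: (boolP (x \in D1)) => D1x; last first.
  rewrite mulr0; under eq_integral do rewrite mulr0 mul0r.
  by rewrite integral0.
rewrite mulr1 /Rintegral fineK; last first.
  by apply: integrable_fin_num => //; apply: if1; exact: set_mem.
rewrite [RHS]integral_mkcond; apply: eq_integral => y _.
by rewrite patchE indicE mulr1; case: ifP => _; rewrite ?mulr1 ?mulr0.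
Qed.

Let GE y : (\int[m1]_x F (x, y))%E =
  ((\int[m1]_(x in D1) f x y) * \1_D2 y)%:E.
Proof.
rewrite /F /= indicE; case: (boolP (y \in D2)) => D2y; last first.
  rewrite mulr0; under eq_integral do rewrite mulr0.
  by rewrite integral0.
rewrite mulr1 /Rintegral fineK; last first.
  by apply: integrable_fin_num => //; apply: if2; exact: set_mem.
rewrite [RHS]integral_mkcond; apply: eq_integral => x _.
by rewrite patchE indicE mulr1; case: ifP => _; rewrite ?mulr1 ?mulr0.
Qed.

Let iF : (m1 \x m2)%E.-integrable setT F.
Proof.
apply/integrable12ltyP => //.
have -> : (\int[m1]_x \int[m2]_y `|F (x, y)| =
  \int[m1]_(x in D1) \int[m2]_(y in D2) `|f x y|%:E)%E.
  rewrite [RHS]integral_mkcond; apply: eq_integral => x _.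
  rewrite patchE; case: ifPn => D1x; last first.
    rewrite -[RHS](integral0 m2 setT); apply: eq_integral => y _.
    by rewrite /F/= !indicE (negbTE D1x) mulr0 mul0r normr0.
  rewrite [RHS]integral_mkcond; apply: eq_integral => y _.
  rewrite patchE /F/= !indicE D1x mulr1.
  by case: ifPn => _; rewrite ?mulr1 ?mulr0 ?normr0.
apply: (@le_lt_trans _ _
  (\int[m1]_(x in D1) ((`|h1 x|)%:E * \int[m2]_(y in D2) (`|h2 y|)%:E))%E).
  apply: ge0_le_integral => //.
  - by move=> x D1x; exact: integral_ge0.
  - apply: measurable_funTS.
    rewrite [X in measurable_fun _ X](_ : _ =
      (fun x => \int[m2]_y ((fun z : T1 * T2 => (`|f z.1 z.2| * \1_D2 z.2)%:E) (x, y)))%E).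
      apply: (@measurable_fun_fubini_tonelli_F _ _ _ _ _ m2 (fun z : T1 * T2 => (`|f z.1 z.2| * \1_D2 z.2)%:E)) => //.
      apply/measurable_EFinP; apply: measurable_funM; first exact: measurableT_comp.
      by apply: measurableT_comp => //; exact: measurable_indic.
    apply/funext => x; rewrite integral_mkcond; apply: eq_integral => y _.
    by rewrite patchE /= indicE; case: ifP => _; rewrite ?mulr1 ?mulr0.
  - move/integrableP: (ih1) => [mh1 _].
    apply: emeasurable_funM => //.
    by apply/measurable_EFinP; apply: measurableT_comp => //; exact/measurable_EFinP.
  - move=> x D1x; rewrite -ge0_integralZl//; last first.
      move/integrableP: (ih2) => [mh2 _].
      by apply/measurable_EFinP; apply: measurableT_comp => //; exact/measurable_EFinP.
    apply: ge0_le_integral => //.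
    + by apply/measurable_EFinP; apply: measurable_funTS; apply: measurableT_comp.
    + move/integrableP: (ih2) => [mh2 _].
      apply: emeasurable_funM => //.
      by apply/measurable_EFinP; apply: measurableT_comp => //; exact/measurable_EFinP.
    + move=> y D2y; rewrite -EFinM lee_fin -normrM.
      by rewrite (le_trans (fh D1x D2y)) ?ler_norm.
rewrite ge0_integralZr//; last 2 first.
- move/integrableP: (ih1) => [mh1 _].
  by apply/measurable_EFinP; apply: measurableT_comp => //; exact/measurable_EFinP.
- exact: integral_ge0.
rewrite lte_mul_pinfty//.
- exact: integral_ge0.
- rewrite ge0_fin_numE ?integral_ge0//.
  by move/integrableP: ih1 => [_].
- by move/integrableP: ih2 => [_].
Qed.

Lemma Rfubini_integrable1 :
  m1.-integrable D1 (EFin \o (fun x => \int[m2]_(y in D2) f x y)).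
Proof.
apply/(integrable_mkcond _ mD1).
apply: eq_integrable (integrable_fubini_F iF) => //.
move=> x _; rewrite /fubini_F FE patchE indicE.
by case: ifP => _ /=; rewrite ?mulr1 ?mulr0.
Qed.

Lemma Rfubini :
  \int[m1]_(x in D1) \int[m2]_(y in D2) f x y =
  \int[m2]_(y in D2) \int[m1]_(x in D1) f x y.
Proof.
have := Fubini iF; under eq_integral do rewrite FE.
under [in RHS]eq_integral do rewrite GE.
move=> H; rewrite /Rintegral; congr fine.
rewrite integral_mkcond [RHS]integral_mkcond.
transitivity (\int[m1]_x ((\int[m2]_(y in D2) f x y) * \1_D1 x)%:E)%E.
  apply: eq_integral => x _; rewrite patchE indicE.
  by case: ifP => _; rewrite ?mulr1 ?mulr0.
rewrite H; apply: eq_integral => y _; rewrite patchE indicE.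
by case: ifP => _; rewrite ?mulr1 ?mulr0.
Qed.

End real_fubini.

Section measurable_parameter.
Context d1 d2 (T1 : measurableType d1) (T2 : measurableType d2) (R : realType).
Variable m2 : {sigma_finite_measure set T2 -> \bar R}.

Lemma measurable_Rintegral (D : set T2) (f : T1 -> T2 -> R) : measurable D ->
  measurable_fun setT (fun z : T1 * T2 => f z.1 z.2) ->
  measurable_fun setT (fun x => \int[m2]_(y in D) f x y).
Proof.
move=> mD mf.
pose g (z : T1 * T2) := (f z.1 z.2 * \1_D z.2)%:E.
have mg : measurable_fun setT g.
  apply/measurable_EFinP; apply: measurable_funM => //.
  by apply: measurableT_comp => //; exact: measurable_indic.
(* No integrability is assumed in the parameter: the real integral is always [fine] of the
   difference of two nonnegative integrals, each measurable by Tonelli's theorem. *)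
rewrite (_ : (fun x => _) = fine \o (fun x => \int[m2]_y g^\+ (x, y) - \int[m2]_y g^\- (x, y))%E).
  apply: measurableT_comp; first exact: fine_measurable.
  by apply: emeasurable_funB; apply: measurable_fun_fubini_tonelli_F => //;
    [exact: measurable_funepos|exact: measurable_funeneg].
apply/funext => x; rewrite /Rintegral /=; congr fine.
rewrite integral_mkcond (_ : _ \_ D = (fun y => g (x, y))); last first.
  apply/funext => y; rewrite patchE /g/= indicE.
  by case: ifP => _; rewrite ?mulr1 ?mulr0.
rewrite [LHS]integralE; congr (_ - _)%E; apply: eq_integral => y _.
  by rewrite (funepos_comp g (pair x)).
by rewrite (funeneg_comp g (pair x)).
Qed.

End measurable_parameter.

Lemma Rintegral_sum d (T : measurableType d) (R : realType)
  (mu : {measure set T -> \bar R}) (D : set T) N (f : 'I_N -> T -> R) :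
  measurable D -> (forall i, mu.-integrable D (EFin \o f i)) ->
  \int[mu]_(x in D) (\sum_(i < N) f i x) = \sum_(i < N) \int[mu]_(x in D) f i x.
Proof.
move=> mD fi; rewrite /Rintegral.
under eq_integral do rewrite -sumEFin.
rewrite (integral_sum mD (f := fun i x => (f i x)%:E)).
  by rewrite -sum_fine// => i _; exact: integrable_fin_num (fi i).
exact: fi.
Qed.

Lemma cvgn_sum (R : realType) N (u : 'I_N -> nat -> R) (l : 'I_N -> R) :
  (forall i, u i n @[n --> \oo] --> l i) ->
  \sum_(i < N) u i n @[n --> \oo] --> \sum_(i < N) l i.
Proof.
elim: N u l => [|N IH] u l ul.
  by rewrite big_ord0; under eq_fun do rewrite big_ord0; exact: cvg_cst.
rewrite big_ord_recr; under eq_fun do rewrite big_ord_recr /=.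
by apply: cvgD; [exact: IH|exact: ul].
Qed.

(** [powR] is measurable on the whole line and agrees with the inverse at nonnegative arguments such
    as [x ^+ 2]; at 0 both sides are 0. *)
Lemma measurable_invr (R : realType) : measurable_fun [set: R] (fun x : R => x^-1).
Proof.
rewrite (_ : (fun x : R => x^-1) = (fun x => x * (x ^+ 2) `^ (-1))); last first.
  apply/funext => x; rewrite powR_inv1 ?sqr_ge0//.
  have [->|x0] := eqVneq x 0; first by rewrite invr0 mul0r.
  by rewrite expr2 invfM mulrA mulfV// mul1r.
apply: measurable_funM => //.
by apply: (measurableT_comp (@measurable_powR _ _)) => //; exact: measurable_funX.
Qed.

Ltac mfun := repeat first
  [ assumption
  | exact: measurable_fst | exact: measurable_snd | exact: measurable_id
  | lazymatch goal with
    | |- measurable_fun _ (fun z => _ + _) => apply: measurable_funD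
    | |- measurable_fun _ (fun z => - _) => apply: measurable_funN
    | |- measurable_fun _ (fun z => _ * _) => apply: measurable_funM
    | |- measurable_fun _ (fun z => _ ^+ _) => apply: measurable_funX
    | |- measurable_fun _ (fun z => expR _) =>
        apply: (measurableT_comp (@measurable_expR _))
    | |- measurable_fun _ (fun z => sin _) =>
        apply: (measurableT_comp (continuous_measurable_fun (@continuous_sin _)))
    | |- measurable_fun _ (fun z => cos _) =>
        apply: (measurableT_comp (continuous_measurable_fun (@continuous_cos _)))
    | |- measurable_fun _ (fun z => _ `^ _) =>
        apply: (measurableT_comp (@measurable_powR _ _))
    | |- measurable_fun _ (fun z => _ ^-1) =>
        apply: (measurableT_comp (@measurable_invr _))
    | |- measurable_fun _ (fun z => `|_|) =>
        apply: (measurableT_comp (@normr_measurable _ _))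
    end
  | exact: measurable_cst
  | done ].

(** * Majorants of order 1 / (1 + u^2) *)

Section decay.
Context {R : realType}.
Implicit Types (c A b u : R) (f g : R -> R).

Lemma oneDsqr_gt0 u : 0 < oneDsqr u.
Proof. exact: lt_le_trans (oneDsqr_ge1 _). Qed.

Lemma powR_le_linear c A b : 0 < c -> 0 <= A -> 0 < b < 1 ->
  exists C, forall s : R, 0 <= s -> A * s `^ b <= c * s + C.
Proof.
move=> c0 A0 /andP[b0 b1].
(* The two sides A s^b and c s cross at [s0]: up to there the constant dominates, beyond it the
   linear term does. *)
pose s0 := (A / c) `^ (1 - b)^-1.
exists (A * s0 `^ b) => s s_ge0.
have [ss0|s0s] := leP s s0.
  rewrite -[leLHS]add0r lerD ?mulr_ge0 ?(ltW c0)//.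
  by rewrite ler_wpM2l// ge0_ler_powR ?nnegrE ?powR_ge0// ltW.
rewrite -[leLHS]addr0 lerD ?mulr_ge0 ?powR_ge0//.
have s_gt0 : 0 < s by rewrite (le_lt_trans _ s0s) ?powR_ge0.
have : A / c <= s `^ (1 - b).
  have -> : A / c = s0 `^ (1 - b).
    by rewrite /s0 -powRrM mulVf ?powRr1 ?divr_ge0 ?(ltW c0)// subr_eq0 gt_eqF.
  by rewrite ge0_ler_powR ?nnegrE ?powR_ge0 ?subr_ge0 ?(ltW b1)// ltW.
rewrite ler_pdivrMr// => /(ler_wpM2r (powR_ge0 s b)) /le_trans; apply.
rewrite mulrAC -powRD; last by apply/implyP => _; rewrite gt_eqF.
by rewrite subrK powRr1// mulrC.
Qed.

Lemma expR_decay c : 0 < c ->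
  exists2 K, 0 <= K & forall u, 0 <= u -> expR (- (c * u)) <= K / oneDsqr u.
Proof.
(* From exp x >= 1 + x^2 / 2 at x = c u: the 1 pays for the 1 of [oneDsqr], and u^2 <= (2 / c^2) exp
   (c u). *)
move=> c0; exists (1 + 2 / c ^+ 2) => [|u u0].
  by rewrite addr_ge0// divr_ge0// exprn_ge0// ltW.
rewrite ler_pdivlMr ?oneDsqr_gt0// expRN mulrC ler_pdivrMr ?expR_gt0//.
have := @expR_ge1Dxn R (c * u) 1 (mulr_ge0 (ltW c0) u0).
rewrite exprMn (_ : 2`!%:R = 2)// => h.
have h2 : u ^+ 2 <= 2 / c ^+ 2 * expR (c * u).
  rewrite mulrAC ler_pdivlMr ?exprn_gt0//; lra.
rewrite /oneDsqr mulrDl mul1r lerD//.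
by rewrite (le_trans _ h)// lerDl divr_ge0// mulr_ge0 ?sqr_ge0.
Qed.

Lemma expR_powR_decay c A b : 0 < c -> 0 <= A -> 0 < b < 1 ->
  exists2 K, 0 <= K &
  forall u, 0 <= u -> expR (- (c * u) + A * (u + 1) `^ b) <= K / oneDsqr u.
Proof.
move=> c0 A0 b01.
(* Half of the linear term absorbs the power, at the cost of the constant c / 2 + C since the power
   is taken at u + 1; the other half provides the decay. *)
have c20 : 0 < c / 2 by rewrite divr_gt0.
have [C hC] := powR_le_linear c20 A0 b01.
have [K K0 hK] := expR_decay c20.
exists (K * expR (c / 2 + C)) => [|u u0]; first by rewrite mulr_ge0 ?expR_ge0.
have -> : K * expR (c / 2 + C) / oneDsqr u = K / oneDsqr u * expR (c / 2 + C).
  by rewrite mulrAC.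
apply: le_trans (ler_wpM2r (expR_ge0 _) (hK _ u0)).
rewrite -expRD ler_expR.
have := hC (u + 1) (addr_ge0 u0 ler01); lra.
Qed.

Lemma expRN_powR_decay c b : 0 < c -> 2^-1 <= b ->
  exists2 K, 0 <= K & forall u, 0 <= u -> expR (- (c * u `^ b)) <= K / oneDsqr u.
Proof.
(* Here 24 is 4!: exp x >= 1 + x^4 / 24 at x = c u^b, and u^2 <= 1 + u^(4 b) because 4 b >= 2. *)
move=> c0 b2; exists (2 + 24 / c ^+ 4) => [|u u0].
  by rewrite addr_ge0// divr_ge0// exprn_ge0// ltW.
set x := c * u `^ b.
have x0 : 0 <= x by rewrite mulr_ge0 ?powR_ge0// ltW.
rewrite ler_pdivlMr ?oneDsqr_gt0// expRN mulrC ler_pdivrMr ?expR_gt0//.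
have := @expR_ge1Dxn R x 3 x0; rewrite (_ : 4`!%:R = 24)// => h.
have ex1 : 1 <= expR x by rewrite (le_trans _ h)// lerDl divr_ge0// exprn_ge0.
have h4 : u `^ b ^+ 4 <= 24 / c ^+ 4 * expR x.
  rewrite mulrAC ler_pdivlMr ?exprn_gt0// -exprMn mulrC -/x; lra.
have u2 : u ^+ 2 <= 1 + u `^ b ^+ 4.
  have [u1|u1] := leP u 1.
    by rewrite (le_trans (exprn_ile1 _ u0 u1))// lerDl exprn_ge0 ?powR_ge0.
  apply: ler_wpDl => //; rewrite -!powR_mulrn ?powR_ge0// -powRrM.
  by apply: ler_powR; [exact: ltW|lra].
rewrite /oneDsqr; nra.
Qed.

(** A single type of majorant serves all integrals over the half-line: it is integrable at both ends
    and stable under multiplication by bounded functions. *)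
Definition quadratic_decay f := measurable_fun setT f /\
  exists K, forall u, 0 < u -> `|f u| <= K / oneDsqr u.

Notation mu := (@lebesgue_measure R).

Lemma integrable_oneDsqrV K :
  mu.-integrable `]0, +oo[ (EFin \o (fun u => K / oneDsqr u)).
Proof.
rewrite [X in integrable _ _ X](_ : _ =
  (fun u => K%:E * (EFin \o (fun u => (oneDsqr u)^-1)%R) u)%E); last first.
  by apply/funext => u; rewrite /= EFinM.
apply: integrableZl => //.
have h : mu.-integrable `[0, +oo[ (EFin \o (fun u => (oneDsqr u)^-1)).
  apply/integrableP; split.
    by apply/measurable_EFinP/measurable_funTS; rewrite /oneDsqr; mfun.
  under eq_integral => x _.
    rewrite /= ger0_norm ?invr_ge0 ?(ltW (oneDsqr_gt0 _))//; over.
  by rewrite integral0y_oneDsqr ltry.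
by apply: integrableS h => //; apply: subset_itvr; rewrite bnd_simp.
Qed.

Lemma quadratic_decay_integrable f : quadratic_decay f ->
  mu.-integrable `]0, +oo[ (EFin \o f).
Proof.
move=> [mf [K fK]]; apply: integrable_le (integrable_oneDsqrV K) => //.
by move=> u; rewrite /= in_itv/= andbT; exact: fK.
Qed.

Lemma quadratic_decayM f g C : quadratic_decay f -> measurable_fun setT g ->
  (forall u, 0 < u -> `|g u| <= C) -> quadratic_decay (fun u => f u * g u).
Proof.
move=> [mf [K fK]] mg gC; split; first by mfun.
exists (C * K) => u u0; rewrite normrM mulrC -mulrA ler_pM//.
- exact: gC.
- exact: fK.
Qed.

End decay.

(** * Rotation of contours, in polar coordinates *)

Section derive_rules.
Context {R : realType}.
Implicit Types (f g : R -> R) (x a b : R).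

Lemma is_derive_add f g x a b : is_derive x 1 f a -> is_derive x 1 g b ->
  is_derive x 1 (fun y => f y + g y) (a + b).
Proof. by move=> df dg; exact: is_deriveD. Qed.

Lemma is_derive_sub f g x a b : is_derive x 1 f a -> is_derive x 1 g b ->
  is_derive x 1 (fun y => f y - g y) (a - b).
Proof. by move=> df dg; exact: is_deriveB. Qed.

Lemma is_derive_mul f g x a b : is_derive x 1 f a -> is_derive x 1 g b ->
  is_derive x 1 (fun y => f y * g y) (a * g x + f x * b).
Proof.
move=> df dg; apply: is_derive_eq (is_deriveM df dg) _.
by rewrite /GRing.scale/= addrC mulrC.
Qed.

Lemma is_derive_exp f x a : is_derive x 1 f a ->
  is_derive x 1 (fun y => expR (f y)) (expR (f x) * a).
Proof.
move=> df; exact: is_derive1_comp.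
Qed.

Lemma is_derive_sinf f x a : is_derive x 1 f a ->
  is_derive x 1 (fun y => sin (f y)) (cos (f x) * a).
Proof.
move=> df; exact: is_derive1_comp.
Qed.

Lemma is_derive_cosf f x a : is_derive x 1 f a ->
  is_derive x 1 (fun y => cos (f y)) (- sin (f x) * a).
Proof.
move=> df; exact: is_derive1_comp.
Qed.

Lemma is_derive_inv f x a : f x != 0 -> is_derive x 1 f a ->
  is_derive x 1 (fun y => (f y)^-1) (- (f x) ^- 2 * a).
Proof.
move=> f0 df; apply: is_derive_eq (is_deriveV f0 df) _.
by rewrite /GRing.scale/=.
Qed.

Lemma is_derive_continuous f x a : is_derive x 1 f a -> {for x, continuous f}.
Proof. by move=> [df _]; exact/differentiable_continuous/derivable1_diffP. Qed.

Notation mu := (@lebesgue_measure R).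

Lemma FTC_is_derive (f F : R -> R) a b : a < b ->
  (forall x, a <= x <= b -> is_derive x 1 F (f x)) ->
  (forall x, a <= x <= b -> {for x, continuous f}) ->
  mu.-integrable `[a, b] (EFin \o f) /\ \int[mu]_(x in `[a, b]) f x = F b - F a.
Proof.
move=> ab dF cf.
have cfw : {within `[a, b], continuous f}.
  apply: continuous_in_subspaceT => x; rewrite inE/= in_itv/= => xab.
  exact: cf.
split.
  by apply: continuous_compact_integrable => //; exact: segment_compact.
rewrite /Rintegral (@continuous_FTC2 _ f F)//.
- have cF x : a <= x <= b -> {for x, continuous F}.
    by move=> /dF; exact: is_derive_continuous.
  split.
  + by move=> x; rewrite in_itv/= => /andP[ax xb]; case: (dF x) => //; rewrite !ltW.
  + by apply: cvg_at_right_filter; apply: cF; rewrite lexx ltW.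
  + by apply: cvg_at_left_filter; apply: cF; rewrite lexx ltW.
- move=> x; rewrite in_itv/= => /andP[ax xb].
  by rewrite derive1E; case: (dF x) => //; rewrite !ltW.
Qed.

End derive_rules.

Section continuity_rules.
Context {R : realType} {T : topologicalType}.
Implicit Types (f g : T -> R) (z : T).

Lemma continuous_add f g z : {for z, continuous f} -> {for z, continuous g} ->
  {for z, continuous (fun x => f x + g x)}.
Proof. exact: cvgD. Qed.

Lemma continuous_mul f g z : {for z, continuous f} -> {for z, continuous g} ->
  {for z, continuous (fun x => f x * g x)}.
Proof. exact: cvgM. Qed.

Lemma continuous_opp f z : {for z, continuous f} ->
  {for z, continuous (fun x => - f x)}.
Proof. exact: cvgN. Qed.

End continuity_rules.

Ltac cfun := repeat first
  [ assumption
  | lazymatch goal with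
    | |- {for _, continuous (fun z => _ + _)} => apply: continuous_add
    | |- {for _, continuous (fun z => - _)} => apply: continuous_opp
    | |- {for _, continuous (fun z => _ * _)} => apply: continuous_mul
    end
  | exact: cvg_cst ].

Section polar.
Context {R : realType}.
Notation mu := (@lebesgue_measure R).

(* With J + i M the polar form of a function of z = r e^(i phi), its complex
   derivative times e^(i phi) is A + i B, and the Cauchy-Riemann equations read
   d_r (J + i M) = A + i B, d_phi (J + i M) = i r (A + i B). *)
Definition polar_holomorphic (Om : set (R * R)) (J M A B : R * R -> R) : Prop :=
  [/\ measurable_fun setT J, measurable_fun setT M,
      measurable_fun setT A & measurable_fun setT B] /\
  forall z, Om z ->
  [/\ {for z, continuous J}, {for z, continuous M},
      {for z, continuous A} & {for z, continuous B}] /\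
  [/\ is_derive z.1 1 (fun r => J (r, z.2)) (A z),
      is_derive z.1 1 (fun r => M (r, z.2)) (B z),
      is_derive z.2 1 (fun p => J (z.1, p)) (- (z.1 * B z)) &
      is_derive z.2 1 (fun p => M (z.1, p)) (z.1 * A z)].

Variable Om : set (R * R).

Lemma polar_cst (c : R) :
  polar_holomorphic Om (fun=> c) (fun=> 0) (fun=> 0) (fun=> 0).
Proof.
split; first by split; exact: measurable_cst.
move=> z _; split; first by split; exact: cvg_cst.
by rewrite !mulr0 oppr0; split; exact: is_derive_cst.
Qed.

Lemma polar_add J1 M1 A1 B1 J2 M2 A2 B2 :
  polar_holomorphic Om J1 M1 A1 B1 -> polar_holomorphic Om J2 M2 A2 B2 ->
  polar_holomorphic Om (fun z => J1 z + J2 z) (fun z => M1 z + M2 z)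
                       (fun z => A1 z + A2 z) (fun z => B1 z + B2 z).
Proof.
move=> [[? ? ? ?] H1] [[? ? ? ?] H2]; split; first by split; mfun.
move=> z Oz; have [[c1 c2 c3 c4] [d1 d2 d3 d4]] := H1 _ Oz.
have [[e1 e2 e3 e4] [g1 g2 g3 g4]] := H2 _ Oz.
split; first by split; cfun.
split.
- exact: is_derive_add.
- exact: is_derive_add.
- by apply: is_derive_eq (is_derive_add d3 g3) _; ring.
- by apply: is_derive_eq (is_derive_add d4 g4) _; ring.
Qed.

Lemma polar_mul J1 M1 A1 B1 J2 M2 A2 B2 :
  polar_holomorphic Om J1 M1 A1 B1 -> polar_holomorphic Om J2 M2 A2 B2 ->
  polar_holomorphic Om (fun z => J1 z * J2 z - M1 z * M2 z)
    (fun z => J1 z * M2 z + M1 z * J2 z)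
    (fun z => (A1 z * J2 z + J1 z * A2 z) - (B1 z * M2 z + M1 z * B2 z))
    (fun z => (A1 z * M2 z + J1 z * B2 z) + (B1 z * J2 z + M1 z * A2 z)).
Proof.
move=> [[? ? ? ?] H1] [[? ? ? ?] H2]; split; first by split; mfun.
move=> [r p] Oz; have [[c1 c2 c3 c4] [d1 d2 d3 d4]] := H1 _ Oz.
have [[e1 e2 e3 e4] [g1 g2 g3 g4]] := H2 _ Oz.
split.
  by split; cfun.
split => /=.
- exact: is_derive_sub (is_derive_mul d1 g1) (is_derive_mul d2 g2).
- exact: is_derive_add (is_derive_mul d1 g2) (is_derive_mul d2 g1).
- apply: is_derive_eq (is_derive_sub (is_derive_mul d3 g3) (is_derive_mul d4 g4)) _.
  by move=> /=; ring.
- apply: is_derive_eq (is_derive_add (is_derive_mul d3 g4) (is_derive_mul d4 g3)) _.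
  by move=> /=; ring.
Qed.

Lemma polar_exp J M A B : polar_holomorphic Om J M A B ->
  polar_holomorphic Om (fun z => expR (J z) * cos (M z))
    (fun z => expR (J z) * sin (M z))
    (fun z => expR (J z) * (A z * cos (M z) - B z * sin (M z)))
    (fun z => expR (J z) * (A z * sin (M z) + B z * cos (M z))).
Proof.
move=> [[? ? ? ?] H1]; split; first by split; mfun.
move=> [r p] Oz; have [[c1 c2 c3 c4] [d1 d2 d3 d4]] := H1 _ Oz.
have ce : {for (r, p), continuous (fun z => expR (J z))}.
  by apply: continuous_comp => //; exact: continuous_expR.
have cc : {for (r, p), continuous (fun z => cos (M z))}.
  by apply: continuous_comp => //; exact: continuous_cos.
have cs : {for (r, p), continuous (fun z => sin (M z))}.
  by apply: continuous_comp => //; exact: continuous_sin.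
split.
  by split; cfun.
split => /=.
- apply: is_derive_eq (is_derive_mul (is_derive_exp d1) (is_derive_cosf d2)) _.
  by move=> /=; ring.
- apply: is_derive_eq (is_derive_mul (is_derive_exp d1) (is_derive_sinf d2)) _.
  by move=> /=; ring.
- apply: is_derive_eq (is_derive_mul (is_derive_exp d3) (is_derive_cosf d4)) _.
  by move=> /=; ring.
- apply: is_derive_eq (is_derive_mul (is_derive_exp d3) (is_derive_sinf d4)) _.
  by move=> /=; ring.
Qed.

(** The inverse is (J - i M) / (J^2 + M^2), and its derivative is - (A + i B) (J - i M)^2 / (J^2 +
    M^2)^2, expanded into real and imaginary parts. *)
Lemma polar_inv J M A B : polar_holomorphic Om J M A B ->
  (forall z, Om z -> J z * J z + M z * M z != 0) ->
  polar_holomorphic Om (fun z => J z * (J z * J z + M z * M z)^-1)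
    (fun z => - (M z * (J z * J z + M z * M z)^-1))
    (fun z => - ((A z * (J z * J z - M z * M z) + (B z + B z) * (J z * M z))
              * ((J z * J z + M z * M z)^-1 * (J z * J z + M z * M z)^-1)))
    (fun z => - ((B z * (J z * J z - M z * M z) - (A z + A z) * (J z * M z))
              * ((J z * J z + M z * M z)^-1 * (J z * J z + M z * M z)^-1))).
Proof.
move=> [[? ? ? ?] H1] N0; split; first by split; mfun.
move=> [r p] Oz; have [[c1 c2 c3 c4] [d1 d2 d3 d4]] := H1 _ Oz.
have cN : {for (r, p), continuous (fun z => (J z * J z + M z * M z)^-1)}.
  apply: cvgV; first exact: N0.
  by apply: cvgD; exact: cvgM.
have {}n0 := N0 _ Oz.
split.
  by split; cfun.
have dN (x : R) (f g : R -> R) (a b : R) : f x * f x + g x * g x != 0 ->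
    is_derive x 1 f a -> is_derive x 1 g b ->
    is_derive x 1 (fun y => (f y * f y + g y * g y)^-1)
      (- (f x * f x + g x * g x) ^- 2 * ((a * f x + f x * a) + (b * g x + g x * b))).
  move=> n df dg; apply: is_derive_inv => //.
  exact: is_derive_add (is_derive_mul df df) (is_derive_mul dg dg).
have dNn (f : R -> R) (x a : R) : is_derive x 1 f a -> is_derive x 1 (fun y => - f y) (- a).
  by move=> df; exact: is_deriveN.
split => /=.
- apply: is_derive_eq (is_derive_mul d1 (dN _ _ _ _ _ _ d1 d2)) _ => //.
  by move=> /=; field.
- apply: is_derive_eq (dNn _ _ _ (is_derive_mul d2 (dN _ _ _ _ _ _ d1 d2))) _ => //.
  by move=> /=; field.
- apply: is_derive_eq (is_derive_mul d3 (dN _ _ _ _ _ _ d3 d4)) _ => //.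
  by move=> /=; field.
- apply: is_derive_eq (dNn _ _ _ (is_derive_mul d4 (dN _ _ _ _ _ _ d3 d4))) _ => //.
  by move=> /=; field.
Qed.

(** The derivative b z^(b - 1) is multiplied by e^(i phi), which restores the angle b phi next to
    the modulus r^(b - 1). The angle being a coordinate, there is no branch cut. *)
Lemma polar_powR (b : R) : (forall z, Om z -> 0 < z.1) ->
  polar_holomorphic Om (fun z => z.1 `^ b * cos (b * z.2))
    (fun z => z.1 `^ b * sin (b * z.2))
    (fun z => b * (z.1 `^ (b - 1) * cos (b * z.2)))
    (fun z => b * (z.1 `^ (b - 1) * sin (b * z.2))).
Proof.
move=> O0; split; first by split; mfun.
move=> [r p] /O0 /= r0.
have cp a : {for (r, p), continuous (fun z : R * R => z.1 `^ a)}.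
  apply: (@continuous_comp _ _ _ fst (fun x => x `^ a)); first exact: cvg_fst.
  exact: is_derive_continuous (is_derive1_powR a r0).
have cb : {for (r, p), continuous (fun z : R * R => b * z.2)}.
  by apply: cvgM; [exact: cvg_cst | exact: cvg_snd].
have cc : {for (r, p), continuous (fun z : R * R => cos (b * z.2))}.
  by apply: continuous_comp => //; exact: continuous_cos.
have cs : {for (r, p), continuous (fun z : R * R => sin (b * z.2))}.
  by apply: continuous_comp => //; exact: continuous_sin.
split.
  have cp1 := cp b; have cp2 := cp (b - 1).
  by split; cfun.
have dp : is_derive r 1 (fun x => x `^ b) (b * r `^ (b - 1)) by exact: is_derive1_powR.
have db : is_derive p 1 (fun x => b * x) b.
  apply: is_derive_eq (is_derive_mul (is_derive_cst b p 1) (is_derive_id p 1)) _.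
  by rewrite /cst/=; ring.
have pE : r `^ b = r * r `^ (b - 1).
  rewrite -[X in _ = X * _](powRr1 (ltW r0)) -powRD; last first.
    by apply/implyP => _; rewrite gt_eqF.
  by rewrite addrC subrK.
split => /=.
- apply: is_derive_eq (is_derive_mul dp (is_derive_cst (cos (b * p)) r 1)) _ => //=.
  by rewrite /cst/=; ring.
- apply: is_derive_eq (is_derive_mul dp (is_derive_cst (sin (b * p)) r 1)) _ => //=.
  by rewrite /cst/=; ring.
- apply: is_derive_eq (is_derive_mul (is_derive_cst (r `^ b) p 1) (is_derive_cosf db)) _.
  by rewrite /cst/= pE; ring.
- apply: is_derive_eq (is_derive_mul (is_derive_cst (r `^ b) p 1) (is_derive_sinf db)) _.
  by rewrite /cst/= pE; ring.
Qed.

End polar.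

(** * Green's formula and Cauchy's theorem on a sector *)

Section rotation.
Context {R : realType}.
Notation mu := (@lebesgue_measure R).
Variables (Om : set (R * R)) (J M A B : R * R -> R).
Hypothesis polJ : polar_holomorphic Om J M A B.

Lemma continuous_pair1 (f : R * R -> R) (r p : R) :
  {for (r, p), continuous f} -> {for r, continuous (fun x => f (x, p))}.
Proof.
move=> cf; apply: (@continuous_comp _ _ _ (fun x => (x, p)) f) => //.
by apply: (@cvg_pair _ _ _ (nbhs r) (nbhs r) (nbhs p)); [exact: cvg_id|exact: cvg_cst].
Qed.

Lemma continuous_pair2 (f : R * R -> R) (r p : R) :
  {for (r, p), continuous f} -> {for p, continuous (fun x => f (r, x))}.
Proof.
move=> cf; apply: (@continuous_comp _ _ _ (fun x => (r, x)) f) => //.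
by apply: (@cvg_pair _ _ _ (nbhs p) (nbhs r) (nbhs p)); [exact: cvg_cst|exact: cvg_id].
Qed.

Lemma continuous_rectangle_bounded (f : R * R -> R) (a b c d : R) :
  (forall r p, a <= r <= b -> c <= p <= d -> {for (r, p), continuous f}) ->
  exists K, forall r p, a <= r <= b -> c <= p <= d -> `|f (r, p)| <= K.
Proof.
move=> cf.
have /compact_bounded : compact (f @` (`[a, b] `*` `[c, d])).
  apply: continuous_compact.
    apply: continuous_in_subspaceT => -[r p]; rewrite inE => -[/=].
    by rewrite !in_itv/=; exact: cf.
  by apply: compact_setX; exact: segment_compact.
move=> [K [_ /(_ (K + 1))]]; rewrite ltrDl ltr01 => /(_ isT) hK.
exists (K + 1) => r p rab pcd; apply: hK.
by exists (r, p) => //; split; rewrite /= in_itv.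
Qed.

(* Green's formula for the closed form Im (F dz / z) on a sector of an annulus. *)
Lemma polar_green (a b p1 p2 : R) : 0 < a -> a < b -> p1 < p2 ->
  (forall r p, a <= r <= b -> p1 <= p <= p2 -> Om (r, p)) ->
  \int[mu]_(r in `[a, b]) ((M (r, p2) - M (r, p1)) / r) =
  \int[mu]_(p in `[p1, p2]) (J (b, p) - J (a, p)).
Proof.
move=> a0 ab p12 sub.
have [[mJ mM mA mB] pol] := polJ.
have H r p : a <= r <= b -> p1 <= p <= p2 -> _ := fun h k => pol _ (sub r p h k).
have cA r p : a <= r <= b -> p1 <= p <= p2 -> {for (r, p), continuous A}.
  by move=> h k; have [[_ _ ? _] _] := H _ _ h k.
have [K AK] := continuous_rectangle_bounded cA.
(* Both sides equal the double integral of A, since d_phi M = r A and d_r J = A. *)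
transitivity (\int[mu]_(r in `[a, b]) \int[mu]_(p in `[p1, p2]) A (r, p)).
  apply: eq_Rintegral => r; rewrite inE/= in_itv/= => rab.
  have r0 : 0 < r by case/andP: rab => /(lt_le_trans a0).
  have [|| _ E] := @FTC_is_derive R (fun p => A (r, p)) (fun p => r^-1 * M (r, p)) _ _ p12.
  - move=> p pp; have [_ [_ _ _ dM]] := H _ _ rab pp.
    apply: is_derive_eq (is_derive_mul (is_derive_cst r^-1 p 1) dM) _.
    by rewrite /cst/= mul0r add0r mulrA mulVf ?mul1r// gt_eqF.
  - by move=> p pp; apply: continuous_pair2; exact: cA.
  by rewrite E; ring.
rewrite (@Rfubini _ _ _ _ _ mu mu `[a, b]%classic `[p1, p2]%classic
  _ _ (fun r p => A (r, p)) (cst K) (cst 1)) //; last first.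
- by move=> r p; rewrite /= !in_itv/= mulr1; exact: AK.
- apply: continuous_compact_integrable; first exact: segment_compact.
  by apply: continuous_subspaceT => x; exact: cvg_cst.
- apply: continuous_compact_integrable; first exact: segment_compact.
  by apply: continuous_subspaceT => x; exact: cvg_cst.
- by rewrite [X in measurable_fun _ X](_ : _ = A)//; apply/funext => -[].
apply: eq_Rintegral => p; rewrite inE/= in_itv/= => pp.
have [|| _ E] := @FTC_is_derive R (fun r => A (r, p)) (fun r => J (r, p)) _ _ ab.
- by move=> r rr; have [_ [dJ _ _ _]] := H _ _ rr pp.
- by move=> r rr; apply: continuous_pair1; exact: cA.
by rewrite E.
Qed.

Variables (p1 p2 K : R).
Hypothesis p12 : p1 < p2.
Hypothesis OmH : forall r p, 0 < r -> p1 <= p <= p2 -> Om (r, p).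
Hypothesis JK : forall r p, 0 < r -> p1 <= p <= p2 -> `|J (r, p)| <= K * r / oneDsqr r.
Hypothesis MK : forall r p, 0 < r -> p1 <= p <= p2 -> `|M (r, p)| <= K * r / oneDsqr r.

Lemma polar_ray_decay p : p1 <= p <= p2 ->
  quadratic_decay (fun r => M (r, p) / r).
Proof.
move=> pp; have [[mJ mM mA mB] _] := polJ; split.
  apply: measurable_funM; first exact: measurable_fun_pair1.
  exact: measurable_invr.
exists K => r r0; rewrite normrM normfV (gtr0_norm r0) ler_pdivrMr//.
by rewrite mulrAC; exact: MK.
Qed.

(* Cauchy's theorem on a sector: [polar_green] with a -> 0 and b -> +oo. *)
Lemma polar_rotation :
  \int[mu]_(r in `]0, +oo[) (M (r, p2) / r) =
  \int[mu]_(r in `]0, +oo[) (M (r, p1) / r).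
Proof.
have p1p : p1 <= p1 <= p2 by rewrite lexx ltW.
have p2p : p1 <= p2 <= p2 by rewrite lexx ltW.
have [[mJ mM mA mB] _] := polJ.
have D := polar_ray_decay; have I p pp := quadratic_decay_integrable (D p pp).
have K0 : 0 <= K.
  have := JK ltr01 p1p; rewrite mulr1 => /(le_trans (normr_ge0 _)).
  by rewrite pmulr_lge0// invr_gt0 oneDsqr_gt0.
pose f r := (M (r, p2) - M (r, p1)) / r.
have mf : measurable_fun setT f.
  apply: measurable_funM; last exact: measurable_invr.
  by apply: measurable_funB; exact: measurable_fun_pair1.
apply/eqP; rewrite -subr_eq0 -RintegralB ?I//; apply/eqP.
under eq_Rintegral do rewrite -mulrBl.
(* With n + 2 instead of n + 1 the inner radius is strictly below the outer one for every n, as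
   [polar_green] asks. *)
pose E n := `[n.+2%:R^-1, n.+2%:R]%classic : set R.
have mE n : measurable (E n) by exact: measurable_itv.
have E0 n x : E n x -> 0 < x.
  by rewrite /E/= in_itv/= => /andP[+ _]; apply: lt_le_trans; rewrite invr_gt0.
have mf1 n : measurable_fun setT (fun r => f r * \1_(E n) r).
  by apply: measurable_funM => //; exact: measurable_indic.
have [|||_ cf] := @Rdominated_cvg _ _ _ mu `]0, +oo[%classic (measurable_itv _)
  (fun n r => f r * \1_(E n) r) f (fun r => (K + K) / oneDsqr r) mf1 mf.
- move=> x; rewrite /= in_itv/= andbT => x0.
  apply: cvg_near_cst.
  near=> n; rewrite indicE mem_set ?mulr1// /E/= in_itv/=; apply/andP; split.
    rewrite invf_ple ?posrE//; near: n.
    apply: filterS (nbhs_infty_ger x^-1) => n /le_trans; apply.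
    by rewrite ler_nat -addn2 leq_addr.
  near: n; apply: filterS (nbhs_infty_ger x) => n /le_trans; apply.
  by rewrite ler_nat -addn2 leq_addr.
- move=> n x; rewrite /= in_itv/= andbT => x0.
  rewrite normrM (le_trans (ler_piMr _ _))//.
    by rewrite indicE normr_nat; case: (_ \in _).
  rewrite /f normrM normfV (gtr0_norm x0) ler_pdivrMr//.
  apply: le_trans (ler_normB _ _) _.
  apply: le_trans (lerD (MK x0 p2p) (MK x0 p1p)) _.
  by rewrite -mulrDl -mulrDl mulrAC.
- exact: integrable_oneDsqrV.
rewrite -(cvg_lim (@Rhausdorff _) cf); apply: cvg_lim; first exact: Rhausdorff.
apply/cvgrPdist_le => e e0; near=> n.
rewrite sub0r normrN.
have -> : \int[mu]_(x in `]0, +oo[) (f x * \1_(E n) x) = \int[mu]_(x in E n) f x.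
  rewrite (_ : E n = `]0, +oo[ `&` E n); last first.
    apply/seteqP; split => x //= xE; last by case: xE.
    by split=> //; rewrite in_itv/= andbT; exact: E0 xE.
  rewrite Rintegral_mkcondr; apply: eq_Rintegral => x _.
  rewrite patchE indicE (_ : _ \in (_ `&` _) = (x \in E n)).
    by case: ifP => _; rewrite ?mulr1 ?mulr0.
  apply/idP/idP; rewrite !inE; first by case.
  by move=> xE; split=> //; rewrite /= in_itv/= andbT; exact: E0 xE.
have n1 : (n.+2%:R^-1 : R) < n.+2%:R.
  by rewrite (@lt_trans _ _ 1) ?invf_lt1 ?ltr1n.
rewrite (@polar_green _ _ p1 p2)//; last first.
  by move=> r p /andP[+ _] pp; move=> /(lt_le_trans _) h; apply: OmH => //; apply: h; rewrite invr_gt0.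
have b0 : (0 : R) < n.+2%:R by [].
(* On each of the two arcs |J| <= K / n.+2: the bound K r / (1 + r^2) is at most K / r, used on the
   outer arc, and at most K r, used on the inner one. *)
apply: le_trans (@Rintegral_norm_le _ _ _ mu `[p1, p2]%classic _ _
   (cst (K / n.+2%:R + K / n.+2%:R)) _ _ _) _ => //.
- by apply: measurable_funB; exact: measurable_fun_pair2.
- move=> p; rewrite /= in_itv/= => pp.
  apply: le_trans (ler_normB _ _) _; apply: lerD.
    apply: le_trans (JK b0 pp) _.
    rewrite -mulrA ler_wpM2l// ler_pdivrMr ?oneDsqr_gt0// mulrC ler_pdivlMr//.
    by rewrite -expr2 /oneDsqr lerDr.
  have ib0 : 0 < n.+2%:R^-1 :> R by rewrite invr_gt0.
  apply: le_trans (JK ib0 pp) _.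
  rewrite ler_piMr ?divr_ge0//.
  by rewrite invf_le1 ?oneDsqr_ge1 ?oneDsqr_gt0.
- apply: continuous_compact_integrable; first exact: segment_compact.
  by apply: continuous_subspaceT => x; exact: cvg_cst.
rewrite Rintegral_cst//= lebesgue_measure_itv/= lte_fin p12 /=.
rewrite -mulrDl mulrAC ler_pdivrMr// mulrC -ler_pdivrMl//.
near: n; apply: filterS (nbhs_infty_ger (e^-1 * ((p2 - p1) * (K + K)))) => n /le_trans; apply.
by rewrite ler_nat -addn2 leq_addr.
Unshelve. all: by end_near. Qed.

End rotation.

(** * Density of the first passage time *)

Section halfline.
Context {R : realType}.
Notation mu := (@lebesgue_measure R).

Lemma FTC_halfline (f F : R -> R) (l : R) : quadratic_decay f ->
  (forall x : R, 0 <= x -> is_derive x 1 F (f x)) ->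
  (forall x : R, 0 <= x -> {for x, continuous f}) ->
  F x @[x --> +oo] --> l ->
  \int[mu]_(x in `]0, +oo[) f x = l - F 0.
Proof.
move=> qf dF cf Fl; have [mf [K fK]] := qf.
pose E n := `]0, n.+1%:R]%classic : set R.
have mE n : measurable (E n) by exact: measurable_itv.
have mf1 n : measurable_fun setT (fun r => f r * \1_(E n) r).
  by apply: measurable_funM => //; exact: measurable_indic.
have [|||_ cI] := @Rdominated_cvg _ _ _ mu `]0, +oo[%classic (measurable_itv _)
  (fun n r => f r * \1_(E n) r) f (fun r => K / oneDsqr r) mf1 mf.
- move=> x; rewrite /= in_itv/= andbT => x0.
  apply: cvg_near_cst; near=> n.
  rewrite indicE mem_set ?mulr1// /E/= in_itv/= x0/=.
  near: n; apply: filterS (nbhs_infty_ger x) => n /le_trans; apply.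
  by rewrite ler_nat.
- move=> n x; rewrite /= in_itv/= andbT => x0.
  rewrite normrM (le_trans (ler_piMr _ _)) ?fK//.
  by rewrite indicE normr_nat; case: (_ \in _).
- exact: integrable_oneDsqrV.
rewrite -(cvg_lim (@Rhausdorff _) cI); apply: cvg_lim; first exact: Rhausdorff.
rewrite (_ : (fun n => _) = (fun n => F n.+1%:R - F 0)).
  apply: cvgB; last exact: cvg_cst.
  apply: (cvg_comp _ _ _ Fl).
  by apply/cvgryPge => A; near=> n; near: n;
    apply: filterS (nbhs_infty_ger A) => n /le_trans; apply; rewrite ler_nat.
apply/funext => n.
have [||iF <-] := @FTC_is_derive R f F 0 n.+1%:R (ltr0Sn _ _).
- by move=> x /andP[x0 _]; exact: dF.
- by move=> x /andP[x0 _]; exact: cf.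
rewrite -Rintegral_itv_obnd_cbnd; last first.
  by apply: integrableS iF => //; apply: subset_itvr; rewrite bnd_simp.
rewrite -/(E n) (_ : E n = `]0, +oo[ `&` E n); last first.
  apply/seteqP; split => x //= xE; last by case: xE.
  by split=> //; move: xE; rewrite /E/= !in_itv/= andbT => /andP[].
rewrite Rintegral_mkcondr; apply: eq_Rintegral => x.
rewrite inE/= => x0; rewrite patchE indicE (_ : (x \in _ `&` _) = (x \in E n)).
  by case: ifP => _; rewrite ?mulr1 ?mulr0.
by apply/idP/idP; rewrite !inE; [case|].
Unshelve. all: by end_near. Qed.

End halfline.

Section polar_extra.
Context {R : realType}.
Variable Om : set (R * R).

Lemma polar_scale (c : R) J M A B : polar_holomorphic Om J M A B ->
  polar_holomorphic Om (fun z => c * J z) (fun z => c * M z)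
                       (fun z => c * A z) (fun z => c * B z).
Proof.
move=> [[? ? ? ?] H1]; split; first by split; mfun.
move=> [r p] Oz; have [[c1 c2 c3 c4] [d1 d2 d3 d4]] := H1 _ Oz.
split; first by split; cfun.
have ds (f : R -> R) (x a : R) : is_derive x 1 f a ->
    is_derive x 1 (fun y => c * f y) (c * a).
  move=> df; apply: is_derive_eq (is_derive_mul (is_derive_cst c x 1) df) _.
  by rewrite /cst/=; ring.
split => /=; [exact: ds|exact: ds| |].
- by apply: is_derive_eq (ds _ _ _ d3) _; rewrite /=; ring.
- by apply: is_derive_eq (ds _ _ _ d4) _; rewrite /=; ring.
Qed.

Lemma polar_id : polar_holomorphic Om (fun z => z.1 * cos z.2)
  (fun z => z.1 * sin z.2) (fun z => cos z.2) (fun z => sin z.2).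
Proof.
split; first by split; mfun.
move=> [r p] _.
have c1 : {for (r, p), continuous (fun z : R * R => z.1)} by exact: cvg_fst.
have cc : {for (r, p), continuous (fun z : R * R => cos z.2)}.
  by apply: continuous_comp; [exact: cvg_snd|exact: continuous_cos].
have cs : {for (r, p), continuous (fun z : R * R => sin z.2)}.
  by apply: continuous_comp; [exact: cvg_snd|exact: continuous_sin].
split; first by split; cfun.
have di (x : R) : is_derive x 1 (fun y : R => y) 1 by exact: is_derive_id.
split => /=.
- apply: is_derive_eq (is_derive_mul (di r) (is_derive_cst (cos p) r 1)) _.
  by rewrite /cst/=; ring.
- apply: is_derive_eq (is_derive_mul (di r) (is_derive_cst (sin p) r 1)) _.
  by rewrite /cst/=; ring.
- apply: is_derive_eq (is_derive_mul (is_derive_cst r p 1) (is_derive_cosf (di p))) _.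
  by rewrite /cst/=; ring.
- apply: is_derive_eq (is_derive_mul (is_derive_cst r p 1) (is_derive_sinf (di p))) _.
  by rewrite /cst/=; ring.
Qed.

End polar_extra.

(** * From the negative real axis to the imaginary axis *)

Section stable_density.
Context {R : realType}.
Notation mu := (@lebesgue_measure R).
Variable b : R.
Hypothesis b_half : 2^-1 < b.
Hypothesis b_lt1 : b < 1.

Let b_gt0 : 0 < b. Proof. by rewrite (lt_trans _ b_half). Qed.

(** Minus the imaginary part of exp (- y z^b) at z = u e^(i pi), that is, on the upper side of the
    cut. *)
Definition stable_kernel (y u : R) : R :=
  expR (- (y * u `^ b * cos (pi * b))) * sin (y * u `^ b * sin (pi * b)).

Lemma cos_halfpi_gt0 : 0 < cos (pi / 2 * b).
Proof.
apply: cos_gt0_pihalf; rewrite (@lt_trans _ _ 0) ?oppr_lt0 ?divr_gt0 ?pi_gt0//=.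
  by rewrite -[ltRHS]mulr1 ltr_pM2l ?divr_gt0 ?pi_gt0.
by rewrite !mulr_gt0 ?pi_gt0.
Qed.

Lemma ltr_cos_pi (x y : R) : 0 <= x -> x < y -> y <= pi -> cos y < cos x.
Proof.
move=> x0 xy yp; rewrite ltr_cos// in_itv/=; apply/andP; split=> //; lra.
Qed.

Lemma ler_cos_pi (x y : R) : 0 <= x -> x <= y -> y <= pi -> cos y <= cos x.
Proof.
move=> x0; rewrite le_eqVlt => /predU1P[->//|xy] yp.
by apply: ltW; exact: ltr_cos_pi.
Qed.

Lemma sector_decay (t y : R) : 0 < t -> 0 < y ->
  exists2 K, 0 <= K & forall r p : R, 0 < r -> pi / 2 <= p <= pi ->
  expR (t * (r * cos p) + - y * (r `^ b * cos (b * p))) <= K / oneDsqr r.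
Proof.
move=> t0 y0; have pi0 := @pi_gt0 R.
pose f0 := (pi / 2 + pi / 2 / b) / 2.
have bV : 1 < b^-1 < 2.
  by rewrite invf_gt1// b_lt1/= invf_plt ?posrE.
have f0_gt : pi / 2 < f0 by rewrite /f0; case/andP: bV => ? ?; nra.
have f0_lt : f0 < pi by rewrite /f0; case/andP: bV => ? ?; nra.
have bf0 : b * f0 < pi / 2.
  have -> : b * f0 = (b * (pi / 2) + pi / 2) / 2 by rewrite /f0; field; rewrite gt_eqF.
  have h : 0 < pi * (1 - b) by rewrite mulr_gt0 ?subr_gt0.
  lra.
have f0_gt0 : 0 < f0 by rewrite (lt_trans _ f0_gt)// divr_gt0.
have c1 : 0 < cos (b * f0).
  apply: cos_gt0_pihalf; rewrite bf0 andbT.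
  have : 0 < b * f0 by rewrite mulr_gt0.
  lra.
have c2 : 0 < - cos f0.
  by rewrite oppr_gt0 -(@cos_pihalf R) ltr_cos_pi//; lra.
have [K1 K10 hK1] := expRN_powR_decay (mulr_gt0 y0 c1) (ltW b_half).
have [|K2 K20 hK2] := @expR_powR_decay R (t * - cos f0) y b (mulr_gt0 t0 c2) (ltW y0).
  by rewrite b_gt0.
exists (K1 + K2) => [|r p r0 /andP[p1 p2]]; first exact: addr_ge0.
have p0 : 0 <= p by rewrite (le_trans _ p1)// divr_ge0 ?ltW.
rewrite mulrDl; have [pf|fp] := leP p f0.
  rewrite -[leLHS]addr0 lerD ?divr_ge0 ?(ltW (oneDsqr_gt0 _))//.
  apply: le_trans (hK1 _ (ltW r0)); rewrite ler_expR.
  have h1 : cos p <= 0.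
    by rewrite -(@cos_pihalf R) ler_cos_pi//; lra.
  have h2 : cos (b * f0) <= cos (b * p).
    by rewrite ler_cos_pi ?ler_pM2l// ?mulr_ge0 ?(ltW b_gt0)//; lra.
  have : t * (r * cos p) <= 0 by rewrite mulr_ge0_le0 ?(ltW t0)// mulr_ge0_le0 ?(ltW r0).
  have : 0 <= y * r `^ b by rewrite mulr_ge0 ?powR_ge0 ?(ltW y0).
  set X := _ * (r * _); move: (r `^ b) => Y Y0 X0; nra.
rewrite -[leLHS]add0r lerD ?divr_ge0 ?(ltW (oneDsqr_gt0 _))//.
apply: le_trans (hK2 _ (ltW r0)); rewrite ler_expR lerD//.
  have -> : - (t * - cos f0 * r) = t * (r * cos f0) by ring.
  by rewrite !ler_pM2l//; apply: ler_cos_pi => //; exact: ltW.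
rewrite mulNr -mulrN ler_pM2l//.
apply: (@le_trans _ _ (r `^ b)); last first.
  by rewrite ge0_ler_powR ?nnegrE ?ltW ?addr_gt0// ltrDl.
by rewrite -mulrN ler_piMr ?powR_ge0// lerNl cos_geN1.
Qed.

(** Rotation of exp (t z - y z^b) dz between the angles pi / 2 and pi. Since [polar_rotation]
    integrates against dz / z, it is applied to z exp (t z - y z^b). *)
Lemma stable_kernel_rotation (t y : R) : 0 < t -> 0 < y ->
  \int[mu]_(u in `]0, +oo[) (expR (- (u * t)) * stable_kernel y u) =
  \int[mu]_(u in `]0, +oo[) (expR (- (y * u `^ b * cos (pi / 2 * b)))
                            * cos (u * t - y * u `^ b * sin (pi / 2 * b))).
Proof.
move=> t0 y0; have pi0 := @pi_gt0 R.
pose Om : set (R * R) := [set z | 0 < z.1].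
have pol := polar_mul (polar_id Om) (polar_exp (polar_add
  (polar_scale t (polar_id Om)) (polar_scale (- y) (@polar_powR _ Om b (fun z h => h))))).
have [K K0 hK] := sector_decay t0 y0.
have p12 : pi / 2 < pi :> R by nra.
have bnd (r p e c1 c2 : R) : 0 < r -> 0 <= e -> e <= K / oneDsqr r ->
    `|r * cos p * (e * c1) + r * sin p * (e * c2)| <= K * r / oneDsqr r *
      (`|cos p| * `|c1| + `|sin p| * `|c2|).
  move=> r0 e0 eK; apply: le_trans (ler_normD _ _) _.
  rewrite !normrM (gtr0_norm r0) (ger0_norm e0).
  have -> : r * `|cos p| * (e * `|c1|) + r * `|sin p| * (e * `|c2|) =
     r * e * (`|cos p| * `|c1| + `|sin p| * `|c2|) by ring.
  rewrite ler_wpM2r ?addr_ge0 ?mulr_ge0//.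
  have -> : K * r / oneDsqr r = r * (K / oneDsqr r) by ring.
  by rewrite ler_pM2l.
have cs1 (x : R) : `|cos x| <= 1 by exact: cos_max.
have sn1 (x : R) : `|sin x| <= 1 by exact: sin_max.
have ub (x y' z w : R) : `|x| <= 1 -> `|y'| <= 1 -> `|z| <= 1 -> `|w| <= 1 ->
    `|x| * `|y'| + `|z| * `|w| <= 2.
  move=> ? ? ? ?; have -> : (2 : R) = 1 * 1 + 1 * 1 by ring.
  by apply: lerD; exact: ler_pM.
have Kr (r : R) : 0 < r -> K * r / oneDsqr r * 2 = (K * 2) * r / oneDsqr r.
  by move=> _; ring.
have Kr0 (r : R) : 0 < r -> 0 <= K * r / oneDsqr r.
  by move=> r0; rewrite !mulr_ge0 ?invr_ge0 ?(ltW (oneDsqr_gt0 _))// ltW.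
have := polar_rotation pol (K := K * 2) p12 _ _ _.
move=> /(_ (fun (r p : R) r0 _ => r0)) rot.
transitivity (\int[mu]_(r in `]0, +oo[) ((r * cos pi *
        (expR (t * (r * cos pi) + - y * (r `^ b * cos (b * pi))) *
         sin (t * (r * sin pi) + - y * (r `^ b * sin (b * pi)))) +
        r * sin pi *
        (expR (t * (r * cos pi) + - y * (r `^ b * cos (b * pi))) *
         cos (t * (r * sin pi) + - y * (r `^ b * sin (b * pi))))) / r)).
  apply: eq_Rintegral => r; rewrite inE/= in_itv/= andbT => r0.
  rewrite /stable_kernel cospi sinpi (mulrC pi b).
  have -> : t * (r * 0) + - y * (r `^ b * sin (b * pi)) =
    - (y * r `^ b * sin (b * pi)) by ring.
  have -> : t * (r * -1) + - y * (r `^ b * cos (b * pi)) =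
    - (r * t) - (y * r `^ b * cos (b * pi)) by ring.
  by rewrite sinN expRD; field; rewrite gt_eqF.
rewrite rot; last 2 first.
- move=> r p r0 pp; rewrite /= -Kr//.
  have := bnd r p _ (cos (t * (r * sin p) + - y * (r `^ b * sin (b * p))))
    (- sin (t * (r * sin p) + - y * (r `^ b * sin (b * p)))) r0 (expR_ge0 _) (hK _ _ r0 pp).
  rewrite !mulrN => /le_trans; apply; rewrite ler_wpM2l ?Kr0//.
  by apply: ub => //; rewrite normrN.
- move=> r p r0 pp; rewrite /= -Kr//.
  have := bnd r p _ (sin (t * (r * sin p) + - y * (r `^ b * sin (b * p))))
    (cos (t * (r * sin p) + - y * (r `^ b * sin (b * p)))) r0 (expR_ge0 _) (hK _ _ r0 pp).
  by move=> /le_trans; apply; rewrite ler_wpM2l ?Kr0//; exact: ub.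
apply: eq_Rintegral => r; rewrite inE/= in_itv/= andbT => r0.
rewrite cos_pihalf sin_pihalf (mulrC (pi / 2) b).
have -> : t * (r * 1) + - y * (r `^ b * sin (b * (pi / 2))) =
  r * t - y * r `^ b * sin (b * (pi / 2)) by ring.
have -> : t * (r * 0) + - y * (r `^ b * cos (b * (pi / 2))) =
  - (y * r `^ b * cos (b * (pi / 2))) by ring.
by field; rewrite gt_eqF.
Qed.

End stable_density.

Lemma mean_value_le {R : realType} (f df : R -> R) (a b C : R) :
  (forall x, a <= x <= b -> is_derive x 1 f (df x)) ->
  (forall x, a <= x <= b -> `|df x| <= C) ->
  forall x x', a <= x <= b -> a <= x' <= b -> `|f x - f x'| <= C * `|x - x'|.
Proof.
move=> dfE dfC x x'; wlog xx' : x x' / x' <= x.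
  move=> W xab x'ab; have [|/ltW] := leP x' x; first by move=> ?; exact: W.
  by move=> h; rewrite (distrC (f x)) (distrC x); exact: W.
move=> /andP[ax xb] /andP[ax' xb'].
have [|| z] := @MVT_segment R f df x' x xx'.
- move=> z; rewrite in_itv/= => /andP[x'z zx]; apply: dfE.
  by apply/andP; split; lra.
- apply: continuous_in_subspaceT => z; rewrite inE/= in_itv/= => /andP[x'z zx].
  apply: (@is_derive_continuous _ _ _ (df z)); apply: dfE.
  by rewrite (le_trans ax')//= (le_trans _ xb).
rewrite in_itv/= => /andP[x'z zx] ->.
by rewrite normrM ler_wpM2r// dfC// (le_trans ax')//= (le_trans _ xb).
Qed.

(** * Cauchy's formula at a point of the positive real axis *)

Section cauchy_imaginary_axis.
Context {R : realType}.
Notation mu := (@lebesgue_measure R).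
Variable b : R.
Hypothesis b_half : 2^-1 < b.
Hypothesis b_lt1 : b < 1.
Variables (y q : R).
Hypothesis y0 : 0 < y.
Hypothesis q0 : 0 < q.

Let b_gt0 : 0 < b. Proof. by rewrite (lt_trans _ b_half). Qed.
Let pi0 : 0 < pi :> R. Proof. exact: pi_gt0. Qed.
Let one_pihalf : 1 <= pi / 2 :> R. Proof. exact: pihalf_ge1. Qed.
Variable c : R.
Hypothesis cE : c = 2 * q * expR (- (y * q `^ b)).

(** [Qp] and [Qm] are |q + z|^2 and |q - z|^2, in the exact shape that [polar_add], [polar_cst],
    [polar_id] and [polar_scale] produce, zeros included. *)
Let Qp (z : R * R) := (q + z.1 * cos z.2) * (q + z.1 * cos z.2) +
                      (0 + z.1 * sin z.2) * (0 + z.1 * sin z.2).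
Let Qm (z : R * R) := (q + -1 * (z.1 * cos z.2)) * (q + -1 * (z.1 * cos z.2)) +
                      (0 + -1 * (z.1 * sin z.2)) * (0 + -1 * (z.1 * sin z.2)).
Let Om : set (R * R) := [set z | [/\ 0 < z.1, Qp z != 0 & Qm z != 0]].
Let Om1 : set (R * R) := [set z | 0 < z.1 /\ Qp z != 0].

Let QmE (r p : R) : Qm (r, p) = q ^+ 2 + r ^+ 2 - 2 * q * r * cos p.
Proof. by rewrite /Qm/=; have := cos2Dsin2 p; set C := cos p; set S := sin p; nra. Qed.

Let QpE (r p : R) : Qp (r, p) = q ^+ 2 + r ^+ 2 + 2 * q * r * cos p.
Proof. by rewrite /Qp/=; have := cos2Dsin2 p; set C := cos p; set S := sin p; nra. Qed.

Let cos_ge0 (p : R) : 0 <= p <= pi / 2 -> 0 <= cos p.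
Proof. by move=> /andP[? ?]; apply: cos_ge0_pihalf; apply/andP; split; lra. Qed.

Let sin_ge0 (p : R) : 0 <= p <= pi / 2 -> 0 <= sin p.
Proof. by move=> /andP[? ?]; apply: sin_ge0_pi; apply/andP; split; lra. Qed.

Let Qp_ge (r p : R) : 0 < r -> 0 <= p <= pi / 2 -> q ^+ 2 + r ^+ 2 <= Qp (r, p).
Proof. by move=> r0 pp; rewrite QpE lerDl !mulr_ge0 ?cos_ge0// ltW. Qed.

Let qr_gt0 (r : R) : 0 < q ^+ 2 + r ^+ 2.
Proof. by rewrite ltr_pwDl ?exprn_gt0// sqr_ge0. Qed.

Let Qp_neq0 (r p : R) : 0 < r -> 0 <= p <= pi / 2 -> Qp (r, p) != 0.
Proof. by move=> r0 pp; rewrite gt_eqF// (lt_le_trans (qr_gt0 r))// Qp_ge. Qed.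

(* D(z) = F(z) - 2 q F(q) / (q + z), which vanishes at q *)
Let JD (z : R * R) := expR (- y * (z.1 `^ b * cos (b * z.2))) *
    cos (- y * (z.1 `^ b * sin (b * z.2))) +
  - c * ((q + z.1 * cos z.2) * (Qp z)^-1).
Let MD (z : R * R) := expR (- y * (z.1 `^ b * cos (b * z.2))) *
    sin (- y * (z.1 `^ b * sin (b * z.2))) +
  - c * (- ((0 + z.1 * sin z.2) * (Qp z)^-1)).

Let polD Om' : Om' `<=` Om1 -> exists A B, polar_holomorphic Om' JD MD A B.
Proof.
move=> sub.
have O0 z : Om' z -> 0 < z.1 by move=> /sub[].
have ON z : Om' z -> Qp z != 0 by move=> /sub[].
do 2 eexists; rewrite /JD /MD /Qp.
exact: (polar_add (polar_exp (polar_scale (- y) (polar_powR b O0)))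
  (polar_scale (- c) (polar_inv (polar_add (polar_cst Om' q) (polar_id Om')) ON))).
Qed.

(** The l1 norm |Re| + |Im| is submultiplicative and avoids square roots. *)
Let nD (z : R * R) := `|JD z| + `|MD z|.

Let c0 : 0 < c. Proof. by rewrite cE !mulr_gt0 ?expR_gt0. Qed.

Let nD_le (r p : R) : 0 < r -> 0 <= p <= pi / 2 ->
  nD (r, p) <= 2 * expR (- (y * cos (pi / 2 * b) * r `^ b)) +
               c * ((q + 2 * r) / (q ^+ 2 + r ^+ 2)).
Proof.
move=> r0 pp; rewrite /nD /JD /MD /=.
set e := expR (- y * _); set C := cos (- y * _); set S := sin (- y * _).
have e_le : e <= expR (- (y * cos (pi / 2 * b) * r `^ b)).
  rewrite ler_expR mulNr lerN2 -mulrA ler_pM2l// mulrC ler_wpM2l ?powR_ge0//.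
  case/andP: pp => p1 p2; rewrite (mulrC (pi / 2)) ler_cos_pi ?mulr_ge0 ?(ltW b_gt0)//.
    by rewrite ler_pM2l.
  have h : 0 < pi * (1 - b) by rewrite mulr_gt0 ?subr_gt0.
  lra.
have e0 : 0 <= e by exact: expR_ge0.
have h1 : `|e * C| <= e by rewrite normrM (ger0_norm e0) ler_piMr// cos_max.
have h2 : `|e * S| <= e by rewrite normrM (ger0_norm e0) ler_piMr// sin_max.
have Q0 : 0 < Qp (r, p) by rewrite (lt_le_trans (qr_gt0 r))// Qp_ge.
have QV : (Qp (r, p))^-1 <= (q ^+ 2 + r ^+ 2)^-1 by rewrite lef_pV2 ?posrE// Qp_ge.
have V0 : 0 <= (Qp (r, p))^-1 by rewrite invr_ge0 ltW.
have Cp := cos_ge0 pp; have Sp := sin_ge0 pp.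
have C1 : cos p <= 1 := cos_le1 p; have S1 : sin p <= 1 := sin_le1 p.
have h3 : `|- c * ((q + r * cos p) * (Qp (r, p))^-1)| +
          `|- c * (- ((0 + r * sin p) * (Qp (r, p))^-1))| <=
          c * ((q + 2 * r) / (q ^+ 2 + r ^+ 2)).
  rewrite add0r !normrM !normrN !normrM (gtr0_norm c0) (ger0_norm V0).
  rewrite (gtr0_norm r0) (ger0_norm Sp) ger0_norm; last first.
    by rewrite addr_ge0 ?(ltW q0)// mulr_ge0// ltW.
  rewrite -mulrDr ler_pM2l// -mulrDl; apply: ler_pM => //.
    by rewrite !addr_ge0 ?(ltW q0)// mulr_ge0// ltW.
  by nra.
apply: le_trans (lerD (ler_normD _ _) (ler_normD _ _)) _.
rewrite addrACA; apply: lerD; last exact: h3.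
by rewrite mulr_natl mulr2n; apply: lerD; exact: le_trans e_le.
Qed.

(* the kernel 1 / (q - z) *)
Let J3 (z : R * R) := (q + -1 * (z.1 * cos z.2)) * (Qm z)^-1.
Let M3 (z : R * R) := - ((0 + -1 * (z.1 * sin z.2)) * (Qm z)^-1).
Let n3 (z : R * R) := `|J3 z| + `|M3 z|.

Let n3E (r p : R) : 0 < r -> 0 <= p <= pi / 2 -> 0 < Qm (r, p) ->
  n3 (r, p) = (`|q - r * cos p| + r * sin p) / Qm (r, p).
Proof.
move=> r0 pp Q0; rewrite /n3 /J3 /M3/= add0r !mulN1r normrN !normrM normrN.
rewrite normfV (gtr0_norm Q0) -mulrDl [`|r * sin p|]ger0_norm//.
by rewrite mulr_ge0 ?sin_ge0// ltW.
Qed.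

Let n3_le (r p : R) : 0 < r -> 0 <= p <= pi / 2 -> 0 < Qm (r, p) ->
  n3 (r, p) <= (q + 2 * r) / Qm (r, p).
Proof.
move=> r0 pp Q0; rewrite n3E// ler_pM2r ?invr_gt0//.
have Cp := cos_ge0 pp; have Sp := sin_ge0 pp.
have C1 : cos p <= 1 := cos_le1 p; have S1 : sin p <= 1 := sin_le1 p.
apply: le_trans (lerD (ler_normB _ _) (lexx _)) _.
by rewrite (gtr0_norm q0) ger0_norm ?mulr_ge0 ?(ltW r0)//; nra.
Qed.

(** Away from q each factor is O(1 / r), the first because of the term c / (q + z), the second
    because it is 1 / (q - z); only their product is integrable at infinity. The number k measures
    how far the ray stays from q. *)
Let far_bound : exists2 K0, 0 <= K0 & forall (k r p : R), 0 < k -> 0 < r ->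
  0 <= p <= pi / 2 -> k * (q ^+ 2 + r ^+ 2) <= Qm (r, p) ->
  nD (r, p) * n3 (r, p) <= K0 / k / oneDsqr r.
Proof.
have [K1 K10 hK1] := expRN_powR_decay (mulr_gt0 y0 (cos_halfpi_gt0 b_half b_lt1)) (ltW b_half).
(* [e1] exchanges the weights: 1 + r^2 <= [e1] (q^2 + r^2). *)
pose e1 := (1 + 1 / q ^+ 2).
have e10 : 0 <= e1 by rewrite /e1 addr_ge0// divr_ge0// sqr_ge0.
exists (4 * K1 / q + 5 * c * e1) => [|k r p k0 r0 pp Qk].
  by rewrite addr_ge0 ?divr_ge0 ?mulr_ge0 ?(ltW q0) ?(ltW c0).
set N := q ^+ 2 + r ^+ 2; have N0 : 0 < N := qr_gt0 r.
have Q0 : 0 < Qm (r, p) by rewrite (lt_le_trans _ Qk)// mulr_gt0.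
have a0 : 0 < q + 2 * r by rewrite addr_gt0// mulr_gt0.
have hN3 : n3 (r, p) <= (q + 2 * r) / N / k.
  apply: le_trans (n3_le r0 pp Q0) _.
  by rewrite -mulrA ler_pM2l// -invfM lef_pV2 ?posrE ?mulr_gt0// mulrC.
apply: le_trans (ler_pM _ _ (nD_le r0 pp) hN3) _.
- by rewrite addr_ge0.
- by rewrite addr_ge0.
have E := hK1 _ (ltW r0); set ee := expR _ in E *.
have ee0 : 0 <= ee by exact: expR_ge0.
have D0 : 0 < oneDsqr r := oneDsqr_gt0 r.
have h1 : (q + 2 * r) / N <= 2 / q.
  by rewrite ler_pdivrMr// mulrAC ler_pdivlMr// /N; nra.
have h2 : ((q + 2 * r) / N) * ((q + 2 * r) / N) <= 5 * e1 / oneDsqr r.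
  rewrite ler_pdivlMr//.
  have h3 : oneDsqr r <= e1 * N.
    rewrite /e1 /N mulrDl mul1r mulrDr div1r mulVf ?expf_neq0 ?gt_eqF// /oneDsqr.
    have : 0 <= (q ^+ 2)^-1 * r ^+ 2 by rewrite mulr_ge0 ?invr_ge0 ?sqr_ge0.
    have : 0 <= q ^+ 2 by exact: sqr_ge0.
    lra.
  (* Cauchy-Schwarz inequality: (q + 2 r)^2 <= (1 + 4) (q^2 + r^2). *)
  have h4 : (q + 2 * r) / N * ((q + 2 * r) / N) <= 5 / N.
    have -> : (q + 2 * r) / N * ((q + 2 * r) / N) =
      (q + 2 * r) * (q + 2 * r) / N / N by field; rewrite gt_eqF.
    rewrite ler_pM2r ?invr_gt0// ler_pdivrMr//.
    have : 0 <= (r - 2 * q) ^+ 2 by exact: sqr_ge0.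
    by rewrite /N; nra.
  apply: le_trans (ler_pM _ (ltW D0) h4 h3) _.
    by rewrite mulr_ge0// divr_ge0// ltW.
  by rewrite mulrCA -mulrA mulVf ?gt_eqF// mulr1 mulrC.
have -> : (4 * K1 / q + 5 * c * e1) / k / oneDsqr r =
  (2 * (K1 / oneDsqr r) * (2 / q) + c * (5 * e1 / oneDsqr r)) / k.
  by field; rewrite !gt_eqF.
rewrite [leLHS]mulrA ler_pM2r ?invr_gt0// mulrDl; apply: lerD; last first.
  by rewrite -[leLHS]mulrA ler_pM2l.
have X0 : 0 <= (q + 2 * r) / N by rewrite divr_ge0 ?ltW.
by apply: ler_pM => //; rewrite ?mulr_ge0// ler_pM2l.
Qed.


Let JD_q0 : JD (q, 0) = 0.
Proof.
rewrite /JD /= QpE !(mulr0, cos0, sin0, mulr1) cE mulNr.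
have qq : q + q != 0 by rewrite gt_eqF ?addr_gt0.
have -> : q ^+ 2 + q ^+ 2 + 2 * q * q = (q + q) ^+ 2 by ring.
by field; rewrite ?qq ?gt_eqF.
Qed.

Let MD_0 (r : R) : MD (r, 0) = 0.
Proof. by rewrite /MD /= !(mulr0, sin0, cos0, addr0, mul0r, oppr0). Qed.

Let sin_ge : exists2 k, 0 < k & forall p : R, 0 <= p <= 1 -> k * p <= sin p.
Proof.
apply: (ex_intro2 _ _ (cos 1)) => [|p /andP[p0 p1]]; first exact: cos1_gt0.
have [| z] := @MVT_segment R sin cos 0 p p0.
  by apply: continuous_subspaceT; exact: continuous_sin.
rewrite in_itv/= => /andP[z0 zp]; rewrite sin0 !subr0 => ->.
rewrite ler_wpM2r// ler_cos_pi//; first exact: le_trans p1.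
by rewrite (le_trans _ (@pi_ge2 R))// ler1n.
Qed.


(** D(z) / (q - z) stays bounded near q. As D(q) = 0, the mean value inequality, along the real axis
    and then along the angle, bounds D by a multiple of p + |r - q|; and |q - z| is at least a
    multiple of the same quantity. *)
Let near_bound : exists2 K0, 0 <= K0 & forall r p : R, q / 2 <= r <= 3 * q / 2 ->
  0 < p <= 1 -> nD (r, p) * n3 (r, p) <= K0.
Proof.
have hq := q0; have hp := pi0; have [A [B polDh]] := polD (fun z h => h).
have rect (r p : R) : q / 2 <= r <= 3 * q / 2 -> 0 <= p <= 1 -> Om1 (r, p).
  move=> /andP[r1 r2] /andP[p0 p1]; have r0 : 0 < r.
    by rewrite (lt_le_trans _ r1)// divr_gt0.
  by split=> //=; apply: Qp_neq0 => //; rewrite p0 (le_trans p1).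
have [_ H] := polDh.
have cA (r p : R) : q / 2 <= r <= 3 * q / 2 -> 0 <= p <= 1 -> {for (r, p), continuous A}.
  by move=> h k; have [[_ _ ? _] _] := H _ (rect _ _ h k).
have cB (r p : R) : q / 2 <= r <= 3 * q / 2 -> 0 <= p <= 1 -> {for (r, p), continuous B}.
  by move=> h k; have [[_ _ _ ?] _] := H _ (rect _ _ h k).
have [CA hA] := continuous_rectangle_bounded cA.
have [CB hB] := continuous_rectangle_bounded cB.
have q_in : q / 2 <= q <= 3 * q / 2 by apply/andP; split; lra.
have p_in : 0 <= (0 : R) <= 1 by rewrite lexx ler01.
have CA0 : 0 <= CA := le_trans (normr_ge0 _) (hA _ _ q_in p_in).
have CB0 : 0 <= CB := le_trans (normr_ge0 _) (hB _ _ q_in p_in).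
pose C1 := CA + (3 * q / 2) * (CA + CB).
have C10 : 0 <= C1.
  by rewrite addr_ge0// mulr_ge0 ?addr_ge0// divr_ge0// mulr_ge0// ltW.
have [k k0 hk] := sin_ge.
(* The first term comes from p <= (2 / (q k)) r sin p, since r >= q / 2 and k p <= sin p; the 1
   comes from |r - q| <= |q - r cos p| + r sin p. *)
pose C2 := 2 / (q * k) + 1.
have C20 : 0 <= C2 by rewrite addr_ge0// divr_ge0// mulr_ge0 ?ltW.
exists (2 * (C1 * C2)) => [|r p rr /andP[p0 p1]]; first by rewrite !mulr_ge0.
have r0 : 0 < r by case/andP: rr => h _; lra.
have pp : 0 <= p <= 1 by rewrite (ltW p0).
have pp2 : 0 <= p <= pi / 2 by rewrite (ltW p0)/= (le_trans p1).
have d1 : `|JD (r, p) - JD (r, 0)| <= (3 * q / 2 * CB) * `|p - 0|.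
  apply: (@mean_value_le _ (fun x => JD (r, x)) (fun x => - (r * B (r, x))) 0 1) => //.
  - by move=> x xx; have [_ []] := H _ (rect _ _ rr xx).
  - move=> x xx; rewrite normrN normrM (gtr0_norm r0).
    by case/andP: (rr) => _ h; apply: ler_pM (ltW r0) (normr_ge0 _) h (hB _ _ rr xx).
have d2 : `|MD (r, p) - MD (r, 0)| <= (3 * q / 2 * CA) * `|p - 0|.
  apply: (@mean_value_le _ (fun x => MD (r, x)) (fun x => r * A (r, x)) 0 1) => //.
  - by move=> x xx; have [_ []] := H _ (rect _ _ rr xx).
  - move=> x xx; rewrite normrM (gtr0_norm r0).
    by case/andP: (rr) => _ h; apply: ler_pM (ltW r0) (normr_ge0 _) h (hA _ _ rr xx).
have d3 : `|JD (r, 0) - JD (q, 0)| <= CA * `|r - q|.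
  apply: (@mean_value_le _ (fun x => JD (x, 0)) (fun x => A (x, 0)) (q / 2) (3 * q / 2)) => //.
  - by move=> x xx; have [_ []] := H _ (rect _ _ xx p_in).
  - by move=> x xx; exact: hA.
move: d1 d2 d3; rewrite MD_0 JD_q0 !subr0 (gtr0_norm p0) => d1 d2 d3.
have nDle : nD (r, p) <= C1 * (p + `|r - q|).
  rewrite /nD; have := ler_normD (JD (r, p) - JD (r, 0)) (JD (r, 0)).
  rewrite subrK => h.
  have : 0 <= `|r - q| * (3 * q / 2 * (CA + CB)).
    by rewrite !mulr_ge0 ?addr_ge0// ltW.
  have : 0 <= CA * p by rewrite mulr_ge0// ltW.
  rewrite /C1; nra.
set m := `|q - r * cos p| + r * sin p.
have S0 : 0 <= sin p := sin_ge0 pp2.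
have Sk : k * p <= sin p := hk _ pp.
have Sp : 0 < sin p by rewrite (lt_le_trans _ Sk)// mulr_gt0.
have m0 : 0 < m by rewrite ltr_wpDl// mulr_gt0.
(* [m] is the l1 norm of q - z and [Qm] the square of its modulus, so the norm m / Qm of 1 / (q - z)
   is at most 2 / m. *)
have Qm2 : m ^+ 2 <= 2 * Qm (r, p).
  rewrite QmE /m; have := cos2Dsin2 p; move: (cos p) (sin p) => C S CS.
  have : `|q - r * C| ^+ 2 = (q - r * C) ^+ 2 by rewrite real_normK ?num_real.
  have : 0 <= (`|q - r * C| - r * S) ^+ 2 by exact: sqr_ge0.
  set v := `|_|; move=> ? ?.
  have -> : q ^+ 2 + r ^+ 2 - 2 * q * r * C = (q - r * C) ^+ 2 + (r * S) ^+ 2.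
    transitivity (q ^+ 2 + r ^+ 2 * (C ^+ 2 + S ^+ 2) - 2 * q * r * C); last by ring.
    by rewrite CS mulr1.
  nra.
have Q0 : 0 < Qm (r, p).
  by rewrite -(@pmulr_rgt0 _ 2)// (lt_le_trans _ Qm2)// exprn_gt0.
have pm : p + `|r - q| <= C2 * m.
  have h1 : p <= 2 / (q * k) * (r * sin p).
    rewrite mulrAC ler_pdivlMr ?mulr_gt0//.
    have : q / 2 * (k * p) <= r * sin p.
      case/andP: (rr) => h _; apply: ler_pM h Sk.
        by rewrite divr_ge0// ltW.
      by rewrite mulr_ge0 ?(ltW k0)// ltW.
    lra.
  have h2 : `|r - q| <= m.
    have -> : r - q = - (q - r * cos p) + r * (1 - cos p) by ring.
    apply: le_trans (ler_normD _ _) _; rewrite normrN lerD2l.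
    have C1' := cos_le1 p; have Cp := cos_ge0 pp2; have S1 := sin_le1 p.
    rewrite ger0_norm ?mulr_ge0 ?subr_ge0 ?(ltW r0)// ler_pM2l//.
    by have := cos2Dsin2 p; nra.
  have : 0 <= 2 / (q * k) * `|q - r * cos p|.
    by rewrite mulr_ge0// divr_ge0// mulr_ge0 ?ltW.
  rewrite /C2 mulrDl mul1r; move: h1 h2; rewrite /m; lra.
rewrite n3E// mulrA ler_pdivrMr//.
apply: (@le_trans _ _ (C1 * (C2 * m) * m)).
  by rewrite ler_pM2r// (le_trans nDle)// ler_wpM2l.
have -> : C1 * (C2 * m) * m = C1 * C2 * m ^+ 2 by ring.
have -> : 2 * (C1 * C2) * Qm (r, p) = C1 * C2 * (2 * Qm (r, p)) by ring.
by rewrite ler_wpM2l// mulr_ge0.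
Qed.

Let uniform_bound : exists2 K0, 0 <= K0 & forall r p : R, 0 < r -> 0 < p <= 1 ->
  nD (r, p) * n3 (r, p) <= K0 / oneDsqr r.
Proof.
have hq := q0; have [K1 K10 h1] := far_bound; have [K2 K20 h2] := near_bound.
(* Outside [q / 2, 3 q / 2], Qm >= (q - r)^2 >= (q^2 + r^2) / 18, where 18 is not optimal; inside, 1
   + r^2 <= 1 + (3 q / 2)^2. *)
exists (K1 / 18^-1 + K2 * (1 + (3 * q / 2) ^+ 2)) => [|r p r0 /andP[p0 p1]].
  by rewrite addr_ge0 ?divr_ge0 ?mulr_ge0// addr_ge0// sqr_ge0.
have pp2 : 0 <= p <= pi / 2 by rewrite (ltW p0)/= (le_trans p1).
have D0 := oneDsqr_gt0 r.
rewrite [leRHS]mulrDl; have [rr|rr] := boolP (q / 2 <= r <= 3 * q / 2).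
  rewrite -[leLHS]add0r lerD ?divr_ge0 ?(ltW D0)//.
  rewrite ler_pdivlMr//.
  have h := h2 _ _ rr; apply: ler_pM => //.
  - by rewrite mulr_ge0 ?addr_ge0.
  - by apply: h; rewrite p0.
  - rewrite /oneDsqr lerD2l ler_sqr ?nnegrE ?(ltW r0)//; last first.
      by rewrite divr_ge0// mulr_ge0// ltW.
    by case/andP: rr.
rewrite -[leLHS]addr0 lerD//; last first.
  by rewrite divr_ge0 ?(ltW D0)// mulr_ge0// addr_ge0// sqr_ge0.
apply: h1 => //; rewrite QmE.
have C1 := cos_le1 p.
have : r * (2 * q * cos p) <= r * (2 * q).
  by rewrite ler_pM2l// ler_piMr// mulr_ge0// ltW.
move: rr; rewrite negb_and -!ltNge => /orP[rr|rr]; nra.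
Qed.

(** The gap in the first inequality is cos p (q - r)^2. On a sector that starts at a fixed positive
    angle, [far_bound] therefore applies at all radii with a single k. *)
Let kernel_neq0 (r p : R) : 0 < r -> 0 < p <= pi / 2 ->
  (1 - cos p) * (q ^+ 2 + r ^+ 2) <= Qm (r, p) /\ 0 < 1 - cos p.
Proof.
have hp := pi0; move=> r0 /andP[p0 p1]; split.
  rewrite QmE; have := @cos_ge0 p; rewrite (ltW p0) p1 => /(_ isT) C0.
  have : 0 <= cos p * (q - r) ^+ 2 by rewrite mulr_ge0// sqr_ge0.
  lra.
by rewrite subr_gt0 -(@cos0 R) ltr_cos_pi//; lra.
Qed.

Let mul_bound (r C S x y' z w : R) : 0 < r -> `|C| <= 1 -> `|S| <= 1 ->
  `|r * C * (x * z - y' * w) - r * S * (x * w + y' * z)| <=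
    r * ((`|x| + `|y'|) * (`|z| + `|w|)) /\
  `|r * C * (x * w + y' * z) + r * S * (x * z - y' * w)| <=
    r * ((`|x| + `|y'|) * (`|z| + `|w|)).
Proof.
move=> r0 C1 S1.
have a1 : `|x * z - y' * w| <= `|x| * `|z| + `|y'| * `|w|.
  by rewrite (le_trans (ler_normB _ _))// !normrM.
have a2 : `|x * w + y' * z| <= `|x| * `|w| + `|y'| * `|z|.
  by rewrite (le_trans (ler_normD _ _))// !normrM.
have b1 (a b' D : R) : `|D| <= 1 -> `|a| <= b' -> `|r * D * a| <= r * b'.
  move=> D1 ab; rewrite !normrM (gtr0_norm r0) -mulrA ler_pM2l//.
  by rewrite (le_trans _ ab)// ler_piMl.
split.
  apply: le_trans (ler_normB _ _) _.
  apply: le_trans (lerD (b1 _ _ _ C1 a1) (b1 _ _ _ S1 a2)) _.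
  by rewrite -mulrDr ler_pM2l//; lra.
apply: le_trans (ler_normD _ _) _.
apply: le_trans (lerD (b1 _ _ _ C1 a2) (b1 _ _ _ S1 a1)) _.
by rewrite -mulrDr ler_pM2l//; lra.
Qed.

Let MG (z : R * R) := z.1 * cos z.2 * (JD z * M3 z + MD z * J3 z) +
                      z.1 * sin z.2 * (JD z * J3 z - MD z * M3 z).

Let polG : exists JG A B, polar_holomorphic Om JG MG A B /\
  forall r p : R, 0 < r ->
  `|JG (r, p)| <= r * (nD (r, p) * n3 (r, p)) /\
  `|MG (r, p)| <= r * (nD (r, p) * n3 (r, p)).
Proof.
have sub : Om `<=` Om1 by move=> z [].
have ON z : Om z -> Qm z != 0 by move=> [].
have [A [B polDh]] := polD sub.
do 3 eexists; split.
  exact: polar_mul (polar_id Om) (polar_mul polDh (polar_inv (polar_add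
    (polar_cst Om q) (polar_scale (-1) (polar_id Om))) ON)).
by move=> r p r0; apply: mul_bound => //; [exact: cos_max|exact: sin_max].
Qed.

Let rotation_eq (p : R) : 0 < p <= 1 ->
  \int[mu]_(r in `]0, +oo[) (MG (r, pi / 2) / r) =
  \int[mu]_(r in `]0, +oo[) (MG (r, p) / r).
Proof.
have hp := pi0; move=> /andP[p0 p1]; have [JG [A [B [pol bnd]]]] := polG.
have pp : 0 < p <= pi / 2 by rewrite p0 (le_trans p1).
move: p1; rewrite le_eqVlt => /predU1P pE.
have [K1 K10 h1] := far_bound.
have k0 : 0 < 1 - cos p by have [] := @kernel_neq0 1 p ltr01 pp.
have Qk (r p' : R) : 0 < r -> p <= p' <= pi / 2 ->
    (1 - cos p) * (q ^+ 2 + r ^+ 2) <= Qm (r, p').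
  move=> r0 /andP[pp' p'2]; have [|h _] := @kernel_neq0 r p' r0.
    by rewrite (lt_le_trans p0).
  apply: le_trans h; rewrite ler_pM2r// lerD2l lerN2 ler_cos_pi//; first exact: ltW.
  lra.
have p'0 (p' : R) : p <= p' <= pi / 2 -> 0 <= p' <= pi / 2.
  by move=> /andP[h ->]; rewrite (le_trans _ h)// ltW.
have b2 (r p' : R) : 0 < r -> p <= p' <= pi / 2 ->
    r * (nD (r, p') * n3 (r, p')) <= K1 / (1 - cos p) * r / oneDsqr r.
  move=> r0 h; rewrite mulrAC [leRHS]mulrC ler_pM2l//.
  by apply: h1 => //; [exact: p'0|exact: Qk].
have := pp => /andP[_]; rewrite le_eqVlt => /predU1P[->//|ppi].
apply: (polar_rotation pol ppi).
- move=> r p' r0 h; split => //=; first by apply: Qp_neq0 => //; exact: p'0.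
  by rewrite gt_eqF// (lt_le_trans _ (Qk _ _ r0 h))// mulr_gt0.
- by move=> r p' r0 h; have [h3 _] := bnd r p' r0; exact: le_trans (b2 _ _ r0 h).
- by move=> r p' r0 h; have [_ h3] := bnd r p' r0; exact: le_trans (b2 _ _ r0 h).
Qed.

(** On the real axis every factor is real, so the imaginary part vanishes. The singularity at q is
    removable because D(q) = 0, but the formulas divide by [Qm], which vanishes there; the axis is
    therefore approached along the angles 1 / (n + 1), under the majorant of [uniform_bound]. *)
Let rotation_0 : \int[mu]_(r in `]0, +oo[) (MG (r, pi / 2) / r) = 0.
Proof.
have [JG [A [B [[[_ mM _ _] pol] bnd]]]] := polG.
have [K0 K00 hK] := uniform_bound.
(* The point r = q, where no limit is claimed, is removed as a null set. *)
pose f n (r : R) := MG (r, n.+1%:R^-1) / r * (r != q)%:R.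
have pn n : 0 < (n.+1%:R^-1 : R) <= 1 by rewrite invr_gt0 ltr0n invf_le1// ler1n.
have mMn (p : R) : measurable_fun setT (fun r => MG (r, p) / r).
  by apply: measurable_funM; [exact: measurable_fun_pair1|exact: measurable_invr].
have mnq : measurable_fun setT (fun r : R => (r != q)%:R : R).
  rewrite (_ : (fun r => _) = \1_(~` [set q])).
    by apply: measurable_indic; apply: measurableC; exact: measurable_set1.
  apply/funext => r; rewrite indicE; congr (nat_of_bool _)%:R.
  apply/idP/idP; rewrite inE/=; first by move/eqP.
  by move=> /eqP.
have mf n : measurable_fun setT (f n) by apply: measurable_funM.
have m0 : measurable_fun setT (fun _ : R => 0 : R) by exact: measurable_cst.
have [|||_ cI] := @Rdominated_cvg _ _ _ mu `]0, +oo[%classic (measurable_itv _)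
  f (fun=> 0) (fun r => K0 / oneDsqr r) mf m0.
- move=> r; rewrite /= in_itv/= andbT => r0; rewrite /f.
  have [->|rq] := eqVneq r q; first by under eq_fun do rewrite mulr0; exact: cvg_cst.
  under eq_fun do rewrite mulr1.
  have MG0 : MG (r, 0) = 0.
    by rewrite /MG MD_0 /M3 /= !(sin0, mulr0, mul0r, addr0, oppr0).
  suff: MG (r, n.+1%:R^-1) / r @[n --> \oo] --> MG (r, 0) / r by rewrite MG0 mul0r.
  have O0 : Om (r, 0).
    split=> //=; first by apply: Qp_neq0 => //; rewrite lexx divr_ge0// ltW.
    rewrite QmE cos0 mulr1 gt_eqF// (_ : _ - _ = (q - r) ^+ 2); last by ring.
    by rewrite lt_neqAle eq_sym sqrf_eq0 subr_eq0 eq_sym rq sqr_ge0.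
  have [[_ cM _ _] _] := pol _ O0.
  have cM2 := continuous_pair2 cM; apply: cvgM; last exact: cvg_cst.
  apply: (@cvg_comp _ _ _ (fun n => n.+1%:R^-1 : R) (fun x => MG (r, x)) _ (nbhs 0)) => //.
  exact: cvg_harmonic.
- move=> n r; rewrite /= in_itv/= andbT => r0; rewrite /f normrM.
  apply: (@le_trans _ _ `|MG (r, n.+1%:R^-1) / r|).
    by rewrite ler_piMr// normr_nat; case: (_ != _).
  rewrite normrM normfV (gtr0_norm r0) ler_pdivrMr// mulrC.
  have [_ h] := bnd r n.+1%:R^-1 r0; apply: le_trans h _.
  by rewrite ler_pM2l// hK.
- exact: integrable_oneDsqrV.
have : (fun n => \int[mu]_(r in `]0, +oo[) f n r) =
       fun n => \int[mu]_(r in `]0, +oo[) (MG (r, pi / 2) / r).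
  apply/funext => n; rewrite (rotation_eq (pn n)).
  rewrite /Rintegral -(@integral_setD1 _ _ q)//; last 2 first.
  - by apply: measurableD.
  - by apply/measurable_EFinP/measurable_funTS.
  rewrite -[in RHS](@integral_setD1 _ _ q)//; last 2 first.
  - by apply: measurableD.
  - by apply/measurable_EFinP/measurable_funTS.
  congr fine; apply: eq_integral => r; rewrite inE /f => -[_] /eqP ->.
  by rewrite mulr1.
move=> E; rewrite E in cI.
move: cI; rewrite Rintegral_cst//= mul0r => cI.
set I := Rintegral _ _ _ in cI *.
have h : limn (fun n : nat => I) = I by apply: cvg_lim; [exact: Rhausdorff|exact: cvg_cst].
by rewrite -h; exact: cvg_lim cI.
Qed.


Let F_int :
  mu.-integrable `]0, +oo[ (EFin \o (fun r => expR (- (y * r `^ b * cos (pi / 2 * b))) *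
    ((q * cos (y * r `^ b * sin (pi / 2 * b)) + r * sin (y * r `^ b * sin (pi / 2 * b)))
     / (q ^+ 2 + r ^+ 2)))).
Proof.
have [K1 K10 hK1] := expRN_powR_decay (mulr_gt0 y0 (cos_halfpi_gt0 b_half b_lt1)) (ltW b_half).
apply: quadratic_decay_integrable; split; first by mfun.
exists (K1 * (2 / q)) => r r0; rewrite normrM (ger0_norm (expR_ge0 _)).
have -> : K1 * (2 / q) / oneDsqr r = K1 / oneDsqr r * (2 / q) by ring.
apply: ler_pM => //.
  by have := hK1 _ (ltW r0); congr (expR (- _) <= _); ring.
rewrite normrM normfV (gtr0_norm (qr_gt0 r)) ler_pdivrMr//.
apply: le_trans (ler_normD _ _) _; rewrite !normrM (gtr0_norm q0) (gtr0_norm r0).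
apply: (@le_trans _ _ (q + r)).
  by apply: lerD; rewrite ler_piMr ?cos_max ?sin_max// ltW.
rewrite mulrAC ler_pdivlMr//.
have : 0 <= (q - r) ^+ 2 by exact: sqr_ge0.
by nra.
Qed.

Let K_int : quadratic_decay (fun r : R => 2 * q / (q ^+ 2 + r ^+ 2)).
Proof.
split; first by mfun.
exists (2 * q * (1 + 1 / q ^+ 2)) => r r0; rewrite normrM normfV (gtr0_norm (qr_gt0 r)).
have h : oneDsqr r <= (1 + 1 / q ^+ 2) * (q ^+ 2 + r ^+ 2).
  rewrite mulrDl mul1r mulrDr div1r mulVf ?expf_neq0 ?gt_eqF// /oneDsqr.
  have : 0 <= (q ^+ 2)^-1 * r ^+ 2 by rewrite mulr_ge0 ?invr_ge0 ?sqr_ge0.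
  have : 0 <= q ^+ 2 by exact: sqr_ge0.
  lra.
rewrite gtr0_norm ?mulr_gt0// ler_pdivrMr// mulrAC ler_pdivlMr ?oneDsqr_gt0//.
by rewrite -[leRHS]mulrA ler_pM2l// mulr_gt0.
Qed.

Let K_val : \int[mu]_(r in `]0, +oo[) (2 * q / (q ^+ 2 + r ^+ 2)) = pi.
Proof.
transitivity (pi - 2 * atan (q^-1 * 0)); last by rewrite mulr0 atan0 mulr0 subr0.
apply: (@FTC_halfline R _ (fun r => 2 * atan (q^-1 * r)) pi) => //.
- move=> x x0.
  have dq : is_derive x 1 (fun r => q^-1 * r) q^-1.
    apply: is_derive_eq (is_derive_mul (is_derive_cst q^-1 x 1) (is_derive_id x 1)) _.
    by rewrite /cst/=; ring.
  have da : is_derive x 1 (fun r => atan (q^-1 * r)) ((1 + (q^-1 * x) ^+ 2)^-1 * q^-1).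
    exact: is_derive1_comp.
  apply: is_derive_eq (is_derive_mul (is_derive_cst (2 : R) x 1) da) _.
  rewrite /cst/=; field; rewrite gt_eqF ?(gt_eqF (qr_gt0 x))//=.
  by rewrite gt_eqF// (lt_le_trans ltr01)// lerDl sqr_ge0.
- move=> x x0; apply: continuous_mul; first exact: cvg_cst.
  apply: cvgV; first by rewrite gt_eqF.
  by apply: cvgD; [exact: cvg_cst|exact: exprn_continuous].
- have -> : pi = 2 * (pi / 2) :> R by field.
  apply: cvgM; first exact: cvg_cst.
  apply: (@cvg_comp _ _ _ (fun x => q^-1 * x) atan _ +oo%R); last exact: cvgy_atan.
  apply/cvgryPge => A; near=> r; rewrite mulrC ler_pdivlMr//.
Unshelve. all: by end_near. Qed.

(* Cauchy's formula at q for F(z) = exp (- y z^b) in the right half-plane, with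
   the contour on the imaginary axis. *)
Lemma cauchy_imaginary :
  \int[mu]_(r in `]0, +oo[) (expR (- (y * r `^ b * cos (pi / 2 * b))) *
    ((q * cos (y * r `^ b * sin (pi / 2 * b)) + r * sin (y * r `^ b * sin (pi / 2 * b)))
     / (q ^+ 2 + r ^+ 2))) = pi * expR (- (y * q `^ b)).
Proof.
set Fr := fun r => expR _ * _.
have E0 := rotation_0.
have iK := quadratic_decay_integrable K_int.
have E1 : \int[mu]_(r in `]0, +oo[) (MG (r, pi / 2) / r) =
  \int[mu]_(r in `]0, +oo[) (Fr r - expR (- (y * q `^ b)) * (2 * q / (q ^+ 2 + r ^+ 2))).
  apply: eq_Rintegral => r; rewrite inE/= in_itv/= andbT => r0.
  rewrite /MG /M3 /J3 /JD /MD /= QmE QpE !cos_pihalf !sin_pihalf.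
  rewrite !(mulr0, mul0r, addr0, subr0, mulr1, add0r).
  rewrite cE /Fr !mulNr cosN sinN ?mulN1r (mulrC b).
  set e := expR (- (y * q `^ b)).
  have -> : y * (r `^ b * cos (pi / 2 * b)) = y * r `^ b * cos (pi / 2 * b) by ring.
  have -> : y * (r `^ b * sin (pi / 2 * b)) = y * r `^ b * sin (pi / 2 * b) by ring.
  set E := expR _; set C := cos _; set S := sin _.
  by field; rewrite !gt_eqF.
have iK2 : mu.-integrable `]0, +oo[ (EFin \o (fun r : R =>
    expR (- (y * q `^ b)) * (2 * q / (q ^+ 2 + r ^+ 2)))).
  rewrite [X in integrable _ _ X](_ : _ = (fun r => (expR (- (y * q `^ b)))%:E *
    (EFin \o (fun r => 2 * q / (q ^+ 2 + r ^+ 2))%R) r)%E).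
    exact: integrableZl.
  by apply/funext => r; rewrite /= EFinM.
have iF : mu.-integrable `]0, +oo[ (EFin \o Fr) := F_int.
move: E0; rewrite E1 RintegralB// RintegralZl// K_val => /eqP.
by rewrite subr_eq0 => /eqP ->; rewrite mulrC.
Qed.

End cauchy_imaginary_axis.

(** * Laplace transform and tails of the density in time *)

Section stable_density_laplace.
Context {R : realType}.
Notation mu := (@lebesgue_measure R).
Variable b : R.
Hypothesis b_half : 2^-1 < b.
Hypothesis b_lt1 : b < 1.

Let b_gt0 : 0 < b. Proof. by rewrite (lt_trans _ b_half). Qed.
Let b01 : 0 < b < 1. Proof. by rewrite b_gt0. Qed.

Lemma laplace_cos (q u s : R) : 0 < q ->
  \int[mu]_(t in `]0, +oo[) (expR (- (q * t)) * cos (u * t - s)) =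
  (q * cos s + u * sin s) / (q ^+ 2 + u ^+ 2).
Proof.
move=> q0.
have N0 : 0 < q ^+ 2 + u ^+ 2 by rewrite ltr_pwDl ?exprn_gt0// sqr_ge0.
have [K K0 hK] := expR_decay q0.
have dl (a c x : R) : is_derive x 1 (fun t => a * t + c) a.
  have h : is_derive x 1 (fun t : R => a * t) a.
    apply: is_derive_eq (is_derive_mul (is_derive_cst a x 1) (is_derive_id x 1)) _.
    by rewrite /cst/=; ring.
  by apply: is_derive_eq (is_derive_add h (is_derive_cst c x 1)) _; rewrite addr0.
pose F t := expR (- q * t + 0) * ((q ^+ 2 + u ^+ 2)^-1 *
  (u * sin (u * t + - s) - q * cos (u * t + - s))).
transitivity (0 - F 0); last first.
  rewrite /F !mulr0 !add0r expR0 sinN cosN; field; exact: lt0r_neq0.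
apply: (@FTC_halfline R _ F 0).
- split; first by mfun.
  exists K => t t0; rewrite normrM (ger0_norm (expR_ge0 _)).
  by rewrite (le_trans _ (hK _ (ltW t0)))// ler_piMr ?expR_ge0// cos_max.
- move=> t t0.
  have d1 := is_derive_exp (dl (- q) 0 t).
  have d2 := is_derive_sinf (dl u (- s) t).
  have d3 := is_derive_cosf (dl u (- s) t).
  have d4 := is_derive_sub (is_derive_mul (is_derive_cst u t 1) d2)
                           (is_derive_mul (is_derive_cst q t 1) d3).
  have d5 := is_derive_mul (is_derive_cst (q ^+ 2 + u ^+ 2)^-1 t 1) d4.
  apply: is_derive_eq (is_derive_mul d1 d5) _.
  rewrite /cst/= addr0 mulNr.
  by field; exact: lt0r_neq0.
- move=> t t0.
  have c1 : {for t, continuous (fun t : R => expR (- (q * t)))}.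
    have := is_derive_continuous (is_derive_exp (dl (- q) 0 t)).
    rewrite (_ : (fun y => expR _) = (fun t => expR (- (q * t))))//.
    by apply/funext => x; rewrite addr0 mulNr.
  have c2 : {for t, continuous (fun t : R => cos (u * t - s))}.
    exact: is_derive_continuous (is_derive_cosf (dl u (- s) t)).
  exact: continuous_mul.
- have F_le t : 0 < t -> `|F t| <= (q ^+ 2 + u ^+ 2)^-1 * (`|u| + q) * (K / oneDsqr t).
    move=> t0; rewrite /F normrM (ger0_norm (expR_ge0 _)) mulrC.
    apply: ler_pM => //.
      rewrite normrM normfV (gtr0_norm N0) ler_pM2l ?invr_gt0//.
      apply: le_trans (ler_normB _ _) _; rewrite !normrM (gtr0_norm q0).
      by apply: lerD; rewrite ler_piMr ?sin_max ?cos_max// ltW.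
    by rewrite addr0 mulNr hK// ltW.
  pose C := (q ^+ 2 + u ^+ 2)^-1 * (`|u| + q).
  have C0 : 0 <= C by rewrite mulr_ge0 ?invr_ge0 ?(ltW N0)// addr_ge0// ltW.
  apply/cvgrPdist_le => e e0; near=> t.
  have t0 : 0 < t by near: t; exact: nbhs_pinfty_gt.
  have t1 : 1 <= t by near: t; exact: nbhs_pinfty_ge.
  rewrite sub0r normrN (le_trans (F_le _ t0))//.
  rewrite -/C mulrA ler_pdivrMr ?oneDsqr_gt0//.
  have tC : C * K / e <= t by near: t; apply: nbhs_pinfty_ge; exact: num_real.
  rewrite ler_pdivrMr// in tC; apply: le_trans tC _; rewrite mulrC ler_pM2l//.
  by rewrite /oneDsqr; nra.
Unshelve. all: by end_near. Qed.

(* Density of the first time the process goes below - y. *)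
Definition stable_density (y t : R) : R :=
  pi^-1 * \int[mu]_(u in `]0, +oo[) (expR (- (u * t)) * stable_kernel b y u).

Lemma measurable_stable_kernel : measurable_fun setT
  (fun z : R * R => stable_kernel b z.1 z.2).
Proof. by rewrite /stable_kernel; mfun. Qed.

Lemma stable_kernel_le y Y u : 0 <= y <= Y -> 0 <= u ->
  `|stable_kernel b y u| <= expR (Y * (u + 1) `^ b).
Proof.
move=> /andP[y0 yY] u0; rewrite /stable_kernel normrM (ger0_norm (expR_ge0 _)).
rewrite -[leRHS]mulr1; apply: ler_pM => //; last exact: sin_max.
rewrite ler_expR.
have h : u `^ b <= (u + 1) `^ b.
  by rewrite ge0_ler_powR ?nnegrE ?addr_ge0 ?(ltW b_gt0)// lerDl.
apply: (@le_trans _ _ (y * u `^ b)).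
  by rewrite -mulrN ler_piMr ?mulr_ge0 ?powR_ge0// lerNl cos_geN1.
by apply: ler_pM; rewrite ?powR_ge0.
Qed.

Lemma measurable_stable_density y : measurable_fun setT (stable_density y).
Proof.
apply: measurable_funM; first exact: measurable_cst.
apply: (@measurable_Rintegral _ _ _ _ _ mu _
  (fun t u => expR (- (u * t)) * stable_kernel b y u)) => //.
by rewrite /stable_kernel; mfun.
Qed.


(** The defining integrand is controlled by exp (- u t) alone, which is lost as t tends to 0; the
    rotated one has the majorant exp (- y u^b cos (pi b / 2)) for all t. *)
Lemma stable_density_bounded y : 0 < y ->
  exists2 C, 0 <= C & forall t, 0 < t -> `|stable_density y t| <= C.
Proof.
move=> y0.
have [K K0 hK] := expRN_powR_decay (mulr_gt0 y0 (cos_halfpi_gt0 b_half b_lt1)) (ltW b_half).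
exists (pi^-1 * \int[mu]_(u in `]0, +oo[) (K / oneDsqr u)).
  apply: mulr_ge0; first by rewrite invr_ge0 pi_ge0.
  by apply: Rintegral_ge0 => u _; rewrite divr_ge0// ltW// oneDsqr_gt0.
move=> t t0; rewrite /stable_density stable_kernel_rotation// normrM.
rewrite gtr0_norm ?invr_gt0 ?pi_gt0// ler_pM2l ?invr_gt0 ?pi_gt0//.
apply: Rintegral_norm_le => //; first by mfun.
  move=> u; rewrite /= in_itv/= andbT => u0; rewrite normrM (ger0_norm (expR_ge0 _)).
  apply: le_trans (hK _ (ltW u0)).
  rewrite (_ : y * cos _ * _ = y * u `^ b * cos (pi / 2 * b)); last by ring.
  by rewrite ler_piMr ?expR_ge0// cos_max.
exact: integrable_oneDsqrV.
Qed.

Lemma stable_density_decay y q : 0 < y -> 0 < q ->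
  quadratic_decay (fun t => expR (- (q * t)) * stable_density y t).
Proof.
move=> y0 q0; have [C C0 hC] := stable_density_bounded y0.
apply: (quadratic_decayM (C := C)) => //; last exact: measurable_stable_density.
have [K K0 hK] := expR_decay q0.
split; first by mfun.
by exists K => u u0; rewrite ger0_norm ?expR_ge0// hK// ltW.
Qed.

(** Fubini's theorem applies to the rotated form, which is dominated by a product of integrable
    functions of t and u. The inner integral is then [laplace_cos], the outer one
    [cauchy_imaginary]. *)
Lemma stable_density_laplace y q : 0 < y -> 0 < q ->
  \int[mu]_(t in `]0, +oo[) (expR (- (q * t)) * stable_density y t) =
  expR (- (y * q `^ b)).
Proof.
move=> y0 q0.
have pin : pi != 0 :> R by rewrite gt_eqF// pi_gt0.
have [K K0 hK] := expRN_powR_decay (mulr_gt0 y0 (cos_halfpi_gt0 b_half b_lt1)) (ltW b_half).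
have [K' K'0 hK'] := expR_decay q0.
pose g u t := expR (- (y * u `^ b * cos (pi / 2 * b))) *
              cos (u * t - y * u `^ b * sin (pi / 2 * b)).
have mg : measurable_fun setT (fun z : R * R => expR (- (q * z.1)) * g z.2 z.1).
  by rewrite /g; mfun.
have gK u : 0 < u -> expR (- (y * u `^ b * cos (pi / 2 * b))) <= K / oneDsqr u.
  move=> u0; apply: le_trans (hK _ (ltW u0)).
  by rewrite (_ : y * cos _ * _ = y * u `^ b * cos (pi / 2 * b))//; ring.
have bd t u : 0 < t -> 0 < u ->
    `|expR (- (q * t)) * g u t| <= K' / oneDsqr t * (K / oneDsqr u).
  move=> t0 u0; rewrite normrM (ger0_norm (expR_ge0 _)).
  apply: ler_pM => //.
    by rewrite hK'// ltW.
  rewrite normrM (ger0_norm (expR_ge0 _)) (le_trans _ (gK _ u0))//.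
  by rewrite ler_piMr ?expR_ge0// cos_max.
transitivity (\int[mu]_(t in `]0, +oo[) (pi^-1 *
   \int[mu]_(u in `]0, +oo[) (expR (- (q * t)) * g u t))).
  apply: eq_Rintegral => t; rewrite inE/= in_itv/= andbT => t0.
  rewrite /stable_density stable_kernel_rotation// mulrCA; congr (_ * _).
  rewrite RintegralZl//; apply: quadratic_decay_integrable; split; first by rewrite /g; mfun.
  exists K => u u0; rewrite normrM (ger0_norm (expR_ge0 _)) (le_trans _ (gK _ u0))//.
  by rewrite ler_piMr ?expR_ge0// cos_max.
rewrite RintegralZl//; last first.
  apply: (@Rfubini_integrable1 _ _ _ _ _ mu mu `]0, +oo[%classic `]0, +oo[%classic
    _ _ (fun t u => expR (- (q * t)) * g u t)
    (fun t => K' / oneDsqr t) (fun u => K / oneDsqr u)) => //;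
    try exact: integrable_oneDsqrV.
  by move=> t u; rewrite /= !in_itv/= !andbT; exact: bd.
rewrite (@Rfubini _ _ _ _ _ mu mu `]0, +oo[%classic `]0, +oo[%classic
    _ _ (fun t u => expR (- (q * t)) * g u t)
    (fun t => K' / oneDsqr t) (fun u => K / oneDsqr u)) //; try exact: integrable_oneDsqrV;
  last by move=> t u; rewrite /= !in_itv/= !andbT; exact: bd.
rewrite -[RHS](mulKf pin) -(cauchy_imaginary b_half b_lt1 y0 q0 (erefl _)); congr (_ * _).
apply: eq_Rintegral => u; rewrite inE/= in_itv/= andbT => u0.
rewrite -laplace_cos// -RintegralZl//.
  by apply: eq_Rintegral => t _; rewrite /g mulrCA.
apply: quadratic_decay_integrable; split; first by mfun.
exists K' => t t0; rewrite normrM (ger0_norm (expR_ge0 _)).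
by rewrite (le_trans _ (hK' _ (ltW t0)))// ler_piMr ?expR_ge0// cos_max.
Qed.

(** After a positive time t the factor exp (- u t) absorbs the growth of the kernel, so Fubini's
    theorem applies before any rotation and keeps [stable_kernel] in the result. *)
Lemma stable_density_tail y q t : 0 < y -> 0 < q -> 0 < t ->
  \int[mu]_(s in `]t, +oo[) (expR (- (q * s)) * stable_density y s) =
  expR (- (q * t)) *
  (pi^-1 * \int[mu]_(u in `]0, +oo[) (expR (- (u * t)) * stable_kernel b y u / (u + q))).
Proof.
move=> y0 q0 t0.
have [K K0 hK] := expR_powR_decay t0 (ltW y0) b01.
have [K' K'0 hK'] := expR_decay q0.
have sub : `]t, +oo[%classic `<=` (`]0, +oo[%classic : set R).
  by move=> s; rewrite /= !in_itv/= !andbT; exact: lt_trans.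
have kb u : 0 < u -> expR (- (u * t)) * `|stable_kernel b y u| <= K / oneDsqr u.
  move=> u0; apply: le_trans (hK _ (ltW u0)); rewrite expRD mulrC (mulrC u).
  rewrite mulrC ler_pM2l ?expR_gt0//.
  by apply: stable_kernel_le; [rewrite lexx ltW|exact: ltW].
have bd s u : t < s -> 0 < u ->
    `|expR (- (q * s)) * (expR (- (u * s)) * stable_kernel b y u)| <=
    K' / oneDsqr s * (K / oneDsqr u).
  move=> ts u0; have s0 := lt_trans t0 ts.
  rewrite normrM (ger0_norm (expR_ge0 _)).
  apply: ler_pM => //.
    by rewrite hK'// ltW.
  rewrite normrM (ger0_norm (expR_ge0 _)) (le_trans _ (kb _ u0))// ler_wpM2r//.
  by rewrite ler_expR lerN2 ler_pM2l// ltW.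
have iK' : mu.-integrable `]t, +oo[ (EFin \o (fun s => K' / oneDsqr s)).
  by apply: integrableS (integrable_oneDsqrV K') => //.
have mf : measurable_fun setT (fun z : R * R =>
    expR (- (q * z.1)) * (expR (- (z.2 * z.1)) * stable_kernel b y z.2)).
  by rewrite /stable_kernel; mfun.
have ik s : t < s -> mu.-integrable `]0, +oo[
    (EFin \o (fun u => expR (- (u * s)) * stable_kernel b y u)).
  move=> ts; apply: quadratic_decay_integrable; split.
    by rewrite /stable_kernel; mfun.
  exists K => u u0; rewrite normrM (ger0_norm (expR_ge0 _)).
  rewrite (le_trans _ (kb _ u0))// ler_wpM2r//.
  by rewrite ler_expR lerN2 ler_pM2l// ltW.
transitivity (\int[mu]_(s in `]t, +oo[) (pi^-1 *
   \int[mu]_(u in `]0, +oo[) (expR (- (q * s)) * (expR (- (u * s)) * stable_kernel b y u)))).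
  apply: eq_Rintegral => s; rewrite inE/= in_itv/= andbT => ts.
  by rewrite /stable_density mulrCA RintegralZl//; exact: ik.
rewrite RintegralZl//; last first.
  apply: (@Rfubini_integrable1 _ _ _ _ _ mu mu `]t, +oo[%classic `]0, +oo[%classic
    _ _ (fun s u => expR (- (q * s)) * (expR (- (u * s)) * stable_kernel b y u))
    (fun t => K' / oneDsqr t) (fun u => K / oneDsqr u)) => //;
    try exact: integrable_oneDsqrV.
  by move=> s u; rewrite /= !in_itv/= !andbT; exact: bd.
rewrite (@Rfubini _ _ _ _ _ mu mu `]t, +oo[%classic `]0, +oo[%classic
    _ _ (fun s u => expR (- (q * s)) * (expR (- (u * s)) * stable_kernel b y u))
    (fun t => K' / oneDsqr t) (fun u => K / oneDsqr u)) //; try exact: integrable_oneDsqrV;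
  last by move=> s u; rewrite /= !in_itv/= !andbT; exact: bd.
rewrite mulrCA; congr (_ * _); rewrite -RintegralZl//; last first.
  apply: quadratic_decay_integrable; split; first by rewrite /stable_kernel; mfun.
  exists (K * q^-1) => u u0; rewrite normrM normfV (gtr0_norm (addr_gt0 u0 q0)).
  rewrite mulrAC; apply: ler_pM; rewrite ?invr_ge0 ?addr_ge0 ?(ltW u0) ?(ltW q0)//.
    by rewrite normrM (ger0_norm (expR_ge0 _)); exact: kb.
  by rewrite lef_pV2 ?posrE ?addr_gt0// lerDr ltW.
apply: eq_Rintegral => u; rewrite inE/= in_itv/= andbT => u0.
have uq : 0 < u + q by rewrite addr_gt0.
transitivity (\int[mu]_(s in `]t, +oo[) (stable_kernel b y u * expR (- ((u + q) * s)))).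
  apply: eq_Rintegral => s _; rewrite mulrA -expRD mulrC; congr (_ * expR _); ring.
have [K2 K20 hK2] := expR_decay uq.
rewrite RintegralZl//; last first.
  apply: integrableS (quadratic_decay_integrable _) => //; split; first by mfun.
  by exists K2 => s s0; rewrite ger0_norm ?expR_ge0// hK2// ltW.
have -> : \int[mu]_(s in `]t, +oo[) expR (- ((u + q) * s)) = expR (- ((u + q) * t)) / (u + q).
  have dl (x : R) : is_derive x 1 (fun s => - (u + q) * s) (- (u + q)).
    apply: is_derive_eq (is_derive_mul (is_derive_cst (- (u + q)) x 1) (is_derive_id x 1)) _.
    by rewrite /cst/=; ring.
  have dF (x : R) : is_derive x 1 (fun s => - (u + q)^-1 * expR (- (u + q) * s))
      (expR (- ((u + q) * x))).
    apply: is_derive_eq (is_derive_mul (is_derive_cst (- (u + q)^-1) x 1)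
      (is_derive_exp (dl x))) _.
    by rewrite /cst/= mulNr; field; exact: lt0r_neq0.
  have cE (x : R) : {for x, continuous (fun s => expR (- ((u + q) * s)))}.
    have := is_derive_continuous (is_derive_exp (dl x)).
    rewrite (_ : (fun y => expR _) = (fun t => expR (- ((u + q) * t))))//.
    by apply/funext => z; rewrite mulNr.
  rewrite /Rintegral integral_itv_obnd_cbnd; last first.
    by apply/measurable_EFinP; apply: measurable_funTS; mfun.
  rewrite (@ge0_continuous_FTC2y _ _ (fun s => - (u + q)^-1 * expR (- (u + q) * s)) t 0).
  - by rewrite sub0e /= mulNr opprK mulNr mulrC.
  - by move=> x _; exact: expR_ge0.
  - by apply: continuous_subspaceT => x; exact: cE.
  - rewrite -[X in _ --> X](mulr0 (- (u + q)^-1)); apply: cvgM; first exact: cvg_cst.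
    under eq_fun do rewrite mulNr.
    apply: (@cvg_comp _ _ _ (fun x => (u + q) * x) (fun x => expR (- x)) _ +oo%R).
      by apply: gt0_cvgMry => //; exact: cvg_id.
    exact: cvgr_expR.
  - by move=> x _; case: (dF x).
  - by apply: cvg_at_right_filter; exact: is_derive_continuous (dF t).
  - by move=> x _; rewrite derive1E; case: (dF x).
have -> : expR (- ((u + q) * t)) = expR (- (q * t)) * expR (- (u * t)).
  by rewrite -expRD; congr expR; ring.
ring.
Qed.

End stable_density_laplace.

(** * Laplace transforms at the integers *)

Section gumbel.
Context {R : realType}.
Notation mu := (@lebesgue_measure R).

Lemma expR_taylor_le (x X : R) N : `|x| <= X ->
  `|expR x - series (exp_coeff x) N| <= expR X - series (exp_coeff X) N.
Proof.
move=> xX.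
have cx : series (exp_coeff x) M @[M --> \oo] --> expR x.
  exact: is_cvg_series_exp_coeff.
have cX : series (exp_coeff X) M @[M --> \oo] --> expR X.
  exact: is_cvg_series_exp_coeff.
have X0 : 0 <= X := le_trans (normr_ge0 _) xX.
have h1 : `|series (exp_coeff x) M - series (exp_coeff x) N| @[M --> \oo] -->
    `|expR x - series (exp_coeff x) N|.
  by apply: cvg_norm; apply: cvgB => //; exact: cvg_cst.
have h2 : series (exp_coeff X) M - series (exp_coeff X) N @[M --> \oo] -->
    expR X - series (exp_coeff X) N.
  by apply: cvgB => //; exact: cvg_cst.
apply: ler_cvg_to h1 h2 _; near=> M.
have NM : (N <= M)%N by near: M; exact: nbhs_infty_ge.
rewrite !sub_series NM.
apply: le_trans (ler_norm_sum _ _ _) _; apply: ler_sum => i _.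
rewrite /exp_coeff /= normrM normrX normfV normr_nat.
by rewrite ler_wpM2r ?invr_ge0// lerXn2r ?nnegrE.
Unshelve. all: by end_near. Qed.

(* a smooth approximation of the indicator of ]a, +oo[ by a function of
   exp (- k^2 s) *)
Definition gumbel (a e : R) (k : nat) (s : R) : R :=
  expR (- expR (k%:R ^+ 2 * (a - s) + e * k%:R)).

(** Taylor polynomials of exp at - X exp (- k^2 s), an argument that stays in [- X, X] for s >= 0,
    so the remainder is uniform in s. The exponents i k^2 are integers, which is why transforms at
    integers will do. *)
Lemma gumbel_poly (a e : R) (k : nat) (eps : R) : 0 < eps ->
  exists N : nat, forall s, 0 <= s ->
  `|gumbel a e k s - \sum_(i < N.+1) (- expR (k%:R ^+ 2 * a + e * k%:R)) ^+ i / i`!%:R *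
     expR (- ((i * k ^ 2)%N%:R * s))| <= eps.
Proof.
move=> eps0; set X := expR (k%:R ^+ 2 * a + e * k%:R).
have cX : series (exp_coeff X) M @[M --> \oo] --> expR X.
  exact: is_cvg_series_exp_coeff.
have /cvgrPdist_le/(_ _ eps0)[N _ hN] := cX.
exists N => s s0; have := hN N.+1 (leqnSn _).
have gE : gumbel a e k s = expR (- (X * expR (- (k%:R ^+ 2 * s)))).
  by rewrite /gumbel /X -expRD; congr (expR (- expR _)); ring.
have v1 : expR (- (k%:R ^+ 2 * s)) <= 1.
  by rewrite expR_le1 oppr_le0 mulr_ge0// sqr_ge0.
set v := expR (- (k%:R ^+ 2 * s)) in gE v1.
have nX : `|- (X * v)| <= X.
  have X0 : 0 <= X by exact: expR_ge0.
  have v0 : 0 <= v by exact: expR_ge0.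
  by rewrite normrN normrM (ger0_norm X0) (ger0_norm v0) ler_piMr.
move=> /(le_trans (ler_norm _)); apply: le_trans.
have := expR_taylor_le N.+1 nX; rewrite gE; congr (`|_ - _| <= _).
rewrite /series/= big_mkord; apply: eq_bigr => i _.
rewrite /exp_coeff/= -mulNr exprMn mulrAC; congr (_ * _).
rewrite /v -expRM_natl; congr expR; rewrite natrM natrX; ring.
Qed.

Lemma gumbel_ge0 a e k s : 0 <= gumbel a e k s. Proof. exact: expR_ge0. Qed.

Lemma gumbel_le1 a e k s : gumbel a e k s <= 1.
Proof. by rewrite /gumbel expR_le1 oppr_le0 expR_ge0. Qed.

(** With e = 1 the hypothesis holds for every s <= a, and with e = - 1 that of [gumbel_right] holds
    for every s >= a. The shift e k thus makes the approximation one-sided, up to exp (- k). *)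
Lemma gumbel_left (a e : R) k s : k%:R <= k%:R ^+ 2 * (a - s) + e * k%:R ->
  gumbel a e k s <= expR (- k%:R).
Proof.
move=> h; rewrite /gumbel ler_expR lerN2 (le_trans h)//.
by rewrite (le_trans _ (expR_ge1Dx _))// lerDr.
Qed.

Lemma gumbel_right (a e : R) k s : k%:R ^+ 2 * (a - s) + e * k%:R <= - k%:R ->
  1 - expR (- k%:R) <= gumbel a e k s.
Proof.
move=> h; apply: le_trans (expR_ge1Dx _).
by rewrite lerD2l lerN2 ler_expR.
Qed.

Lemma gumbel_cvg (a e s : R) : `|e| <= 1 -> s != a ->
  gumbel a e k s @[k --> \oo] --> ((a < s)%R%:R : R).
Proof.
move=> e1 sa.
apply: (@squeeze_cvgr _ _ _ _ (fun k => (a < s)%R%:R - expR (- k%:R))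
                              (fun k => (a < s)%R%:R + expR (- k%:R))); last 2 first.
- rewrite -[X in _ --> X]subr0; apply: cvgB; [exact: cvg_cst|exact: cvgn_expR].
- rewrite -[X in _ --> X]addr0; apply: cvgD; [exact: cvg_cst|exact: cvgn_expR].
have sa0 : 0 < `|a - s| by rewrite normr_gt0 subr_eq0 eq_sym.
near=> k.
have k2 : 2 / `|a - s| <= k%:R by near: k; exact: nbhs_infty_ger.
rewrite ler_pdivrMr// in k2.
have k0 : (0 : R) <= k%:R by [].
have ek : `|e * k%:R| <= k%:R by rewrite normrM normr_nat ler_piMl.
move: ek; rewrite ler_norml => /andP[ek1 ek2].
have kk : 2 * k%:R <= k%:R ^+ 2 * `|a - s|.
  by rewrite expr2 -mulrA mulrC ler_wpM2l.
have [as_|sa'] := ltP a s.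
  have h : k%:R ^+ 2 * (a - s) + e * k%:R <= - k%:R.
    move: kk; rewrite ltr0_norm ?subr_lt0// mulrN; lra.
  rewrite (le_trans (gumbel_right h))//= (le_trans (gumbel_le1 _ _ _ _))//.
  by rewrite lerDl expR_ge0.
have h : k%:R <= k%:R ^+ 2 * (a - s) + e * k%:R.
  move: kk; rewrite ger0_norm ?subr_ge0//; lra.
rewrite sub0r add0r (gumbel_left h) andbT.
by rewrite (@le_trans _ _ 0) ?gumbel_ge0// oppr_le0 expR_ge0.
Unshelve. all: by end_near. Qed.

Lemma measurable_gumbel a e k : measurable_fun setT (gumbel a e k).
Proof. by rewrite /gumbel; mfun. Qed.

Lemma gumbel_integral_cvg (h : R -> R) (a e : R) : quadratic_decay h ->
  0 <= a -> `|e| <= 1 ->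
  \int[mu]_(s in `]0, +oo[) (gumbel a e k s * h s) @[k --> \oo] -->
  \int[mu]_(s in `]a, +oo[) h s.
Proof.
move=> [mh [K hK]] a0 e1.
have mnq : measurable_fun setT (fun r : R => (r != a)%:R : R).
  rewrite (_ : (fun r => _) = \1_(~` [set a])).
    by apply: measurable_indic; apply: measurableC; exact: measurable_set1.
  apply/funext => r; rewrite indicE; congr (nat_of_bool _)%:R.
  apply/idP/idP; rewrite inE/=; first by move/eqP.
  by move=> /eqP.
have mg k := measurable_gumbel a e k.
have mI : measurable_fun setT (\1_(`]a, +oo[%classic : set R) : R -> R).
  exact: measurable_indic.
have m1 k : measurable_fun setT (fun s => gumbel a e k s * h s * (s != a)%:R).
  by apply: measurable_funM => //; exact: measurable_funM.
have m2 : measurable_fun setT (fun s => h s * \1_(`]a, +oo[%classic : set R) s).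
  exact: measurable_funM.
have [|||_ cI] := @Rdominated_cvg _ _ _ mu `]0, +oo[%classic (measurable_itv _)
  (fun k s => gumbel a e k s * h s * (s != a)%:R)
  (fun s => h s * \1_(`]a, +oo[%classic : set R) s)
  (fun r => K / oneDsqr r) m1 m2.
- move=> s; rewrite /= in_itv/= andbT => s0.
  have [->|sa] := eqVneq s a.
    under eq_fun do rewrite mulr0.
    by rewrite indicE memNset ?mulr0 /= ?in_itv/= ?ltxx//; exact: cvg_cst.
  under eq_fun do rewrite mulr1 mulrC.
  apply: cvgM; first exact: cvg_cst.
  have -> : \1_(`]a, +oo[%classic : set R) s = ((a < s)%R%:R : R).
    rewrite indicE; congr (nat_of_bool _)%:R.
    by apply/idP/idP; rewrite inE/= in_itv/= andbT.
  exact: gumbel_cvg.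
- move=> k s; rewrite /= in_itv/= andbT => s0; rewrite !normrM.
  apply: le_trans (hK _ s0); rewrite (ger0_norm (gumbel_ge0 _ _ _ _)) normr_nat.
  rewrite mulrAC ler_piMl//.
  by case: (_ != _); rewrite ?mulr1 ?mulr0// gumbel_le1.
- exact: integrable_oneDsqrV.
have E1 : (fun k => \int[mu]_(s in `]0, +oo[) (gumbel a e k s * h s * (s != a)%:R)) =
  (fun k => \int[mu]_(s in `]0, +oo[) (gumbel a e k s * h s)).
  apply/funext => k; rewrite /Rintegral -(@integral_setD1 _ _ a)//; last 2 first.
  - by apply: measurableD.
  - by apply/measurable_EFinP/measurable_funTS.
  rewrite -[in RHS](@integral_setD1 _ _ a)//; last 2 first.
  - by apply: measurableD.
  - by apply/measurable_EFinP/measurable_funTS; exact: measurable_funM.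
  congr fine; apply: eq_integral => r; rewrite inE => -[_] /eqP ->.
  by rewrite mulr1.
rewrite E1 in cI.
suff -> : \int[mu]_(s in `]a, +oo[) h s =
  \int[mu]_(s in `]0, +oo[) (h s * \1_(`]a, +oo[%classic : set R) s) by exact: cI.
rewrite (_ : `]a, +oo[%classic = `]0, +oo[ `&` `]a, +oo[); last first.
  apply/seteqP; split => x /=; rewrite !in_itv/= !andbT.
    by move=> ax; split => //; exact: le_lt_trans ax.
  by case.
rewrite Rintegral_mkcondr; apply: eq_Rintegral => x; rewrite inE/= => x0.
rewrite patchE indicE (_ : (x \in _ `&` _) = (x \in `]a, +oo[%classic)).
  by case: ifP => _; rewrite ?mulr1 ?mulr0.
by apply/idP/idP; rewrite !inE; [case|].
Qed.


(* A bounded Laplace transform at large arguments only feels h near the left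
   end of its support: with X = exp (k^2 a - k), the terms i >= 1 of the series
   of gumbel a (-1) k are at most (X exp (- A k^2))^i / i! *)
Lemma laplace_support (h : R -> R) (A C a : R) : quadratic_decay h ->
  (forall i : nat, `|\int[mu]_(x in `]0, +oo[) (expR (- (i%:R * x)) * h x)| <=
    C * expR (- (A * i%:R))) ->
  0 <= a <= A -> \int[mu]_(x in `]0, a]) h x = 0.
Proof.
move=> qh hC /andP[a0 aA]; have ih := quadratic_decay_integrable qh.
have mh : measurable_fun setT h by case: qh.
have e1 : `|-1 : R| <= 1 by rewrite normrN1.
have C0 : 0 <= C.
  by have := le_trans (normr_ge0 _) (hC 0%N); rewrite mulr0 oppr0 expR0 mulr1.
pose H0 := \int[mu]_(x in `]0, +oo[) h x.
pose H1 := \int[mu]_(x in `]0, +oo[) `|h x|.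
have H10 : 0 <= H1 by exact: Rintegral_ge0.
pose G k := \int[mu]_(x in `]0, +oo[) (gumbel a (-1) k x * h x).
have qe (i : nat) : quadratic_decay (fun x => expR (- (i%:R * x)) * h x).
  rewrite (_ : (fun x => _) = (fun x => h x * expR (- (i%:R * x)))); last first.
    by apply/funext => x; rewrite mulrC.
  apply: (@quadratic_decayM _ _ _ 1 qh); first by mfun.
  move=> x x0; rewrite ger0_norm ?expR_ge0// expR_le1 oppr_le0.
  by rewrite mulr_ge0// ltW.
have key k eps : 0 < eps -> `|G k - H0| <= eps * H1 + C * (expR (expR (- k%:R)) - 1).
  move=> eps0; have [N hN] := gumbel_poly a (-1) k eps0.
  set X := expR (k%:R ^+ 2 * a + -1 * k%:R) in hN.
  pose Pf x := \sum_(i < N.+1) (- X) ^+ i / i`!%:R * expR (- ((i * k ^ 2)%N%:R * x)).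
  have mP : measurable_fun setT Pf.
    by rewrite /Pf; apply: measurable_sum => i; mfun.
  have ic (i : 'I_N.+1) : mu.-integrable `]0, +oo[ (EFin \o (fun x =>
      (- X) ^+ i / i`!%:R * (expR (- ((i * k ^ 2)%N%:R * x)) * h x))).
    rewrite (_ : EFin \o _ = (fun x => ((- X) ^+ i / i`!%:R)%:E *
      (EFin \o (fun x => expR (- ((i * k ^ 2)%N%:R * x)) * h x)%R) x)%E).
      by apply: integrableZl => //; exact: quadratic_decay_integrable (qe _).
    by apply/funext => x; rewrite /= EFinM.
  have PfE : (fun x => Pf x * h x) = (fun x => \sum_(i < N.+1)
      (- X) ^+ i / i`!%:R * (expR (- ((i * k ^ 2)%N%:R * x)) * h x)).
    by apply/funext => x; rewrite /Pf mulr_suml; apply: eq_bigr => i _; rewrite mulrA.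
  have i2 : mu.-integrable `]0, +oo[ (EFin \o (fun x => Pf x * h x)).
    rewrite PfE (_ : EFin \o _ = (fun x => \sum_(i < N.+1)
      (EFin \o (fun x => (- X) ^+ i / i`!%:R * (expR (- ((i * k ^ 2)%N%:R * x)) * h x))%R) x)%E).
      exact: integrable_sum.
    by apply/funext => x; rewrite /= -sumEFin.
  have i1 : mu.-integrable `]0, +oo[ (EFin \o (fun x => gumbel a (-1) k x * h x)).
    apply: quadratic_decay_integrable.
    rewrite (_ : (fun x => _) = (fun x => h x * gumbel a (-1) k x)); last first.
      by apply/funext => x; rewrite mulrC.
    apply: (@quadratic_decayM _ _ _ 1 qh); first exact: measurable_gumbel.
    by move=> x _; rewrite ger0_norm ?gumbel_ge0 ?gumbel_le1.
  have A1 : `|G k - \int[mu]_(x in `]0, +oo[) (Pf x * h x)| <= eps * H1.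
    rewrite /G -RintegralB// /H1 -RintegralZl//; last exact: integrable_norm.
    apply: Rintegral_norm_le => //.
    - by apply: measurable_funB; apply: measurable_funM => //; exact: measurable_gumbel.
    - move=> x; rewrite /= in_itv/= andbT => x0.
      by rewrite -mulrBl normrM ler_wpM2r// hN// ltW.
    - rewrite (_ : EFin \o _ = (fun x => eps%:E * (EFin \o (Num.norm \o h)) x)%E).
        by apply: integrableZl => //; exact: integrable_norm.
      by apply/funext => x; rewrite /= EFinM.
  have A2 : `|\int[mu]_(x in `]0, +oo[) (Pf x * h x) - H0| <=
      C * (expR (expR (- k%:R)) - 1).
    rewrite PfE Rintegral_sum// big_ord_recl.
    rewrite RintegralZl//; last exact: quadratic_decay_integrable (qe _).
    rewrite expr0 fact0 invr1 mulr1 mul1r mul0n.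
    under eq_Rintegral do rewrite mul0r oppr0 expR0 mul1r.
    rewrite -/H0 addrC addrA addNr add0r.
    apply: le_trans (ler_norm_sum _ _ _) _.
    set v := expR (- k%:R).
    have sv : series (exp_coeff v) M @[M --> \oo] --> expR v.
      exact: is_cvg_series_exp_coeff.
    have v0 : 0 <= v by exact: expR_ge0.
    have nd : {homo series (exp_coeff v) : n m / (n <= m)%N >-> n <= m}.
      by apply: nondecreasing_series => n _ _; exact: exp_coeff_ge0.
    have := nondecreasing_cvgn_le nd (cvgP _ sv) N.+1.
    rewrite (cvg_lim (@Rhausdorff _) sv) /series/= big_mkord big_ord_recl.
    rewrite /exp_coeff/= expr0 fact0 divr1 -lerBrDl => hle.
    apply: (@le_trans _ _ (C * \sum_(i < N) v ^+ (bump 0 i) / (bump 0 i)`!%:R)); last first.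
      by rewrite ler_wpM2l.
    rewrite mulr_sumr; apply: ler_sum => i _; set j := bump 0 i.
    rewrite RintegralZl//; last exact: quadratic_decay_integrable (qe _).
    rewrite normrM.
    apply: le_trans (ler_wpM2l (normr_ge0 _) (hC _)) _.
    rewrite normrM normrX normrN normfV normr_nat (ger0_norm (expR_ge0 _)).
    rewrite mulrCA ler_wpM2l// mulrAC ler_wpM2r ?invr_ge0//.
    have -> : expR (- (A * (j * k ^ 2)%:R)) = expR (- (A * k%:R ^+ 2)) ^+ j.
      by rewrite -expRM_natl; congr expR; rewrite natrM natrX; ring.
    rewrite -exprMn lerXn2r ?nnegrE ?mulr_ge0 ?expR_ge0//.
    rewrite -expRD ler_expR mulN1r.
    have : k%:R ^+ 2 * a <= k%:R ^+ 2 * A by rewrite ler_wpM2l ?sqr_ge0.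
    lra.
  rewrite -[G k - H0](subrKA (\int[mu]_(x in `]0, +oo[) (Pf x * h x))).
  apply: le_trans (ler_normD _ _) _; apply: lerD => //.
have key2 k : `|G k - H0| <= C * (expR (expR (- k%:R)) - 1).
  apply/ler_addgt0Pl => eps eps0.
  have := key k (eps / (H1 + 1)); rewrite divr_gt0 ?ltr_wpDl// => /(_ isT) /le_trans; apply.
  rewrite lerD2r mulrAC ler_pdivrMr ?ltr_wpDl// ler_pM2l//.
  by rewrite lerDl.
have GH : G k @[k --> \oo] --> H0.
  apply/cvgrPdist_le => eps eps0.
  have eC : 0 < eps / (C * expR 1 + 1).
    by rewrite divr_gt0// ltr_wpDl// mulr_ge0 ?expR_ge0.
  have /cvgrPdist_le/(_ _ eC) := @cvgn_expR R.
  apply: filterS => k; rewrite sub0r normrN ger0_norm ?expR_ge0// => h1.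
  rewrite distrC (le_trans (key2 k))//.
  set v := expR (- k%:R) in h1 *.
  have v0 : 0 <= v by exact: expR_ge0.
  have v1 : v <= 1 by rewrite expR_le1 oppr_le0.
  have ev : expR v - 1 <= v * expR 1.
    have h2 : 1 - v <= expR (- v) by exact: expR_ge1Dx.
    have h3 : expR v * expR (- v) = 1 by rewrite expRxMexpNx_1.
    have h4 : expR v <= expR 1 by rewrite ler_expR.
    have h5 : 0 < expR v by exact: expR_gt0.
    have h6 : expR v * (1 - v) <= expR v * expR (- v) by rewrite ler_pM2l.
    rewrite h3 in h6.
    have h7 : v * expR v <= v * expR 1 by rewrite ler_wpM2l.
    move: (expR v) (expR 1) h6 h7 => e1' e2' h6 h7; lra.
  apply: le_trans (ler_wpM2l C0 ev) _.
  move: h1; rewrite ler_pdivlMr; last by rewrite ltr_wpDl// mulr_ge0 ?expR_ge0.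
  by move=> /(le_trans _); apply; rewrite mulrDr mulr1 mulrCA lerDl.
(* [G] tends to the integral over ]0, +oo[ by the smallness of the transform and to the integral
   over ]a, +oo[ by [gumbel_integral_cvg]; nothing is left on ]0, a]. *)
have E : H0 = \int[mu]_(x in `]a, +oo[) h x.
  rewrite -(cvg_lim (@Rhausdorff _) GH).
  by apply: cvg_lim; [exact: Rhausdorff|exact: gumbel_integral_cvg].
have := E; rewrite /H0 (@itv_bndbnd_setU _ _ _ (BRight a)) ?bnd_simp//.
rewrite Rintegral_setU//=.
- by move/eqP; rewrite -subr_eq0 addrK => /eqP.
- by rewrite -itv_bndbnd_setU ?bnd_simp.
- apply/disj_setPS => y [/=]; rewrite 2!in_itv/= => /andP[_ ya] /andP[].
  by rewrite ltNge ya.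
Qed.

End gumbel.

Lemma squeeze3 (R : realDomainType) (L I1 I2 M1 M2 d T e : R) :
  `|L - I1| <= e -> `|L - I2| <= e -> `|I1 - M1| <= e -> `|I2 - M2| <= e ->
  d <= e -> M1 - d <= T -> T <= M2 + d -> `|L - T| <= 3 * e.
Proof.
rewrite !ler_norml => /andP[? ?] /andP[? ?] /andP[? ?] /andP[? ?] ? ? ?.
by apply/andP; split; lra.
Qed.

(** * Convergence of tails from Laplace transforms at the integers *)

Section tail_convergence.
Context {R : realType}.
Notation mu := (@lebesgue_measure R).
Variables (w s : nat -> nat -> R) (m : nat -> nat) (h : R -> R).
Hypothesis w0 : forall n j, 0 <= w n j.
Hypothesis s0 : forall n j, 0 <= s n j.
Hypothesis qh : quadratic_decay h.
Hypothesis laplace_cvg : forall i : nat,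
  \sum_(j < m n) w n j * expR (- (i%:R * s n j)) @[n --> \oo] -->
  \int[mu]_(x in `]0, +oo[) (expR (- (i%:R * x)) * h x).

Let M (f : R -> R) n := \sum_(j < m n) w n j * f (s n j).
Let I (f : R -> R) := \int[mu]_(x in `]0, +oo[) (f x * h x).

Let qf (f : R -> R) (C : R) : measurable_fun setT f -> (forall x : R, 0 < x -> `|f x| <= C) ->
  quadratic_decay (fun x => f x * h x).
Proof.
move=> mf fC; rewrite (_ : (fun x => _) = (fun x => h x * f x)).
  exact: quadratic_decayM fC.
by apply/funext => x; rewrite mulrC.
Qed.

Let gumbel_M_cvg a e k : M (gumbel a e k) n @[n --> \oo] --> I (gumbel a e k).
Proof.
pose H := \int[mu]_(x in `]0, +oo[) `|h x|.
have H0 : 0 <= H by exact: Rintegral_ge0.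
have ih := quadratic_decay_integrable qh.
have mh : measurable_fun setT h by case: qh.
have M1 : M (fun=> 1) n @[n --> \oo] --> I (fun=> 1).
  have := @laplace_cvg 0%N; rewrite /M /I.
  under eq_fun do under eq_bigr do rewrite mul0r oppr0 expR0.
  by under eq_Rintegral do rewrite mul0r oppr0 expR0.
have I1 : I (fun=> 1) <= H.
  rewrite /I /H; apply: le_Rintegral => //.
  - by rewrite (_ : (fun x => 1 * h x) = h)//; apply/funext => x; rewrite mul1r.
  - exact: integrable_norm.
  - by move=> x _; rewrite mul1r ler_norm.
apply/cvgrPdist_le => eps eps0.
(* H + 1 bounds the mass of |h| and, for large n, the total weight, so each replacement of [gumbel]
   by its polynomial costs at most eps / 3. *)
pose ep := eps / (3 * (H + 1)).
have H1 : 0 < H + 1 by rewrite ltr_wpDl.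
have ep0 : 0 < ep by rewrite divr_gt0// mulr_gt0.
have [N0 hN] := gumbel_poly a e k ep0; set N := N0.+1 in hN.
pose c i := (- expR (k%:R ^+ 2 * a + e * k%:R)) ^+ i / i`!%:R.
pose Pf x := \sum_(i < N) c i * expR (- ((i * k ^ 2)%N%:R * x)).
have mP : measurable_fun setT Pf.
  rewrite (_ : Pf = (fun x => \sum_(i < N) (fun i x => c i * expR (- ((i * k ^ 2)%N%:R * x))) i x))//.
  by apply: measurable_sum => i; mfun.
have mc (i : 'I_N) : mu.-integrable `]0, +oo[ (EFin \o (fun x =>
    c i * expR (- ((i * k ^ 2)%N%:R * x)) * h x)).
  apply: quadratic_decay_integrable; apply: (@qf _ `|c i|); first by mfun.
  move=> x x0; rewrite normrM ler_piMr// ger0_norm ?expR_ge0// expR_le1 oppr_le0.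
  by rewrite mulr_ge0// ltW.
have IP : I Pf = \sum_(i < N) c i *
    \int[mu]_(x in `]0, +oo[) (expR (- ((i * k ^ 2)%N%:R * x)) * h x).
  rewrite /I /Pf.
  under eq_Rintegral do rewrite mulr_suml.
  rewrite Rintegral_sum//.
  apply: eq_bigr => i _; rewrite -RintegralZl//.
    by apply: eq_Rintegral => x _; rewrite mulrA.
  apply: quadratic_decay_integrable; apply: (@qf _ 1); first by mfun.
  move=> x x0; rewrite ger0_norm ?expR_ge0// expR_le1 oppr_le0.
  by rewrite mulr_ge0// ltW.
have MP : M Pf n @[n --> \oo] --> I Pf.
  rewrite IP (_ : M Pf = (fun n => \sum_(i < N) c i *
    \sum_(j < m n) w n j * expR (- ((i * k ^ 2)%N%:R * s n j)))).
    apply: cvgn_sum => i; apply: cvgM; first exact: cvg_cst.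
    exact: laplace_cvg.
  apply/funext => n; rewrite /M /Pf.
  under eq_bigr do rewrite mulr_sumr.
  rewrite exchange_big/=; apply: eq_bigr => i _; rewrite mulr_sumr.
  by apply: eq_bigr => j _; rewrite mulrCA.
have PI : `|I (gumbel a e k) - I Pf| <= ep * H.
  have i1 : mu.-integrable `]0, +oo[ (EFin \o (fun x => gumbel a e k x * h x)).
    apply: quadratic_decay_integrable; apply: (@qf _ 1); first exact: measurable_gumbel.
    by move=> x _; rewrite ger0_norm ?gumbel_ge0 ?gumbel_le1.
  have i2 : mu.-integrable `]0, +oo[ (EFin \o (fun x => Pf x * h x)).
    rewrite (_ : (fun x => Pf x * h x) = (fun x => \sum_(i < N)
      c i * expR (- ((i * k ^ 2)%N%:R * x)) * h x)); last first.
      by apply/funext => x; rewrite /Pf mulr_suml.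
    rewrite (_ : EFin \o _ = (fun x => \sum_(i < N)
      (EFin \o (fun x => c i * expR (- ((i * k ^ 2)%N%:R * x)) * h x)%R) x)%E).
      exact: integrable_sum.
    by apply/funext => x; rewrite /= -sumEFin.
  rewrite /I -RintegralB// /H -RintegralZl//; last exact: integrable_norm.
  apply: Rintegral_norm_le => //.
  - by apply: measurable_funB; apply: measurable_funM => //; exact: measurable_gumbel.
  - move=> x; rewrite /= in_itv/= andbT => x0.
    by rewrite -mulrBl normrM ler_wpM2r// hN// ltW.
  - rewrite (_ : EFin \o _ = (fun x => ep%:E * (EFin \o (Num.norm \o h)) x)%E).
      by apply: integrableZl => //; exact: integrable_norm.
    by apply/funext => x; rewrite /= EFinM.
near=> n.
have A1 : `|I Pf - M Pf n| <= eps / 3.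
  by near: n; move/cvgrPdist_le: MP; apply; rewrite divr_gt0.
have A2 : M (fun=> 1) n <= H + 1.
  near: n; move/cvgrPdist_le: M1 => /(_ _ ltr01); apply: filterS => n.
  rewrite ler_norml => /andP[h1 h2]; lra.
have A3 : `|M Pf n - M (gumbel a e k) n| <= ep * (H + 1).
  rewrite /M -sumrB; apply: le_trans (ler_norm_sum _ _ _) _.
  apply: (@le_trans _ _ (ep * M (fun=> 1) n)); last by rewrite ler_pM2l.
  rewrite /M mulr_sumr; apply: ler_sum => j _.
  rewrite -mulrBr normrM (ger0_norm (w0 _ _)) mulr1 mulrC ler_wpM2r//.
  by rewrite distrC hN.
have A4 : ep * (H + 1) = eps / 3 by rewrite /ep; field; exact: lt0r_neq0.
have A5 : ep * H <= ep * (H + 1) by rewrite ler_pM2l// lerDl.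
have -> : I (gumbel a e k) - M (gumbel a e k) n = (I (gumbel a e k) - I Pf) +
   ((I Pf - M Pf n) + (M Pf n - M (gumbel a e k) n)) by ring.
apply: le_trans (ler_normD _ _) _.
apply: le_trans (lerD PI (ler_normD _ _)) _.
lra.
Unshelve. all: by end_near. Qed.

(* Limits at the integers suffice: the indicator of ]t, +oo[ lies, up to a small
   error, between two functions [gumbel], which are limits of polynomials in
   exp (- s). *)
Lemma tail_sum_cvg (t : R) : 0 <= t ->
  \sum_(j < m n | t < s n j) w n j @[n --> \oo] --> \int[mu]_(x in `]t, +oo[) h x.
Proof.
move=> t0.
set L := Rintegral _ _ _; set T := fun n => _.
have M1 : M (fun=> 1) n @[n --> \oo] --> I (fun=> 1).
  have := @laplace_cvg 0%N; rewrite /M /I.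
  under eq_fun do under eq_bigr do rewrite mul0r oppr0 expR0.
  by under eq_Rintegral do rewrite mul0r oppr0 expR0.
have M10 n : 0 <= M (fun=> 1) n by apply: sumr_ge0 => j _; rewrite mulr1.
have TE n : T n = M (fun x => (t < x)%R%:R) n.
  rewrite /T /M big_mkcond/=; apply: eq_bigr => j _.
  by case: ifP => _; rewrite ?mulr1 ?mulr0.
have lo k n : M (gumbel t 1 k) n - expR (- k%:R) * M (fun=> 1) n <= T n.
  rewrite lerBlDr TE /M mulr_sumr -big_split/=; apply: ler_sum => j _.
  rewrite mulrCA -mulrDr mulr1 ler_wpM2l//.
  have [ts|st] := ltP t (s n j).
    by rewrite (le_trans (gumbel_le1 _ _ _ _))// lerDl expR_ge0.
  rewrite add0r gumbel_left// mul1r lerDr.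
  by rewrite mulr_ge0 ?sqr_ge0// subr_ge0.
have up k n : T n <= M (gumbel t (-1) k) n + expR (- k%:R) * M (fun=> 1) n.
  rewrite TE /M mulr_sumr -big_split/=; apply: ler_sum => j _.
  rewrite mulrCA -mulrDr mulr1 ler_wpM2l//.
  have [ts|st] := ltP t (s n j); last first.
    by apply: addr_ge0; [exact: gumbel_ge0|exact: expR_ge0].
  rewrite -lerBlDr gumbel_right// mulN1r gerDr.
  by rewrite mulr_ge0_le0 ?sqr_ge0// subr_le0 ltW.
have e1 : `|1 : R| <= 1 by rewrite normr1.
have e2 : `|-1 : R| <= 1 by rewrite normrN1.
have g1 := gumbel_integral_cvg qh t0 e1.
have g2 := gumbel_integral_cvg qh t0 e2.
apply/cvgrPdist_le => eps eps0.
pose B := `|I (fun=> 1)| + 1.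
have B0 : 0 < B by rewrite ltr_wpDl.
have [k [k1 [k2 k3]]] : exists k : nat, `|L - I (gumbel t 1 k)| <= eps / 3 /\
   (`|L - I (gumbel t (-1) k)| <= eps / 3 /\ expR (- k%:R) * B <= eps / 3).
  have e3 : 0 < eps / 3 by rewrite divr_gt0.
  have := @cvgn_expR R => /cvgrPdist_le/(_ _ (divr_gt0 e3 B0)) h3.
  move/cvgrPdist_le: g1 => /(_ _ e3) h1; move/cvgrPdist_le: g2 => /(_ _ e3) h2.
  have [k _ hk] := filterI h1 (filterI h2 h3).
  have [h4 [h5 h6]] := hk k (leqnn k).
  exists k; split; first exact: h4.
  split; first exact: h5.
  move: h6 => /=; rewrite sub0r normrN (ger0_norm (expR_ge0 _)).
  by rewrite ler_pdivlMr.
have e3 : 0 < eps / 3 by rewrite divr_gt0.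
move/cvgrPdist_le: (@gumbel_M_cvg t 1 k) => /(_ _ e3) H1.
move/cvgrPdist_le: (@gumbel_M_cvg t (-1) k) => /(_ _ e3) H2.
move/cvgrPdist_le: M1 => /(_ _ ltr01) H3.
apply: (filterS _ (filterI H1 (filterI H2 H3))) => n [A1 [A2 A3]].
have A4 : expR (- k%:R) * M (fun=> 1) n <= eps / 3.
  apply: le_trans k3; rewrite ler_pM2l ?expR_gt0//.
  have h1 := ler_norm (I (fun=> 1)).
  rewrite -[leLHS](subrK (I (fun=> 1))) /B addrC; apply: lerD => //.
  by apply: le_trans A3; rewrite distrC ler_norm.
have -> : eps = 3 * (eps / 3) by field.
exact: squeeze3 k1 k2 A1 A2 A4 (lo k n) (up k n).
Qed.

End tail_convergence.

(** * Mittag-Leffler functions and inversion in the level *)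

Section mittag_leffler.
Context {R : realType}.
Notation mu := (@lebesgue_measure R).

Lemma powR_le_expR (p : R) : 0 <= p -> exists2 C, 0 <= C &
  forall u, 0 <= u -> u `^ p <= C * expR (u / 2).
Proof.
move=> p0; pose n := Num.truncn p.
have np : p <= n.+1%:R by rewrite ltW// truncnS_gt.
exists (1 + n.+1`!%:R * 2 ^+ n.+1) => [|u u0].
  by rewrite addr_ge0// mulr_ge0// exprn_ge0.
have u20 : 0 <= u / 2 by rewrite divr_ge0.
have := @expR_ge1Dxn R (u / 2) n u20; rewrite expr_div_n => h.
have f0 : (0 : R) < n.+1`!%:R by rewrite ltr0n fact_gt0.
have h2 : u ^+ n.+1 <= n.+1`!%:R * 2 ^+ n.+1 * expR (u / 2).
  have : u ^+ n.+1 / 2 ^+ n.+1 / n.+1`!%:R <= expR (u / 2).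
    by rewrite (le_trans _ h)// lerDr.
  by rewrite ler_pdivrMr// ler_pdivrMr ?exprn_gt0//; congr (_ <= _); ring.
have e1 : 1 <= expR (u / 2) by rewrite (le_trans _ (expR_ge1Dx _))// lerDl.
rewrite mulrDl mul1r; have [u1|u1] := leP u 1.
  rewrite (@le_trans _ _ 1)//; last by rewrite ler_wpDr// mulr_ge0 ?expR_ge0// mulr_ge0// exprn_ge0.
  by have := ge0_ler_powR p0 u0 ler01 u1; rewrite powR1.
rewrite (@le_trans _ _ (u ^+ n.+1))//; last by rewrite ler_wpDl// expR_ge0.
by rewrite -powR_mulrn// ler_powR// ltW.
Qed.

Lemma gamma_integrand_decay (z t : R) : 1 <= z -> 0 < t ->
  quadratic_decay (fun u => u `^ (z - 1) * expR (- (t * u))).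
Proof.
move=> z1 t0; have [C C0 hC] := @powR_le_expR (z - 1) (eqbRL (subr_ge0 _ _) z1).
have t20 : 0 < t / 2 by rewrite divr_gt0.
have [K K0 hK] := expR_decay t20.
split; first by mfun.
exists (t^-1 `^ (z - 1) * C * K) => u u0.
rewrite normrM !ger0_norm ?powR_ge0 ?expR_ge0//.
have -> : u `^ (z - 1) = t^-1 `^ (z - 1) * (t * u) `^ (z - 1).
  by rewrite -powRM ?invr_ge0 ?mulr_ge0 ?(ltW t0) ?(ltW u0)// mulKf// gt_eqF.
rewrite -!mulrA ler_wpM2l ?powR_ge0//.
apply: le_trans (ler_wpM2r (expR_ge0 _) (hC (t * u) _)) _.
  by rewrite mulr_ge0// ltW.
rewrite -mulrA ler_wpM2l// -expRD.
have := hK _ (ltW u0).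
by congr (expR _ <= _); field.
Qed.

Lemma laplace_powR (z t : R) : 1 <= z -> 0 < t ->
  \int[mu]_(u in `]0, +oo[) (u `^ (z - 1) * expR (- (t * u))) = Gamma z / t `^ z.
Proof.
move=> z1 t0; rewrite /Gamma.
pose G (u : R) := u `^ (z - 1) * expR (- u).
pose F (u : R) := t * u.
have dF (x : R) : is_derive x 1 F t.
  apply: is_derive_eq (is_derive_mul (is_derive_cst t x 1) (is_derive_id x 1)) _.
  by rewrite /cst/=; ring.
have F'E : derive1 F = cst t.
  by apply/funext => x; rewrite derive1E; case: (dF x).
have F0 : F 0 = 0 by rewrite /F mulr0.
have cp : {within `[0, +oo[, continuous (fun u : R => u `^ (z - 1))}.
  apply/continuous_within_itvcyP; split.
    move=> x; rewrite in_itv/= andbT => x0.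
    exact: is_derive_continuous (is_derive1_powR _ x0).
  have [->|z11] := eqVneq z 1.
    by rewrite subrr powRr0; under eq_fun do rewrite powRr0; exact: cvg_cst.
  have z10 : 0 < z - 1 by rewrite subr_gt0 lt_neqAle eq_sym z11.
  by rewrite powR0 ?gt_eqF//; exact: powR_cvg0.
have cG : {within `[0, +oo[, continuous G}.
  move=> x; apply: cvgM; first exact: cp.
  apply: continuous_subspaceT => y.
  by apply: continuous_comp; [exact: continuousN|exact: continuous_expR].
have S := @increasing_ge0_integration_by_substitutiony R F G 0.
have : (\int[mu]_(x in `[F 0%R, +oo[) (G x)%:E =
        \int[mu]_(x in `[0%R, +oo[) (((G \o F) * derive1 F)%R x)%:E)%E.
  apply: S.
  - by move=> x y _ _ xy; rewrite /F ltr_pM2l.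
  - by rewrite F'E => x _; exact: cvg_cst.
  - by rewrite F'E; exact: is_cvg_cst.
  - by rewrite F'E; exact: is_cvg_cst.
  - split; first by move=> x _; case: (dF x).
    by apply: cvg_at_right_filter; exact: is_derive_continuous (dF 0).
  - by apply: gt0_cvgMry => //; exact: cvg_id.
  - by rewrite F0.
  - by move=> x _; rewrite mulr_ge0 ?powR_ge0 ?expR_ge0.
rewrite F0 => E.
have iG := quadratic_decay_integrable (gamma_integrand_decay z1 t0).
have t1 : t `^ z = t * t `^ (z - 1).
  by rewrite mulr_powRB1 ?ltW// (lt_le_trans ltr01).
have E2 : (fun u => ((G \o F) * derive1 F) u) =
    (fun u => if 0 <= u then t `^ z * (u `^ (z - 1) * expR (- (t * u))) else
              ((G \o F) * derive1 F) u).
  apply/funext => u; case: ifP => // u0.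
  transitivity (G (F u) * derive1 F u); first by [].
  by rewrite F'E /G /F /cst/= powRM ?(ltW t0)// t1; ring.
apply/eqP; rewrite eq_sym; apply/eqP.
rewrite -[LHS]mulr1 -[X in _ * X](mulfV (_ : t `^ z != 0)); last first.
  by rewrite gt_eqF// powR_gt0.
have tz0 : t `^ z != 0 by rewrite gt_eqF// powR_gt0.
rewrite mulrA mulfVK//.
apply: (mulfI tz0); rewrite -RintegralZl//.
rewrite [LHS]mulrA mulrAC mulfV// mul1r.
rewrite /Rintegral integral_itv_obnd_cbnd; last first.
  by apply/measurable_EFinP; apply: measurable_funTS; mfun.
rewrite [in RHS]integral_itv_obnd_cbnd; last first.
  by apply/measurable_EFinP; apply: measurable_funTS; mfun.
congr fine; rewrite E; apply: eq_integral => u; rewrite inE/= in_itv/= andbT => u0.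
by have := congr1 (fun f => f u) E2; rewrite u0 => ->.
Qed.

Lemma Gamma_gt0 (z : R) : 1 <= z -> 0 < Gamma z.
Proof.
move=> z1; have q := gamma_integrand_decay z1 ltr01.
have iG := quadratic_decay_integrable q.
have E : (fun u => u `^ (z - 1) * expR (- (1 * u))) = (fun u => u `^ (z - 1) * expR (- u)).
  by apply/funext => u; rewrite mul1r.
rewrite E in iG.
have iJ : mu.-integrable `]0, +oo[ (EFin \o (\1_(`]1, 2]%classic : set R) : R -> R)).
  apply: quadratic_decay_integrable; split; first exact: measurable_indic.
  exists 5 => u u0; rewrite indicE.
  have [|_] := boolP (u \in _); last by rewrite normr0 divr_ge0// ltW// oneDsqr_gt0.
  rewrite inE/= in_itv/= => /andP[u1 u2]; rewrite normr1.
  by rewrite ler_pdivlMr ?oneDsqr_gt0// mul1r /oneDsqr; nra.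
pose J : R -> R := \1_(`]1, 2]%classic : set R).
have iI : mu.-integrable `]0, +oo[ (EFin \o (fun u : R =>
    expR (- 2) * \1_(`]1, 2]%classic : set R) u)).
  rewrite (_ : EFin \o _ = (fun u => (expR (- 2))%:E * (EFin \o J) u)%E).
    exact: integrableZl.
  by apply/funext => u; rewrite /= EFinM.
(* On ]1, 2], an interval of length 1, the integrand is at least exp (- 2) because z >= 1. *)
apply: (@lt_le_trans _ _ (expR (- 2))); first exact: expR_gt0.
have -> : expR (- 2) = \int[mu]_(u in `]0, +oo[)
    (expR (- 2) * \1_(`]1, 2]%classic : set R) u).
  rewrite RintegralZl//.
  rewrite -[LHS]mulr1; congr (_ * _).
  transitivity (\int[mu]_(u in `]0, +oo[ `&` `]1, 2]) (1 : R)).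
    rewrite (_ : `]0, +oo[ `&` _ = `]1, 2]%classic); last first.
      apply/seteqP; split => x /=; rewrite !in_itv/= ?andbT; first by case.
      by move=> /andP[h1 h2]; rewrite h1 h2; split => //; rewrite (lt_trans ltr01).
    rewrite Rintegral_cst//= lebesgue_measure_itv/= lte_fin ltr1n/= mul1r.
    by rewrite (_ : 2 - 1 = 1 :> R)//; ring.
  rewrite Rintegral_mkcondr; apply: eq_Rintegral => u _.
  by rewrite patchE indicE; case: ifP.
rewrite /Gamma; apply: le_Rintegral => // u; rewrite /= in_itv/= andbT => u0.
rewrite indicE; have [|_] := boolP (u \in _).
  rewrite inE/= in_itv/= => /andP[u1 u2]; rewrite mulr1 -[leLHS]mul1r.
  apply: ler_pM; rewrite ?expR_ge0//.
    apply: (@le_trans _ _ ((1 : R) `^ (z - 1))); first by rewrite powR1.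
    by apply: ge0_ler_powR; rewrite ?nnegrE ?subr_ge0// ltW.
  by rewrite ler_expR lerN2.
by rewrite mulr0 mulr_ge0 ?powR_ge0 ?expR_ge0.
Qed.

(** With nonnegative coefficients the tail at X dominates the tails at all |y| <= X, so the partial
    sums converge locally uniformly. *)
Lemma pseries_continuous (c : nat -> R) : (forall n, 0 <= c n) ->
  (forall X : R, 0 <= X -> cvgn (series (fun n => c n * X ^+ n))) ->
  continuous (fun x : R => limn (series (fun n => c n * x ^+ n))).
Proof.
move=> c0 cc x; pose S x := series (fun n => c n * x ^+ n).
have abs y : cvgn (S y).
  apply: normed_cvg; apply: series_le_cvg (cc `|y| (normr_ge0 _)) => n.
  - exact: normr_ge0.
  - by apply: mulr_ge0 => //; apply: exprn_ge0.
  - by rewrite /= normrM normrX (ger0_norm (c0 _)).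
pose X := `|x| + 1.
have X0 : 0 <= X by rewrite addr_ge0.
have tail y N : `|y| <= X -> `|limn (S y) - S y N| <= limn (S X) - S X N.
  move=> yX.
  have h1 : `|S y M - S y N| @[M --> \oo] --> `|limn (S y) - S y N|.
    by apply: cvg_norm; apply: cvgB; [exact: abs|exact: cvg_cst].
  have h2 : S X M - S X N @[M --> \oo] --> limn (S X) - S X N.
    by apply: cvgB; [exact: cc|exact: cvg_cst].
  apply: ler_cvg_to h1 h2 _; near=> M.
  have NM : (N <= M)%N by near: M; exact: nbhs_infty_ge.
  rewrite !sub_series NM.
  apply: le_trans (ler_norm_sum _ _ _) _; apply: ler_sum => i _.
  rewrite normrM normrX (ger0_norm (c0 _)) ler_wpM2l//.
  by rewrite lerXn2r ?nnegrE.
apply/cvgrPdist_le => eps eps0.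
have e3 : 0 < eps / 3 by rewrite divr_gt0.
have /cvgrPdist_le/(_ _ e3)[N _ /(_ N (leqnn N)) hN] := cc X X0.
have cS : {for x, continuous (fun y => S y N)}.
  rewrite (_ : (fun y => S y N) = (fun y => \sum_(i < N) c i * y ^+ i)); last first.
    by apply/funext => y; rewrite /S /series/= big_mkord.
  elim: N {hN} => [|N IH].
    rewrite (_ : (fun y => _) = (fun=> 0)); first exact: cvg_cst.
    by apply/funext => y; rewrite big_ord0.
  rewrite (_ : (fun y => _) = (fun y => \sum_(i < N) c i * y ^+ i + c N * y ^+ N)); last first.
    by apply/funext => y; rewrite big_ord_recr.
  by apply: cvgD => //; apply: cvgM; [exact: cvg_cst|exact: exprn_continuous].
have xX : `|x| <= X by rewrite lerDl.
move/cvgrPdist_le: cS => /(_ _ e3).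
have : \forall y \near x, `|y| <= X.
  have /cvgrPdist_le/(_ _ ltr01) := @cvg_id _ (nbhs x).
  apply: filterS => y h; rewrite /X -[y](subKr x); apply: le_trans (ler_normB _ _) _.
  by rewrite lerD2l.
apply: filterS2 => y yX h.
have t1 := le_trans (tail x N xX) (le_trans (ler_norm _) hN).
have t2 := le_trans (tail y N yX) (le_trans (ler_norm _) hN).
have -> : limn (S x) - limn (S y) = (limn (S x) - S x N) + (S x N - S y N) + (S y N - limn (S y)) by ring.
have := ler_normD (limn (S x) - S x N + (S x N - S y N)) (S y N - limn (S y)).
have := ler_normD (limn (S x) - S x N) (S x N - S y N).
rewrite [`|S y N - _|]distrC.
move: t1 t2 h; set a1 := `|_|; set a2 := `|_|; set a3 := `|_|.
set a4 := `|_|; set a5 := `|_|; lra.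
Unshelve. all: by end_near. Qed.

End mittag_leffler.

Section indicator_integral.
Context {R : realType}.
Notation mu := (@lebesgue_measure R).

Lemma Rintegral_indic_oc (C p q : R) : 0 <= p -> p <= q ->
  mu.-integrable `]0, +oo[ (EFin \o (fun u => C * \1_(`]p, q]%classic : set R) u)) /\
  \int[mu]_(u in `]0, +oo[) (C * \1_(`]p, q]%classic : set R) u) = C * (q - p).
Proof.
move=> p0 pq.
have mI : measurable_fun setT (\1_(`]p, q]%classic : set R) : R -> R).
  exact: measurable_indic.
have qI : quadratic_decay (fun u => C * \1_(`]p, q]%classic : set R) u).
  split; first exact: measurable_funM.
  exists (`|C| * oneDsqr q) => u u0; rewrite indicE normrM.
  rewrite -mulrA ler_wpM2l// ler_pdivlMr ?oneDsqr_gt0//.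
  have [|_] := boolP (u \in _); last by rewrite normr0 mul0r ltW// oneDsqr_gt0.
  rewrite inE/= in_itv/= => /andP[u1 u2]; rewrite normr1 mul1r.
  by rewrite lerD2l ler_sqr ?nnegrE// ?(ltW u0)// (le_trans p0).
split; first exact: quadratic_decay_integrable.
transitivity (\int[mu]_(u in `]0, +oo[ `&` `]p, q]) C).
  rewrite Rintegral_mkcondr; apply: eq_Rintegral => u _.
  by rewrite patchE indicE; case: ifP; rewrite ?mulr1 ?mulr0.
rewrite (_ : `]0, +oo[ `&` _ = `]p, q]%classic); last first.
  apply/seteqP; split => x /=; rewrite !in_itv/= ?andbT; first by case.
  by move=> /andP[h1 h2]; rewrite h1 h2; split => //; rewrite (le_lt_trans p0).
rewrite Rintegral_cst//= lebesgue_measure_itv/= lte_fin.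
by move: pq; rewrite le_eqVlt => /predU1P[->|->]//; rewrite ltxx subrr.
Qed.

End indicator_integral.

(** * Growth and Laplace transform of the Mittag-Leffler function *)

Section mittag_leffler_bounds.
Context {R : realType}.
Notation mu := (@lebesgue_measure R).
Variable a : R.
Hypothesis a1 : 1 < a.
Let b := a^-1.

Let a0 : 0 < a. Proof. exact: lt_trans a1. Qed.
Let pz n : 1 <= a * n%:R + a.
Proof.
have h := a1; have : 0 <= a * n%:R by rewrite mulr_ge0// ltW.
lra.
Qed.
Let Gp n : 0 < Gamma (a * n%:R + a). Proof. exact: Gamma_gt0. Qed.

Let cf n := (Gamma (a * n%:R + a))^-1.
Let cf0 n : 0 <= cf n. Proof. by rewrite invr_ge0 ltW. Qed.

(** Partial sums of c^(a - 1) E_(a, a)(x c^a). Their transforms in c are finite geometric sums,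
    because Gamma cancels. *)
Let S N (x c : R) := \sum_(n < N) cf n * x ^+ n * c `^ (a * n%:R + a - 1).

Let term_decay (th c : R) n : 0 < th ->
  quadratic_decay (fun s => c * (s `^ (a * n%:R + a - 1) * expR (- (th * s)))).
Proof.
move=> th0; have [m [K hK]] := gamma_integrand_decay (pz n) th0.
split; first by mfun.
exists (`|c| * K) => u u0; rewrite normrM -mulrA ler_wpM2l//; exact: hK.
Qed.

Let powR_an (th : R) n : 0 < th -> th `^ (a * n%:R + a) = (th `^ a) ^+ n.+1.
Proof.
move=> th0; rewrite -powR_mulrn ?powR_ge0// -powRrM; congr (_ `^ _).
by rewrite -addn1 natrD; ring.
Qed.

Let S_decay N (x th : R) : 0 < th ->
  mu.-integrable `]0, +oo[ (EFin \o (fun s => expR (- (th * s)) * S N x s)) /\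
  \int[mu]_(s in `]0, +oo[) (expR (- (th * s)) * S N x s) =
  \sum_(n < N) x ^+ n / (th `^ a) ^+ n.+1.
Proof.
move=> th0.
have E : (fun s => expR (- (th * s)) * S N x s) =
  (fun s => \sum_(n < N) (cf n * x ^+ n) * (s `^ (a * n%:R + a - 1) * expR (- (th * s)))).
  by apply/funext => s; rewrite /S mulr_sumr; apply: eq_bigr => n _; ring.
have it (n : 'I_N) := quadratic_decay_integrable (term_decay (cf n * x ^+ n) n th0).
split.
  rewrite E (_ : EFin \o _ = (fun s => \sum_(n < N)
    (EFin \o (fun s => (cf n * x ^+ n) * (s `^ (a * n%:R + a - 1) * expR (- (th * s))))%R) s)%E).
    exact: integrable_sum.
  by apply/funext => s; rewrite /= -sumEFin.
rewrite E Rintegral_sum//; apply: eq_bigr => n _.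
rewrite RintegralZl//; last first.
  exact: quadratic_decay_integrable (gamma_integrand_decay (pz n) th0).
rewrite laplace_powR// powR_an// /cf.
have g0 : Gamma (a * n%:R + a) != 0 by rewrite gt_eqF.
have t0 : th `^ a != 0 by rewrite gt_eqF// powR_gt0.
by rewrite exprS; field; rewrite g0 t0 expf_neq0.
Qed.

Let geom N (x z : R) : z != 0 -> z != x ->
  \sum_(n < N) x ^+ n / z ^+ n.+1 = (1 - (x / z) ^+ N) / (z - x).
Proof.
move=> z0 zx; have zx0 : z - x != 0 by rewrite subr_eq0.
elim: N => [|N IH]; first by rewrite big_ord0 expr0 subrr mul0r.
rewrite big_ord_recr/= IH !expr_div_n !exprS.
by field; rewrite zx0 z0 expf_neq0.
Qed.

Let b_gt0 : 0 < b. Proof. by rewrite invr_gt0. Qed.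

Let powRb (x : R) : 0 < x -> (x `^ b) `^ a = x.
Proof. by move=> x0; rewrite -powRrM /b mulVf ?gt_eqF// powRr1// ltW. Qed.

Let S_ge0 N (x c : R) : 0 <= x -> 0 <= S N x c.
Proof. by move=> x0; apply: sumr_ge0 => n _; rewrite !mulr_ge0 ?powR_ge0 ?exprn_ge0. Qed.

Let S_mono N (x c c' : R) : 0 <= x -> 0 <= c <= c' -> S N x c <= S N x c'.
Proof.
move=> x0 /andP[c0 cc']; apply: ler_sum => n _.
rewrite ler_wpM2l ?mulr_ge0 ?exprn_ge0//.
by rewrite ge0_ler_powR ?nnegrE ?subr_ge0// (le_trans c0).
Qed.

Let measurable_S N (x : R) : measurable_fun setT (S N x).
Proof. by apply: measurable_sum => n; mfun. Qed.

(* S N x is nondecreasing, so its Laplace transform controls its values *)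
Let S_le N (x c : R) : 0 <= x -> 0 < c -> S N x c <= expR ((c + 1) * (x + 1) `^ b).
Proof.
(* This [th] satisfies th^a - x = 1, so the transform at [th] is at most 1; comparing it with its
   part over ]c, c + 1] gives the bound. *)
move=> x0 c0; set th := (x + 1) `^ b.
have x1 : 0 < x + 1 by rewrite ltr_wpDl.
have th0 : 0 < th by rewrite powR_gt0.
have tha : th `^ a = x + 1 by rewrite powRb.
have [iS IS] := S_decay N x th0.
pose C := expR (- (th * (c + 1))) * S N x c.
have [iC IC] : mu.-integrable `]0, +oo[ (EFin \o (fun u => C * \1_(`]c, (c + 1)]%classic : set R) u)) /\
  \int[mu]_(u in `]0, +oo[) (C * \1_(`]c, (c + 1)]%classic : set R) u) = C * (c + 1 - c).
  by apply: Rintegral_indic_oc; [exact: ltW|rewrite lerDl].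
have : C * (c + 1 - c) <= 1.
  rewrite -IC; apply: (@le_trans _ _ (\int[mu]_(s in `]0, +oo[) (expR (- (th * s)) * S N x s))).
    apply: le_Rintegral => // s; rewrite /= in_itv/= andbT => s0; rewrite indicE.
    have [|_] := boolP (s \in _); last by rewrite mulr0 mulr_ge0 ?expR_ge0 ?S_ge0.
    rewrite inE/= in_itv/= => /andP[cs sc]; rewrite mulr1 /C.
    apply: ler_pM; rewrite ?expR_ge0 ?S_ge0//.
      by rewrite ler_expR lerN2 ler_pM2l.
    by apply: S_mono => //; rewrite !ltW.
  rewrite IS tha geom ?gt_eqF ?ltrDl//.
  have -> : x + 1 - x = 1 by ring.
  by rewrite divr1 lerBlDr lerDl exprn_ge0// divr_ge0// ltW.
have -> : c + 1 - c = 1 by ring.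
rewrite mulr1 /C expRN mulrC ler_pdivrMr ?expR_gt0// mul1r.
by rewrite mulrC.
Qed.

Let mlE z : mittag_leffler a a z = limn (series (fun n => cf n * z ^+ n)).
Proof.
rewrite /mittag_leffler; congr (limn (series _)).
by apply/funext => n; rewrite mulrC.
Qed.

Let S1E N x : S N x 1 = series (fun n => cf n * x ^+ n) N.
Proof.
rewrite /S /series/= big_mkord; apply: eq_bigr => n _.
by rewrite powR1 mulr1.
Qed.

(** The Laplace transform, rather than an asymptotic estimate of [Gamma], gives the convergence:
    [S_le] at c = 1 bounds the partial sums. *)
Let cf_cvg (X : R) : 0 <= X -> cvgn (series (fun n => cf n * X ^+ n)).
Proof.
move=> X0; apply: nondecreasing_is_cvgn.
  by apply: nondecreasing_series => n _ _; rewrite mulr_ge0// exprn_ge0.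
exists (expR ((1 + 1) * (X + 1) `^ b)) => _ [N _ <-].
by rewrite -S1E; exact: S_le.
Qed.

Lemma mittag_leffler_continuous : continuous (mittag_leffler a a).
Proof.
rewrite (_ : mittag_leffler a a = (fun z : R => limn (series (fun n => cf n * z ^+ n)))).
  exact: pseries_continuous.
by apply/funext => z; exact: mlE.
Qed.

Let S_cvg (x c : R) : 0 < c ->
  S N x c @[N --> \oo] --> c `^ (a - 1) * mittag_leffler a a (x * c `^ a).
Proof.
move=> c0; rewrite mlE.
have cv : series (fun n => cf n * (x * c `^ a) ^+ n) @ \oo -->
    limn (series (fun n => cf n * (x * c `^ a) ^+ n)).
  apply: normed_cvg; apply: series_le_cvg (cf_cvg (normr_ge0 (x * c `^ a))) => n.
  - exact: normr_ge0.
  - by apply: mulr_ge0 => //; apply: exprn_ge0.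
  - by rewrite /= normrM normrX (ger0_norm (cf0 _)).
rewrite (_ : (fun N => S N x c) = (fun N => c `^ (a - 1) *
    series (fun n => cf n * (x * c `^ a) ^+ n) N)).
  by apply: cvgM => //; exact: cvg_cst.
apply/funext => N; rewrite /S /series/= big_mkord mulr_sumr.
apply: eq_bigr => n _.
have -> : (x * c `^ a) ^+ n = x ^+ n * c `^ (a * n%:R).
  by rewrite exprMn powRrM powR_mulrn ?powR_ge0.
rewrite (_ : a * n%:R + a - 1 = (a - 1) + a * n%:R); last by ring.
rewrite powRD; last by apply/implyP => _; rewrite gt_eqF.
ring.
Qed.

Let S_norm N (x c : R) : 0 < c -> `|S N x c| <= expR ((c + 1) * (`|x| + 1) `^ b).
Proof.
move=> c0; apply: le_trans (S_le N (normr_ge0 x) c0).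
apply: le_trans (ler_norm_sum _ _ _) _; apply: ler_sum => n _.
by rewrite !normrM normrX (ger0_norm (cf0 _)) (ger0_norm (powR_ge0 _ _)).
Qed.

Lemma mittag_leffler_le (x c : R) : 0 < c ->
  `|c `^ (a - 1) * mittag_leffler a a (x * c `^ a)| <=
    expR ((c + 1) * (`|x| + 1) `^ b).
Proof.
move=> c0; have cv : `|S N x c| @[N --> \oo] --> `|c `^ (a - 1) * mittag_leffler a a (x * c `^ a)|.
  by apply: cvg_norm; exact: S_cvg.
rewrite -(cvg_lim (@Rhausdorff _) cv).
apply: limr_le; first exact: cvgP cv.
by near=> N; exact: S_norm.
Unshelve. all: by end_near. Qed.

(** Under the condition on th, the majorant exp ((c + 1) (|x| + 1)^b) of the partial sums is at most
    exp ((c + 1) th / 2), and exp (- th c / 2) is left for dominated convergence. The admissible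
    range of th depends on x, which is the difficulty of the inversion below. *)
Lemma mittag_leffler_laplace (x th : R) : 0 < th -> (`|x| + 1) `^ b <= th / 2 ->
  \int[mu]_(c in `]0, +oo[) (expR (- (th * c)) *
    (c `^ (a - 1) * mittag_leffler a a (x * c `^ a))) = 1 / (th `^ a - x).
Proof.
move=> th0 xth.
have x1 : 0 < `|x| + 1 by rewrite ltr_wpDl.
have xa : `|x| + 1 <= (th / 2) `^ a.
  by rewrite -[leLHS]powRb// ge0_ler_powR ?nnegrE ?powR_ge0 ?divr_ge0// ltW.
have xa2 : `|x| + 1 <= th `^ a.
  rewrite (le_trans xa)// ge0_ler_powR ?nnegrE ?(ltW th0) ?(ltW a0) ?divr_ge0 ?(ltW th0)//.
  by have := th0; lra.
have tha0 : 0 < th `^ a by rewrite powR_gt0.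
have th20 : 0 < th / 2 by rewrite divr_gt0.
have [K K0 hK] := expR_decay th20.
have mml : measurable_fun setT (fun c : R => expR (- (th * c)) *
    (c `^ (a - 1) * mittag_leffler a a (x * c `^ a))).
  apply: measurable_funM; first by mfun.
  apply: measurable_funM; first by mfun.
  apply: (measurableT_comp (continuous_measurable_fun mittag_leffler_continuous)).
  by mfun.
have mS N : measurable_fun setT (fun c => expR (- (th * c)) * S N x c).
  by apply: measurable_funM; [mfun|exact: measurable_S].
have [|||_ cI] := @Rdominated_cvg _ _ _ mu `]0, +oo[%classic (measurable_itv _)
  (fun N c => expR (- (th * c)) * S N x c)
  (fun c => expR (- (th * c)) * (c `^ (a - 1) * mittag_leffler a a (x * c `^ a)))
  (fun c => (expR (th / 2) * K) / oneDsqr c)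
  mS mml.
- move=> c; rewrite /= in_itv/= andbT => c0.
  by apply: cvgM; [exact: cvg_cst|exact: S_cvg].
- move=> N c; rewrite /= in_itv/= andbT => c0; rewrite normrM (ger0_norm (expR_ge0 _)).
  apply: le_trans (ler_wpM2l (expR_ge0 _) (S_norm N x c0)) _.
  rewrite -mulrA -expRD.
  apply: (@le_trans _ _ (expR (th / 2) * expR (- (th / 2 * c)))).
    rewrite -expRD ler_expR.
    have : (c + 1) * (`|x| + 1) `^ b <= (c + 1) * (th / 2).
      by rewrite ler_wpM2l// addr_ge0// ltW.
    by set V := (c + 1) * _; lra.
  by rewrite ler_wpM2l ?expR_ge0// hK// ltW.
- exact: integrable_oneDsqrV.
rewrite -(cvg_lim (@Rhausdorff _) cI); apply: cvg_lim; first exact: Rhausdorff.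
have xlt : x < th `^ a.
  by rewrite (le_lt_trans (ler_norm _))// (lt_le_trans _ xa2)// ltrDl.
rewrite (_ : (fun N => _) = (fun N => (1 - (x / th `^ a) ^+ N) / (th `^ a - x))).
  apply: cvgM; last exact: cvg_cst.
  rewrite -[X in _ --> X]subr0; apply: cvgB; first exact: cvg_cst.
  apply: cvg_expr; rewrite normrM normfV (gtr0_norm tha0) ltr_pdivrMr// mul1r.
  by rewrite (lt_le_trans _ xa2)// ltrDl.
apply/funext => N; have [_ ->] := S_decay N x th0.
by rewrite geom// gt_eqF.
Qed.

End mittag_leffler_bounds.

Section right_limit.
Context {R : realType}.
Notation mu := (@lebesgue_measure R).

(** If h p < 0, then h <= h p / 2 on some ]p, s], where the integral would be negative. Only the
    right limit enters, as suits functions of the level. *)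
Lemma Rintegral_ge0_right_limit (h : R -> R) (p r : R) : p < r ->
  mu.-integrable `]p, r] (EFin \o h) ->
  (forall s, p < s <= r -> 0 <= \int[mu]_(x in `]p, s]) h x) ->
  h x @[x --> p^'+] --> h p -> 0 <= h p.
Proof.
move=> pr ih h0 /cvgrPdist_le hc; rewrite leNgt; apply/negP => hp.
have e0 : 0 < - h p / 2 by rewrite divr_gt0// oppr_gt0.
have /nbhs_ballP[d /= d0 hd] := hc _ e0.
have [s ps [sr sd]] : exists2 s, p < s & s <= r /\ s < p + d.
  exists (Num.min r (p + d / 2)).
    by rewrite lt_min pr ltrDl divr_gt0.
  split; first by rewrite ge_min lexx.
  by rewrite gt_min ltrD2l gtr_pMr// invf_lt1// ltr1n orbT.
have ihs : mu.-integrable `]p, s] (EFin \o h).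
  apply: integrableS ih => // x /=; rewrite !in_itv/= => /andP[-> xs].
  exact: le_trans sr.
have : \int[mu]_(x in `]p, s]) h x <= \int[mu]_(x in `]p, s]) (h p / 2).
  apply: le_Rintegral => //.
    apply: measurable_bounded_integrable => //.
      by rewrite /= lebesgue_measure_itv/= lte_fin ps -EFinB ltry.
    by exists `|h p / 2|; split=> [|M cM x _]; [exact: num_real|exact: ltW].
  move=> x; rewrite /= in_itv/= => /andP[px xs].
  have : `|h p - h x| <= - h p / 2.
    apply: (hd x _ px); rewrite /ball/= distrC gtr0_norm ?subr_gt0//.
    by rewrite ltrBlDl (le_lt_trans xs).
  by rewrite ler_norml => /andP[h1 _]; lra.
have psr : p < s <= r by rewrite ps.
move=> /(le_trans (h0 s psr)); rewrite Rintegral_cst//= lebesgue_measure_itv/= lte_fin ps/=.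
by rewrite leNgt pmulr_llt0 ?subr_gt0// pmulr_llt0// hp.
Qed.

Lemma Rintegral_zero_right_limit (h : R -> R) (p r : R) : p < r ->
  mu.-integrable `]p, r] (EFin \o h) ->
  (forall s, p < s <= r -> \int[mu]_(x in `]p, s]) h x = 0) ->
  h x @[x --> p^'+] --> h p -> h p = 0.
Proof.
move=> pr ih h0 hc; apply/eqP; rewrite eq_le; apply/andP; split; last first.
  by apply: (Rintegral_ge0_right_limit pr ih) => // s /h0 ->.
rewrite -oppr_ge0.
have iN : mu.-integrable `]p, r] (EFin \o (fun x => - h x)).
  rewrite (_ : _ \o _ = (fun x => - (EFin \o h) x)%E)//; exact: integrableN.
apply: (@Rintegral_ge0_right_limit (fun x => - h x) p r) => //; last exact: cvgN.
move=> s /[dup] psr /andP[ps sr].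
have ihs : mu.-integrable `]p, s] (EFin \o h).
  apply: integrableS ih => // x /=; rewrite !in_itv/= => /andP[-> xs].
  exact: le_trans sr.
under eq_Rintegral do rewrite -mulN1r.
by rewrite RintegralZl// h0// mulr0.
Qed.

End right_limit.

(** * Inversion of the transform in the level *)

Section laplace_inversion.
Context {R : realType}.
Notation mu := (@lebesgue_measure R).
Variables (a t B Y : R).
Hypothesis a1 : 1 < a.
Hypothesis t0 : 0 < t.
Hypothesis B0 : 0 <= B.
Hypothesis Y0 : 0 <= Y.
Let b := a^-1.
Variables w K : R -> R.
Hypothesis mw : measurable_fun setT w.
Hypothesis wB : forall u, 0 < u -> `|w u| <= B * expR (- (t * u) + Y * (u + 1) `^ b).
Hypothesis mK : measurable_fun setT K.
Hypothesis K1 : forall c, 0 < c -> `|K c| <= 1.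
Hypothesis LK : forall th, 1 <= th ->
  \int[mu]_(c in `]0, +oo[) (expR (- (th * c)) * K c) =
  \int[mu]_(u in `]0, +oo[) (w u / (u + th `^ a)).
Hypothesis Kr : K c @[c --> 1^'+] --> K 1.

Let b01 : 0 < b < 1.
Proof. by rewrite invr_gt0 (lt_trans _ a1)//= invf_lt1// (lt_trans _ a1). Qed.

Let p1a : 1 `^ a = 1.
Proof. by rewrite powR1. Qed.

Let E u c := c `^ (a - 1) * mittag_leffler a a (- u * c `^ a).

Let E_le u c : 0 < u -> 0 < c -> `|E u c| <= expR ((c + 1) * (u + 1) `^ b).
Proof.
move=> u0 c0; rewrite /E (le_trans (mittag_leffler_le a1 _ c0))//.
by rewrite normrN gtr0_norm.
Qed.

Let mE : measurable_fun setT (fun z : R * R => E z.1 z.2).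
Proof.
apply: measurable_funM; first by mfun.
apply: (measurableT_comp (continuous_measurable_fun (mittag_leffler_continuous a1))).
by mfun.
Qed.

Let mEs : measurable_fun setT (fun z : R * R => E z.2 z.1).
Proof.
apply: measurable_funM; first by mfun.
apply: (measurableT_comp (continuous_measurable_fun (mittag_leffler_continuous a1))).
by mfun.
Qed.

Let mE1 u : measurable_fun setT (E u).
Proof. exact: (measurableT_comp mE (measurable_pair1 u)). Qed.

Let mE2 c : measurable_fun setT (E ^~ c).
Proof. exact: (measurableT_comp mE (measurable_pair2 c)). Qed.

(** For c <= 4 the factor c + 1 of [E_le] is at most 5, so one majorant in u serves all these c. *)
Let wE_le u c : 0 < u -> 0 < c <= 4 ->
  `|w u * E u c| <= B * expR (- (t * u) + (Y + 5) * (u + 1) `^ b).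
Proof.
move=> u0 /andP[c0 c4]; rewrite normrM.
apply: le_trans (ler_pM _ _ (wB u0) (E_le u0 c0)) _ => //.
rewrite -mulrA -expRD ler_wpM2l// ler_expR -addrA lerD2l [leRHS]mulrDl lerD2l.
by rewrite ler_wpM2r ?powR_ge0//; move: c4; lra.
Qed.

Let k c := \int[mu]_(u in `]0, +oo[) (w u * E u c).

Let mk : measurable_fun setT k.
Proof.
apply: (@measurable_Rintegral _ _ _ _ _ mu _ (fun c u => w u * E u c)) => //.
apply: measurable_funM; first exact: measurableT_comp.
exact: mEs.
Qed.

Let dom Z : 0 <= Z -> exists2 K, 0 <= K &
  forall u, 0 < u -> B * expR (- (t * u) + Z * (u + 1) `^ b) <= K / oneDsqr u.
Proof.
move=> Z0; have [K2 K20 hK] := expR_powR_decay t0 Z0 b01.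
exists (B * K2); first exact: mulr_ge0.
by move=> u u0; rewrite -mulrA ler_wpM2l// hK// ltW.
Qed.

Let k_bounded : exists2 M, 0 <= M & forall c, 0 < c <= 4 -> `|k c| <= M.
Proof.
have Y5 : 0 <= Y + 5 by rewrite addr_ge0.
have [M M0 hM] := dom Y5.
exists (\int[mu]_(u in `]0, +oo[) (M / oneDsqr u)).
  by apply: Rintegral_ge0 => u _; rewrite divr_ge0// ltW// oneDsqr_gt0.
move=> c c4; apply: Rintegral_norm_le => //.
- by apply: measurable_funM; [exact: mw|exact: mE2].
- move=> u; rewrite /= in_itv/= andbT => u0.
  exact: le_trans (wE_le u0 c4) (hM _ u0).
- exact: integrable_oneDsqrV.
Qed.

Let E_continuous u c : 0 < c -> {for c, continuous (E u)}.
Proof.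
move=> c0; have cp (p : R) : {for c, continuous (fun c => c `^ p)}.
  exact: is_derive_continuous (is_derive1_powR p c0).
apply: cvgM; first exact: cp.
apply: (continuous_comp (f := fun c => - u * c `^ a)); last exact: mittag_leffler_continuous.
by apply: cvgM; [exact: cvg_cst|exact: cp].
Qed.

Let k_continuous : {for 1, continuous k}.
Proof.
have Y5 : 0 <= Y + 5 by rewrite addr_ge0.
have [M M0 hM] := dom Y5.
have wM c u : 0 < c <= 4 -> 0 < u -> `|w u * E u c| <= M / oneDsqr u.
  by move=> c4 u0; exact: le_trans (wE_le u0 c4) (hM _ u0).
apply: (@continuity_under_integral _ _ _ mu (fun c u => w u * E u c) `]0, +oo[%classic
  (measurable_itv _) 0 2 _ _ (fun u => M / oneDsqr u)).
- move=> c; rewrite /= in_itv/= => /andP[c0 c2].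
  apply: integrable_le (integrable_oneDsqrV M) => //.
    by apply: measurable_funM; [exact: mw|exact: mE2].
  move=> u; rewrite /= in_itv/= andbT => u0; apply: wM => //.
  by rewrite c0 ltW// (lt_trans c2)// ltr_nat.
- apply: aeW => u; rewrite /= in_itv/= andbT => u0 c; rewrite inE/= in_itv/= => /andP[c0 _].
  by apply: cvgM; [exact: cvg_cst|exact: E_continuous].
- exact: integrable_oneDsqrV.
- move=> c; rewrite /= in_itv/= => /andP[c0 c2].
  apply: aeW => u; rewrite /= in_itv/= andbT => u0; apply: wM => //.
  by rewrite c0 ltW// (lt_trans c2)// ltr_nat.
- by rewrite inE/= in_itv/= ltr01 ltr1n.
Qed.

Let I4 (c : R) : R := \1_(`]0, 4]%classic : set R) c.

Let I4E c : 0 < c -> I4 c = (c <= 4)%R%:R.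
Proof.
move=> c0; rewrite /I4 indicE; congr (nat_of_bool _)%:R.
by apply/idP/idP; rewrite inE/= in_itv/= c0.
Qed.

Let I41 : I4 1 = 1.
Proof. by rewrite I4E// ler1n. Qed.

Let mI4 : measurable_fun setT I4.
Proof. exact: measurable_indic. Qed.

Let J th u := \int[mu]_(c in `]0, +oo[) (expR (- (th * c)) * (I4 c * E u c)).

(** If (u + 1)^b <= th / 2, the transform of [E u] is exact and only the part c > 4 is missing,
    where exp (th / 2 - th c / 2) <= exp (2 - 3 th / 2 - c / 2) by (th - 1) (c - 4) >= 0. Otherwise
    exp (3 (u + 1)^b - 3 th / 2) >= 1 pays for crude bounds of both terms: 1 for the fraction and 4
    exp (5 (u + 1)^b) for [J], whence the constants 5 and 8 = 5 + 3. The cutoff 4 is large enough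
    for the rate (4 - 1) / 2 = 3 / 2 to exceed 1, the level of interest. *)
Let J_err : exists2 C, 0 <= C & forall th u, 1 <= th -> 0 < u ->
  `|1 / (u + th `^ a) - J th u| <= C * expR (- (3 / 2 * th)) * expR (8 * (u + 1) `^ b).
Proof.
have h2 : 0 < 2^-1 :> R by rewrite invr_gt0.
have [M M0 hM] := expR_decay h2.
pose C1 := expR 2 * \int[mu]_(c in `]0, +oo[) (M / oneDsqr c).
have C10 : 0 <= C1.
  rewrite mulr_ge0 ?expR_ge0//.
  by apply: Rintegral_ge0 => u _; rewrite divr_ge0// ltW// oneDsqr_gt0.
exists (C1 + 5); first by rewrite addr_ge0.
move=> th u th1 u0.
have th0 : 0 < th := lt_le_trans ltr01 th1.
have V0 : 0 <= (u + 1) `^ b := powR_ge0 _ _.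
have mJ : measurable_fun setT (fun c => expR (- (th * c)) * (I4 c * E u c)).
  by apply: measurable_funM; [mfun|apply: measurable_funM; [exact: mI4|exact: mE1]].
have [K2 K20 hK2] := expR_decay th0.
have iJ : mu.-integrable `]0, +oo[ (EFin \o (fun c => expR (- (th * c)) * (I4 c * E u c))).
  apply: integrable_le (integrable_oneDsqrV (expR (5 * (u + 1) `^ b) * K2)) => //.
  move=> c; rewrite /= in_itv/= andbT => c0.
  rewrite normrM (ger0_norm (expR_ge0 _)) mulrC -mulrA.
  apply: ler_pM; rewrite ?expR_ge0//; last by rewrite hK2// ltW.
  rewrite I4E//; case: (leP c 4) => c4; last by rewrite mul0r normr0 expR_ge0.
  rewrite mul1r (le_trans (E_le u0 c0))// ler_expR ler_wpM2r//.
  by move: c4; lra.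
have [Vth|Vth] := leP ((u + 1) `^ b) (th / 2).
- have Vth' : (`|- u| + 1) `^ a^-1 <= th / 2 by rewrite normrN gtr0_norm.
  have := mittag_leffler_laplace a1 th0 Vth'.
  rewrite opprK [th `^ a + u]addrC => <-; rewrite /J.
  pose f c := expR (- (th * c)) * E u c.
  have mf : measurable_fun setT f by apply: measurable_funM; [mfun|exact: mE1].
  have th20 : 0 < th / 2 by rewrite divr_gt0.
  have [K3 K30 hK3] := expR_decay th20.
  have fb c : 0 < c -> `|f c| <= expR (th / 2) * expR (- (th / 2 * c)).
    move=> c0; rewrite normrM (ger0_norm (expR_ge0 _)).
    apply: le_trans (ler_wpM2l (expR_ge0 _) (E_le u0 c0)) _.
    rewrite -!expRD ler_expR.
    have : (c + 1) * (u + 1) `^ b <= (c + 1) * (th / 2).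
      by rewrite ler_wpM2l// addr_ge0// ltW.
    by set V := (c + 1) * _ `^ _; lra.
  have if_ : mu.-integrable `]0, +oo[ (EFin \o f).
    apply: integrable_le (integrable_oneDsqrV (expR (th / 2) * K3)) => //.
    move=> c; rewrite /= in_itv/= andbT => c0; apply: le_trans (fb _ c0) _.
    by rewrite -[leRHS]mulrA ler_wpM2l ?expR_ge0// hK3// ltW.
  rewrite -RintegralB//.
  apply: (@le_trans _ _ (C1 * expR (- (3 / 2 * th)))); last first.
    rewrite -[leLHS]mulr1; apply: ler_pM => //.
    - by rewrite mulr_ge0 ?expR_ge0.
    - by rewrite ler_wpM2r ?expR_ge0// lerDl.
    - by rewrite -[leLHS]expR0 ler_expR mulr_ge0.
  rewrite (_ : C1 * _ = \int[mu]_(c in `]0, +oo[) ((expR 2 * expR (- (3 / 2 * th)) * M) / oneDsqr c)); last first.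
    rewrite /C1 mulrAC -RintegralZl//; last exact: integrable_oneDsqrV.
    by apply: eq_Rintegral => c _; ring.
  apply: Rintegral_norm_le => //; first exact: measurable_funB; last exact: integrable_oneDsqrV.
  move=> c; rewrite /= in_itv/= andbT => c0.
  have -> : expR (- (th * c)) * (c `^ (a - 1) * mittag_leffler a a (- u * c `^ a)) -
     expR (- (th * c)) * (I4 c * E u c) = (1 - I4 c) * f c.
    by rewrite /f /E; ring.
  rewrite I4E//; case: (leP c 4) => c4.
    by rewrite subrr mul0r normr0 divr_ge0 ?(ltW (oneDsqr_gt0 _))// !mulr_ge0// expR_ge0.
  rewrite subr0 mul1r (le_trans (fb _ c0))//.
  apply: (@le_trans _ _ (expR 2 * expR (- (3 / 2 * th)) * expR (- (2^-1 * c)))).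
    rewrite -!expRD ler_expR.
    have : 0 <= (th - 1) * (c - 4) by rewrite mulr_ge0// subr_ge0// ltW.
    have -> : (th - 1) * (c - 4) = th * c - 4 * th - c + 4 by ring.
    by lra.
  by rewrite -[leRHS]mulrA ler_wpM2l ?mulr_ge0 ?expR_ge0// hM// ltW.
- apply: le_trans (ler_normB _ _) _.
  have tha : 0 < th `^ a by rewrite powR_gt0.
  have e1 : 1 <= expR (- (3 / 2 * th)) * expR (3 * (u + 1) `^ b).
    by rewrite -expRD -[leLHS]expR0 ler_expR; move: Vth; set V := _ `^ b; lra.
  have e5 : 1 <= expR (5 * (u + 1) `^ b).
    by rewrite -[leLHS]expR0 ler_expR mulr_ge0.
  have H : 5 * expR (5 * (u + 1) `^ b) <=
      (C1 + 5) * expR (- (3 / 2 * th)) * expR (8 * (u + 1) `^ b).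
    have -> : expR (8 * (u + 1) `^ b) = expR (5 * (u + 1) `^ b) * expR (3 * (u + 1) `^ b).
      by rewrite -expRD; congr expR; ring.
    have -> : (C1 + 5) * expR (- (3 / 2 * th)) * (expR (5 * (u + 1) `^ b) * expR (3 * (u + 1) `^ b)) =
      ((C1 + 5) * expR (5 * (u + 1) `^ b)) * (expR (- (3 / 2 * th)) * expR (3 * (u + 1) `^ b)) by ring.
    rewrite -[leLHS]mulr1; apply: ler_pM => //.
    by rewrite ler_wpM2r ?expR_ge0// lerDr.
  apply: le_trans H.
  have -> : 5 * expR (5 * (u + 1) `^ b) = expR (5 * (u + 1) `^ b) + 4 * expR (5 * (u + 1) `^ b) by ring.
  apply: lerD.
    apply: le_trans e5; rewrite div1r normfV gtr0_norm ?addr_gt0// invf_le1 ?addr_gt0//.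
    apply: (@le_trans _ _ (th `^ a)); last by rewrite lerDr ltW.
    by rewrite -[leLHS]p1a ge0_ler_powR ?nnegrE ?(le_trans ler01 th1)// ltW// (lt_trans _ a1).
  have [iI II] := Rintegral_indic_oc (expR (5 * (u + 1) `^ b)) (lexx 0) (ler0n R 4).
  rewrite [leRHS](_ : _ = expR (5 * (u + 1) `^ b) * (4 - 0)); last by rewrite subr0 mulrC.
  rewrite -II; apply: Rintegral_norm_le => // c; rewrite /= in_itv/= andbT => c0.
  rewrite -/(I4 c) I4E//; case: (leP c 4) => c4; last by rewrite mul0r !mulr0 normr0.
  rewrite mul1r mulr1 normrM (ger0_norm (expR_ge0 _)) -[leRHS]mul1r.
  apply: ler_pM; rewrite ?expR_ge0//.
    by rewrite -expR0 ler_expR oppr_le0 mulr_ge0// ltW.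
  rewrite (le_trans (E_le u0 c0))// ler_expR ler_wpM2r//.
  by move: c4; lra.
Qed.

(** The factor exp (- c) makes the difference integrable and shifts the integers i >= 0 to th = i +
    1 >= 1, the range where the transform of [K] is given. *)
Let h c := expR (- (1 * c)) * (K c - I4 c * k c).

Let h_decay : quadratic_decay h.
Proof.
have [M M0 hM] := k_bounded.
have [K2 K20 hK2] := expR_decay (@ltr01 R).
apply: (quadratic_decayM (C := 1 + M)).
- split; first by mfun.
  by exists K2 => u u0; rewrite ger0_norm ?expR_ge0// hK2// ltW.
- by apply: measurable_funB; [exact: mK|apply: measurable_funM; [exact: mI4|exact: mk]].
- move=> c c0; rewrite (le_trans (ler_normB _ _))// lerD ?K1//.
  rewrite I4E//; case: (leP c 4) => c4; last by rewrite mul0r normr0.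
  by rewrite mul1r hM// c0.
Qed.

Let k_laplace th : 1 <= th ->
  \int[mu]_(c in `]0, +oo[) (expR (- (th * c)) * (I4 c * k c)) =
  \int[mu]_(u in `]0, +oo[) (w u * J th u).
Proof.
move=> th1; have th0 : 0 < th := lt_le_trans ltr01 th1.
have [K2 K20 hK2] := expR_decay th0.
have Y5 : 0 <= Y + 5 by rewrite addr_ge0.
have [M M0 hM] := dom Y5.
pose G c u := expR (- (th * c)) * I4 c * (w u * E u c).
have mG : measurable_fun setT (fun z : R * R => G z.1 z.2).
  apply: measurable_funM.
    by apply: measurable_funM; [mfun|exact: measurableT_comp].
  by apply: measurable_funM; [exact: measurableT_comp|].
transitivity (\int[mu]_(c in `]0, +oo[) \int[mu]_(u in `]0, +oo[) G c u).
  apply: eq_Rintegral => c; rewrite inE/= in_itv/= andbT => c0; rewrite /G.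
  rewrite I4E//; case: (leP c 4) => c4; last first.
    rewrite mul0r !mulr0; under eq_Rintegral do rewrite mul0r.
    by rewrite Rintegral_cst// mul0r.
  rewrite mul1r mulr1 -RintegralZl//.
  apply: integrable_le (integrable_oneDsqrV M) => //.
    by apply: measurable_funM; [exact: mw|exact: mE2].
  move=> u; rewrite /= in_itv/= andbT => u0.
  by apply: le_trans (hM _ u0); apply: wE_le; rewrite ?c0.
rewrite (@Rfubini _ _ _ _ _ mu mu _ _ (measurable_itv _) (measurable_itv _) G
  (fun c => K2 / oneDsqr c) (fun u => M / oneDsqr u)) => //.
- apply: eq_Rintegral => u; rewrite inE/= in_itv/= andbT => u0; rewrite /J -RintegralZl//.
    by apply: eq_Rintegral => c _; rewrite /G; ring.
  apply: integrable_le (integrable_oneDsqrV (expR (5 * (u + 1) `^ b) * K2)) => //.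
    by apply: measurable_funM; [mfun|apply: measurable_funM; [exact: mI4|exact: mE1]].
  move=> c; rewrite /= in_itv/= andbT => c0.
  rewrite normrM (ger0_norm (expR_ge0 _)) mulrC -mulrA.
  apply: ler_pM; rewrite ?expR_ge0//; last by rewrite hK2// ltW.
  rewrite I4E//; case: (leP c 4) => c4; last by rewrite mul0r normr0 expR_ge0.
  rewrite mul1r (le_trans (E_le u0 c0))// ler_expR ler_wpM2r ?powR_ge0//.
  by move: c4; lra.
- exact: integrable_oneDsqrV.
- exact: integrable_oneDsqrV.
- move=> c u; rewrite /= !in_itv/= !andbT => c0 u0; rewrite /G normrM.
  have M1 : 0 <= M / oneDsqr u by rewrite divr_ge0// ltW// oneDsqr_gt0.
  have M2 : 0 <= K2 / oneDsqr c by rewrite divr_ge0// ltW// oneDsqr_gt0.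
  rewrite I4E//; case: (leP c 4) => c4; last by rewrite mulr0 normr0 mul0r mulr_ge0.
  rewrite mulr1 (ger0_norm (expR_ge0 _)); apply: ler_pM; rewrite ?expR_ge0//.
    by rewrite hK2// ltW.
  by apply: le_trans (hM _ u0); apply: wE_le; rewrite ?c0.
Qed.

Let h_laplace : exists C, forall i : nat,
  `|\int[mu]_(x in `]0, +oo[) (expR (- (i%:R * x)) * h x)| <= C * expR (- (3 / 2 * i%:R)).
Proof.
have [C C0 hC] := J_err.
have Y8 : 0 <= Y + 8 by rewrite addr_ge0.
have [M M0 hM] := dom Y8.
have [Mk Mk0 hMk] := k_bounded.
exists (C * expR (- (3 / 2)) * \int[mu]_(u in `]0, +oo[) (M / oneDsqr u)) => i.
set th : R := i%:R + 1.
have th1 : 1 <= th by rewrite lerDr.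
have th0 : 0 < th := lt_le_trans ltr01 th1.
have [K2 K20 hK2] := expR_decay th0.
have bd (f : R -> R) A : measurable_fun setT f -> (forall c, 0 < c -> `|f c| <= A) ->
    mu.-integrable `]0, +oo[ (EFin \o (fun c => expR (- (th * c)) * f c)).
  move=> mf fA; apply: quadratic_decay_integrable.
  apply: (quadratic_decayM (C := A)) => //; split; first by mfun.
  by exists K2 => u u0; rewrite ger0_norm ?expR_ge0// hK2// ltW.
pose w' th u := 1 / (u + th `^ a) - J th u.
have mw' : measurable_fun setT (w' th).
  apply: measurable_funB; first by mfun.
  apply: (@measurable_Rintegral _ _ _ _ _ mu _
    (fun u c => expR (- (th * c)) * (I4 c * E u c))) => //.
  apply: measurable_funM; first by mfun.
  apply: measurable_funM; last exact: mE.
  exact: (measurableT_comp mI4 measurable_snd).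
have wJ u : 0 < u -> `|w u * w' th u| <= C * expR (- (3 / 2 * th)) * M / oneDsqr u.
  move=> u0; rewrite normrM.
  apply: le_trans (ler_pM _ _ (wB u0) (hC _ _ th1 u0)) _ => //.
  rewrite (_ : B * _ * _ = C * expR (- (3 / 2 * th)) *
      (B * expR (- (t * u) + (Y + 8) * (u + 1) `^ b))).
    by rewrite -[leRHS]mulrA ler_wpM2l ?mulr_ge0 ?expR_ge0// hM.
  have -> : - (t * u) + (Y + 8) * (u + 1) `^ b = (- (t * u) + Y * (u + 1) `^ b) + 8 * (u + 1) `^ b.
    by rewrite mulrDl addrA.
  by rewrite [in RHS]expRD; ring.
have -> : \int[mu]_(x in `]0, +oo[) (expR (- (i%:R * x)) * h x) =
  \int[mu]_(u in `]0, +oo[) (w u * (1 / (u + th `^ a) - J th u)).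
  transitivity (\int[mu]_(c in `]0, +oo[) (expR (- (th * c)) * K c - expR (- (th * c)) * (I4 c * k c))).
    apply: eq_Rintegral => c _; rewrite /h mulrA -expRD -mulrBr; congr (expR _ * _).
    by rewrite /th; ring.
  have iK := bd K 1 mK K1.
  have ik : mu.-integrable `]0, +oo[ (EFin \o (fun c => expR (- (th * c)) * (I4 c * k c))).
    apply: (bd _ Mk); first by apply: measurable_funM; [exact: mI4|exact: mk].
    move=> c c0; rewrite I4E//; case: (leP c 4) => c4; last by rewrite mul0r normr0.
    by rewrite mul1r hMk// c0.
  have iw : mu.-integrable `]0, +oo[ (EFin \o (fun u => w u / (u + th `^ a))).
    have [M' M'0 hM'] := dom Y0.
    apply: integrable_le (integrable_oneDsqrV M') => //.
      by apply: measurable_funM => //; mfun.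
    move=> u; rewrite /= in_itv/= andbT => u0; apply: le_trans (hM' _ u0).
    rewrite normrM -[leRHS]mulr1; apply: ler_pM => //; first exact: wB.
    have tha : 1 <= th `^ a.
      by rewrite -[leLHS]p1a ge0_ler_powR ?nnegrE ?(ltW th0)// ltW// (lt_trans _ a1).
    have tha0 : 0 < th `^ a := lt_le_trans ltr01 tha.
    rewrite normfV gtr0_norm ?addr_gt0// invf_le1 ?addr_gt0//.
    by rewrite (le_trans tha)// lerDr ltW.
  have iJw : mu.-integrable `]0, +oo[ (EFin \o (fun u => w u * (w' th u))).
    apply: integrable_le (integrable_oneDsqrV (C * expR (- (3 / 2 * th)) * M)) => //.
      by apply: measurable_funM; [exact: mw|exact: mw'].
    by move=> u; rewrite /= in_itv/= andbT => u0; exact: wJ.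
  rewrite RintegralB// LK// k_laplace// -RintegralB//.
    by apply: eq_Rintegral => u _; rewrite mulrBr mul1r.
  rewrite (_ : EFin \o _ = (EFin \o (fun u => (w u / (u + th `^ a))%R)) \-
     (EFin \o (fun u => (w u * w' th u)%R)))%E; first exact: integrableB.
  by apply/funext => u /=; rewrite /w' -EFinB; congr EFin; ring.
rewrite [leRHS](_ : _ = \int[mu]_(u in `]0, +oo[) ((C * expR (- (3 / 2 * th)) * M) / oneDsqr u)).
  apply: Rintegral_norm_le => //; last exact: integrable_oneDsqrV.
    by apply: measurable_funM; [exact: mw|exact: mw'].
  by move=> u; rewrite /= in_itv/= andbT => u0; exact: wJ.
have -> : expR (- (3 / 2 * th)) = expR (- (3 / 2)) * expR (- (3 / 2 * i%:R)).
  by rewrite -expRD; congr expR; rewrite /th; ring.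
rewrite mulrAC -RintegralZl//; last exact: integrable_oneDsqrV.
by apply: eq_Rintegral => u _; ring.
Qed.

(* The function k has the Laplace transform of K up to errors that come from
   c > 4 and from (u + 1)^b > th / 2. Hence exp (- c) (K - k) has a transform
   O(exp (- 3 th / 2)) and vanishes on ]0, 3/2]. *)
Lemma laplace_inversion :
  K 1 = \int[mu]_(u in `]0, +oo[) (w u * mittag_leffler a a (- u)).
Proof.
have [C hC] := h_laplace.
have ls := laplace_support h_decay hC.
have ih := quadratic_decay_integrable h_decay.
have ih1 : mu.-integrable `]0, (3 / 2)%R] (EFin \o h).
  by apply: integrableS ih => // x /=; rewrite !in_itv/= andbT => /andP[].
have h32 : 1 < 3 / 2 :> R by lra.
have h1 : h 1 = 0.
  (* Level 1 lies strictly inside ]0, 3/2], so the integrals over ]1, s] vanish for s up to 3/2;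
     with the right-continuity of [K] at 1 they determine [h 1]. *)
  apply: (@Rintegral_zero_right_limit R h 1 (3 / 2)) => //.
  - apply: integrableS ih1 => // x /=; rewrite !in_itv/= => /andP[x1 ->].
    by rewrite andbT (lt_trans _ x1).
  - move=> s /andP[s1 s32].
    have ihs : mu.-integrable `]0, s] (EFin \o h).
      apply: integrableS ih1 => // x /=; rewrite !in_itv/= => /andP[-> xs].
      by rewrite (le_trans xs).
    have i1 : (BRight (0 : R) <= BRight 1)%O by rewrite bnd_simp.
    have i2 : (BRight (1 : R) <= BRight s)%O by rewrite bnd_simp ltW.
    rewrite -(Rintegral_itvB ihs i1 i2) !ls ?subrr// ?ler01 ?(ltW h32)// s32 andbT.
    by rewrite ltW// (lt_trans _ s1).
  - have H : (fun c => expR (- (1 * c)) * (K c - k c)) x @[x --> 1^'+] -->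
        expR (- (1 * 1)) * (K 1 - k 1).
      apply: cvgM.
        apply: cvg_at_right_filter.
        apply: (continuous_comp (f := fun x : R => - (1 * x))); last exact: continuous_expR.
        by apply: cvgN; apply: cvgM; [exact: cvg_cst|exact: cvg_id].
      by apply: cvgB => //; apply: cvg_at_right_filter; exact: k_continuous.
    have h1E : expR (- (1 * 1)) * (K 1 - k 1) = h 1.
      by rewrite /h I41 [1 * k 1]mul1r.
    rewrite h1E in H.
    apply: (cvg_trans _ H); apply: near_eq_cvg; near=> c.
    have c0 : 0 < c by rewrite (@lt_trans _ _ 1).
    have c4 : c <= 4.
      near: c; apply: nbhs_right_le; by rewrite ltr1n.
    have I4c : I4 c = 1 by rewrite I4E// c4.
    by rewrite /h I4c [1 * k c]mul1r.
move: h1; rewrite /h I41 [1 * k 1]mul1r => /eqP.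
rewrite mulf_eq0 gt_eqF ?expR_gt0//= subr_eq0 => /eqP ->.
by apply: eq_Rintegral => u _; rewrite /E powR1 mul1r mulr1.
Unshelve. all: by end_near. Qed.

End laplace_inversion.

(** * Killed random walks *)

(* The measure structure on [pushforward m f] depends on a proof that [f] is
   measurable, which canonical inference does not find. *)
Notation pushforward_measure m mf :=
  (measure_function_pushforward__canonical__measure_function_Measure m mf).

Section independence.
Context d (T : measurableType d) (R : realType) (P : probability T R).

Lemma ge0_integral_mfrestr (E : set T) (mE : measurable E) (Eoo : (P E < +oo)%E)
    (f : T -> \bar R) : measurable_fun setT f -> (forall w, (0 <= f w)%E) ->
  (\int[mfrestr mE Eoo]_w f w = \int[P]_(w in E) f w)%E.
Proof.
move=> mf f0; rewrite -(setUv E) ge0_integral_setU//=; last 2 first.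
- by rewrite setUv.
- by apply/disj_setPS => w /= [].
rewrite [X in (_ + X)%E](_ : _ = 0%E); last first.
  apply: null_set_integral; [exact: measurableC| |].
    exact: measurable_funTS.
  by rewrite /= /mfrestr /mrestr setICl measure0.
rewrite adde0; apply: eq_measure_integral => A mA AE.
  by rewrite /= /mfrestr /mrestr setIidl.
exact: measurableC.
Qed.

(** Restricting P to [E] replaces conditioning, which allows P E = 0. The law of (Y, xi) under the
    restriction and the product of the restricted law of Y with the law of xi agree on rectangles, a
    pi-system that generates the Borel sets of the plane. *)
Lemma ge0_integral_independent (E : set T) (Y xi : T -> R) (h : R * R -> \bar R) :
  measurable E -> measurable_fun setT Y -> measurable_fun setT xi ->
  measurable_fun setT h -> (forall z, (0 <= h z)%E) ->
  (forall A C : set R, measurable A -> measurable C ->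
    P (E `&` Y @^-1` A `&` xi @^-1` C) = (P (E `&` Y @^-1` A) * P (xi @^-1` C))%E) ->
  (\int[P]_(w in E) h (Y w, xi w) = \int[P]_(w in E) \int[P]_v h (Y w, xi v))%E.
Proof.
move=> mE mY mxi mh h0 ind.
have Eoo : (P E < +oo)%E by rewrite (le_lt_trans (probability_le1 _ mE))// ltry.
pose m := mfrestr mE Eoo.
have mf1 : measurable_fun setT (fun w => (Y w, xi w)) by exact: measurable_fun_pair.
have mf2 : measurable_fun setT (fun z : T * T => (Y z.1, xi z.2)).
  by apply: measurable_fun_pair; apply: measurableT_comp.
pose M1 := pushforward_measure m mf1.
pose M2 := pushforward_measure (m \x P)%E mf2.
pose C : set (set (R * R)) :=
  [set C | exists A, measurable A /\ exists B, measurable B /\ C = A `*` B].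
have M12 D : measurable D -> M1 D = M2 D.
  apply: (measure_unique C (fun=> setT)) => //.
  - rewrite measurable_prod_measurableType //; congr (<<s _ >>).
    rewrite predeqE; split => [[A mA [B mB <-]]|[A [mA [B [mB ->]]]]].
      by exists A; split => //; exists B.
    by exists A => //; exists B.
  - move=> /= _ _ [X1 [mX1 [X2 [mX2 ->]]]] [Y1 [mY1 [Y2 [mY2 ->]]]].
    rewrite -setXI; exists (X1 `&` Y1); split; first exact: measurableI.
    by exists (X2 `&` Y2); split => //; exact: measurableI.
  - by move=> _; exists setT; split => //; exists setT; split => //; rewrite setXTT.
  - by rewrite bigcup_const.
  - move=> _ [A [mA [B [mB ->]]]]; rewrite /M1 /M2 /pushforward/=.
    have mYA : measurable (Y @^-1` A) by rewrite -[X in measurable X]setTI; exact: mY.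
    have mxB : measurable (xi @^-1` B) by rewrite -[X in measurable X]setTI; exact: mxi.
    transitivity ((m \x P)%E ((Y @^-1` A) `*` (xi @^-1` B))); last by [].
    rewrite product_measure1E// /m/= /mfrestr /mrestr [Y @^-1` A `&` E]setIC -ind//.
    by congr (P _); apply/seteqP; split => w /=; tauto.
  - move=> _; rewrite (_ : M1 setT = P E)//.
    by transitivity (P (setT `&` E)); [|rewrite setTI].
have e1 : (\int[M1]_z h z = \int[P]_(w in E) h (Y w, xi w))%E.
  rewrite (ge0_integral_pushforward mf1)//.
  rewrite preimage_setT; apply: (@ge0_integral_mfrestr _ mE Eoo (h \o (fun w => (Y w, xi w)))).
    exact: (measurableT_comp mh mf1).
  by move=> w; exact: h0.
have e2 : (\int[M2]_z h z = \int[P]_(w in E) \int[P]_v h (Y w, xi v))%E.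
  rewrite (ge0_integral_pushforward mf2)// preimage_setT.
  have mhf : measurable_fun setT (h \o (fun z : T * T => (Y z.1, xi z.2))).
    exact: measurableT_comp.
  rewrite fubini_tonelli1//=; apply: ge0_integral_mfrestr.
    apply: (@measurable_fun_fubini_tonelli_F _ _ _ _ _ P
      (h \o (fun z : T * T => (Y z.1, xi z.2)))) => //.
    by move=> z; exact: h0.
  by move=> w; apply: integral_ge0 => v _; exact: h0.
by rewrite -e1 -e2; apply: eq_measure_integral => A mA _; exact: M12.
Qed.

End independence.

Section lebesgue_reflection.
Context {R : realType}.
Notation mu := (@lebesgue_measure R).

Lemma ge0_integral_reflection (c : R) (f : R -> \bar R) :
  measurable_fun setT f -> (forall x, (0 <= f x)%E) ->
  (\int[mu]_x f (c - x)%R = \int[mu]_x f x)%E.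
Proof.
move=> mf f0.
pose phi (x : measurableTypeR R) : measurableTypeR R := c - (x : R).
have mc : measurable_fun setT phi by rewrite /phi; mfun.
transitivity (\int[mu]_(x in phi @^-1` setT) (f \o phi) x)%E.
  by rewrite preimage_setT.
rewrite -(ge0_integral_pushforward mc)//.
apply: eq_measure_integral => A mA _; apply/esym.
apply: (@lebesgue_measure_unique _
  (pushforward_measure mu mc)) => //= _ [[a b]] _ <-.
rewrite /pushforward [X in _ = _ X](_ : _ = `[(c - b), (c - a)[%classic).
  rewrite !lebesgue_measure_itv/= !lte_fin ltrD2l ltrN2; case: ifP => // _.
  by rewrite -!EFinB; congr EFin; ring.
by apply/seteqP; split => x; rewrite /= !in_itv/= /phi => /andP[h1 h2];
  apply/andP; split; move: h1 h2; lra.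
Qed.

Lemma ge0_integral_translation (c : R) (f : R -> \bar R) :
  measurable_fun setT f -> (forall x, (0 <= f x)%E) ->
  (\int[mu]_x f (x + c)%R = \int[mu]_x f x)%E.
Proof.
move=> mf f0; rewrite -(ge0_integral_reflection c mf f0).
have mg : measurable_fun setT (fun x : R => f (c - x)).
  by apply: (measurableT_comp mf); mfun.
rewrite -(ge0_integral_reflection 0 mg)//.
by apply: eq_integral => x _; rewrite sub0r opprK addrC.
Qed.

End lebesgue_reflection.

(** * Killed transition operators and their duality *)

Section killed_step.
Context d (T : measurableType d) (R : realType) (P : probability T R).
Notation mu := (@lebesgue_measure R).
Variable xi : T -> R.
Hypothesis mxi : measurable_fun setT xi.

(* One step y -> y + e xi of a random walk killed when it leaves [0, +oo[. *)
Definition killed_step (e : R) (f : R -> R) (y : R) : R :=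
  (0 <= y)%R%:R * \int[P]_w f (y + e * xi w).

Definition bounded_nonneg (C : R) (f : R -> R) :=
  measurable_fun setT f /\ forall y, 0 <= f y <= C.

Implicit Types (e C D : R) (f g : R -> R).

Lemma probability_bounded_integrable C (h : T -> R) : measurable_fun setT h ->
  (forall w, `|h w| <= C) -> P.-integrable setT (EFin \o h).
Proof.
move=> mh hC; apply: measurable_bounded_integrable => //.
  by rewrite /= probability_setT ltry.
by exists C; split=> [|M CM w _]; [exact: num_real|exact: le_trans (hC w) (ltW CM)].
Qed.

Lemma measurable_affine_comp e f y : measurable_fun setT f ->
  measurable_fun setT (fun w => f (y + e * xi w)).
Proof. by move=> mf; apply: (measurableT_comp mf); mfun. Qed.

Lemma killed_step_integrable C e f y : bounded_nonneg C f ->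
  P.-integrable setT (EFin \o (fun w => f (y + e * xi w))).
Proof.
move=> [mf fC]; apply: (@probability_bounded_integrable C).
  exact: measurable_affine_comp.
by move=> w; have /andP[f0 ?] := fC (y + e * xi w); rewrite ger0_norm.
Qed.

Lemma measurable_ge0 : measurable_fun setT (fun y : R => (0 <= y)%R%:R : R).
Proof.
rewrite (_ : (fun y => _) = (\1_(`[0, +oo[%classic : set R) : R -> R)).
  exact: measurable_indic.
apply/funext => y; rewrite indicE; congr (nat_of_bool _)%:R.
by apply/idP/idP; rewrite inE/= in_itv/= andbT.
Qed.

Lemma killed_step_bounded C e f : bounded_nonneg C f ->
  bounded_nonneg C (killed_step e f).
Proof.
move=> bf; have [mf fC] := bf; split.
  apply: measurable_funM; first exact: measurable_ge0.
  have : measurable_fun setT (fun z : R * T => f (z.1 + e * xi z.2)); last first.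
    exact: (@measurable_Rintegral _ _ _ _ _ P setT (fun (y : R) w => f (y + e * xi w)) measurableT).
  apply: (measurableT_comp mf); apply: measurable_funD; first by mfun.
  by apply: measurable_funM; [mfun|exact: measurableT_comp].
move=> y; rewrite /killed_step; case: (leP 0 y) => y0; last first.
  have /andP[f0 f1] := fC 0.
  by rewrite mul0r lexx (le_trans f0).
rewrite mul1r; apply/andP; split.
  by apply: Rintegral_ge0 => w _; have /andP[] := fC (y + e * xi w).
have <- : \int[P]_(w in setT) C = C.
  by rewrite Rintegral_cst//= probability_setT mulr1.
apply: le_Rintegral => //; first exact: killed_step_integrable.
  by apply: (@probability_bounded_integrable `|C|).
by move=> w _; have /andP[] := fC (y + e * xi w).
Qed.

Lemma killed_step_lt0 e f y : y < 0 -> killed_step e f y = 0.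
Proof. by move=> y0; rewrite /killed_step leNgt y0 mul0r. Qed.

Lemma killed_step_EFin C e f y : bounded_nonneg C f ->
  ((killed_step e f y)%:E =
   ((0 <= y)%R%:R)%:E * \int[P]_w (f (y + e * xi w)%R)%:E)%E.
Proof.
move=> bf; rewrite /killed_step EFinM /Rintegral fineK//.
exact: (integrable_fin_num measurableT (killed_step_integrable e y bf)).
Qed.

Lemma killed_step_linear C D e a b f g : bounded_nonneg C f -> bounded_nonneg D g ->
  killed_step e (fun y => a * f y + b * g y) =
  (fun y => a * killed_step e f y + b * killed_step e g y).
Proof.
move=> bf bg; apply/funext => y; rewrite /killed_step.
have i1 := killed_step_integrable e y bf.
have i2 := killed_step_integrable e y bg.
rewrite RintegralD//.
- by rewrite !RintegralZl//; ring.
- by rewrite (_ : _ \o _ = (fun w => a%:E * (EFin \o (fun w => f (y + e * xi w)%R)) w)%E);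
    [exact: integrableZl|].
- by rewrite (_ : _ \o _ = (fun w => b%:E * (EFin \o (fun w => g (y + e * xi w)%R)) w)%E);
    [exact: integrableZl|].
Qed.

Lemma killed_step_le C D e f g : bounded_nonneg C f -> bounded_nonneg D g ->
  (forall y, f y <= g y) -> forall y, killed_step e f y <= killed_step e g y.
Proof.
move=> bf bg fg y; rewrite /killed_step ler_wpM2l//.
by apply: le_Rintegral => //; [exact: killed_step_integrable bf|exact: killed_step_integrable bg].
Qed.

Lemma iter_killed_step_bounded C e f n : bounded_nonneg C f ->
  bounded_nonneg C (iter n (killed_step e) f).
Proof. by move=> bf; elim: n => //= n; exact: killed_step_bounded. Qed.

Lemma iter_killed_step_lt0 e f n y : (forall y, y < 0 -> f y = 0) -> y < 0 ->
  iter n (killed_step e) f y = 0.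
Proof. by move=> f0 y0; case: n => [|n]; [exact: f0|exact: killed_step_lt0]. Qed.

Lemma iter_killed_step_linear C D e a b f g n : 0 <= a -> 0 <= b ->
  bounded_nonneg C f -> bounded_nonneg D g ->
  iter n (killed_step e) (fun y => a * f y + b * g y) =
  (fun y => a * iter n (killed_step e) f y + b * iter n (killed_step e) g y).
Proof.
move=> a0 b0 bf bg; elim: n => // n IH; rewrite iterS IH.
by rewrite (@killed_step_linear C D)//; exact: iter_killed_step_bounded.
Qed.

Lemma iter_killed_step_le C D e f g n : bounded_nonneg C f -> bounded_nonneg D g ->
  (forall y, f y <= g y) ->
  forall y, iter n (killed_step e) f y <= iter n (killed_step e) g y.
Proof.
move=> bf bg fg; elim: n => // n IH y /=.
by apply: (@killed_step_le C D) => //; exact: iter_killed_step_bounded.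
Qed.

(** For a fixed increment, the translation c = y + xi preserves Lebesgue measure and exchanges the
    two integrands. Since f and g vanish on the negative half-line, the indicators at the points of
    departure are already contained in them. *)
Let duality1 C D f g : bounded_nonneg C f -> bounded_nonneg D g ->
  (forall y, y < 0 -> f y = 0) -> (forall y, y < 0 -> g y = 0) ->
  (\int[mu]_c (g c * killed_step (-1) f c)%:E =
   \int[mu]_y (f y * killed_step 1 g y)%:E)%E.
Proof.
move=> bf bg f0 g0; have [mf fC] := bf; have [mg gD] := bg.
have f_ge0 y : 0 <= f y by case/andP: (fC y).
have g_ge0 y : 0 <= g y by case/andP: (gD y).
have pull (k l : R -> R) C' e : bounded_nonneg C' l -> (forall y, y < 0 -> k y = 0) ->
    (forall y, 0 <= k y) ->
    (fun c => (k c * killed_step e l c)%:E) =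
    (fun c => \int[P]_w (k c * l (c + e * xi w))%:E)%E.
  move=> bl k0 k_ge0; have [ml lC] := bl; apply/funext => c.
  rewrite EFinM (killed_step_EFin _ _ bl) muleA -EFinM.
  have -> : k c * (0 <= c)%R%:R = k c.
    by case: (leP 0 c) => c0; rewrite ?mulr1// k0// mul0r.
  rewrite -ge0_integralZl_EFin//.
  - by move=> w _; rewrite lee_fin; have /andP[] := lC (c + e * xi w).
  - by apply/measurable_EFinP; exact: measurable_affine_comp.
rewrite (pull _ _ _ _ bf g0 g_ge0) (pull _ _ _ _ bg f0 f_ge0).
pose F (e : R) (k l : R -> R) (z : R * T) := (k z.1 * l (z.1 + e * xi z.2))%:E.
have mF e k l : measurable_fun setT k -> measurable_fun setT l ->
    measurable_fun setT (F e k l).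
  move=> mk ml; apply/measurable_EFinP; apply: measurable_funM.
    exact: (measurableT_comp mk measurable_fst).
  apply: (measurableT_comp ml); apply: measurable_funD; first by mfun.
  by apply: measurable_funM; [mfun|exact: measurableT_comp].
have F0 e k l : (forall y, 0 <= k y) -> (forall y, 0 <= l y) ->
    forall z, (0 <= F e k l z)%E.
  by move=> k0 l0 z; rewrite lee_fin mulr_ge0.
rewrite (@fubini_tonelli _ _ _ _ _ mu P (F (-1) g f)) ?(@fubini_tonelli _ _ _ _ _ mu P (F 1 f g)) ; try exact: mF; try exact: F0.
apply: eq_integral => w _; rewrite -[LHS](@ge0_integral_translation _ (xi w)).
- apply: eq_integral => y _; rewrite /F/=; congr EFin; rewrite mulrC; congr (f _ * g _); ring.
- apply/measurable_EFinP; rewrite /=; apply: measurable_funM; first exact: mg.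
  by apply: (measurableT_comp mf); mfun.
- by move=> c; exact: (F0 _ _ _ g_ge0 f_ge0 (c, w)).
Qed.

Lemma killed_step_duality C D f g n : bounded_nonneg C f -> bounded_nonneg D g ->
  (forall y, y < 0 -> f y = 0) -> (forall y, y < 0 -> g y = 0) ->
  (\int[mu]_c (g c * iter n (killed_step (-1)) f c)%:E =
   \int[mu]_y (f y * iter n (killed_step 1) g y)%:E)%E.
Proof.
move=> bf bg f0 g0; elim: n => [|n IH] in g bg g0 *.
  by apply: eq_integral => c _; rewrite /= mulrC.
rewrite iterS (@duality1 C D)//; last 2 first.
- exact: iter_killed_step_bounded.
- by move=> y; exact: iter_killed_step_lt0.
rewrite (_ : (fun y => _) = (fun y => (killed_step 1 g y * iter n (killed_step (-1)) f y)%:E)).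
  rewrite IH ?iterSr//; first exact: killed_step_bounded.
  by move=> y; exact: killed_step_lt0.
by apply/funext => y; rewrite mulrC.
Qed.

End killed_step.

(** * Random walk below a level *)

Section killed_walk.
Context d (T : measurableType d) (R : realType) (P : probability T R).
Variables (xi : nat -> T -> R) (zeta : T -> R).
Hypothesis mxi : forall i, measurable_fun setT (xi i).
Hypothesis mzeta : measurable_fun setT zeta.
Hypothesis xi_independent : forall n (A : nat -> set R),
  (forall i, measurable (A i)) ->
  P [set w | forall i, (i < n)%N -> A i (xi i w)] =
  (\prod_(i < n) P [set w | A i (xi i w)])%E.
Hypothesis xi_law : forall i A, measurable A ->
  P [set w | A (xi i w)] = P [set w | A (zeta w)].

Definition walk (c : R) (k : nat) (w : T) : R := c - \sum_(i < k) xi i w.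
(** Time n is left out: as in [killed_step], points are tested on departure, and at time n a test
    function that vanishes on the negative half-line does the killing. *)
Definition survival (c : R) (n : nat) : set T :=
  [set w | forall k, (k < n)%N -> 0 <= walk c k w].

Lemma measurable_walk c k : measurable_fun setT (walk c k).
Proof. by apply: measurable_funB => //; exact: measurable_sum. Qed.

Lemma measurable_survival c n : measurable (survival c n).
Proof.
rewrite (_ : survival c n = \bigcap_(k in [set k | (k < n)%N]) (walk c k @^-1` `[0, +oo[)).
  apply: bigcap_measurableType => k _.
  by rewrite -[X in measurable X]setTI; exact: measurable_walk.
by apply/seteqP; split => w wk k kn; have := wk k kn; rewrite /= in_itv/= andbT.
Qed.

Let G (B : nat -> set R) n := [set w | forall i, (i < n)%N -> B i (xi i w)].

Let mG B n : (forall i, measurable (B i)) -> measurable (G B n).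
Proof.
move=> mB; rewrite (_ : G B n = \bigcap_(k in [set k | (k < n)%N]) (xi k @^-1` B k)).
  apply: bigcap_measurableType => k _.
  by rewrite -[X in measurable X]setTI; exact: mxi.
by apply/seteqP; split => w wk k kn; exact: wk.
Qed.

Lemma ge0_integral_same_law i (f : R -> \bar R) : measurable_fun setT f ->
  (forall x, (0 <= f x)%E) -> (\int[P]_w f (xi i w) = \int[P]_w f (zeta w))%E.
Proof.
move=> mf f0.
transitivity (\int[P]_(w in (xi i) @^-1` setT) (f \o xi i) w)%E.
  by rewrite preimage_setT.
rewrite -(ge0_integral_pushforward (mxi i))//.
transitivity (\int[P]_(w in zeta @^-1` setT) (f \o zeta) w)%E; last by rewrite preimage_setT.
rewrite -(ge0_integral_pushforward mzeta)//.
by apply: eq_measure_integral => A mA _; exact: xi_law.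
Qed.

Notation Q := (killed_step P zeta (-1)).

(* The events B i only serve the induction, which makes the position of the
   walk independent of the next increment. *)
Let killed_walk_with_events c N M (B : nat -> set R) C f : (N <= M)%N ->
  (forall i, measurable (B i)) -> (forall i, (i < N)%N -> B i = setT) ->
  bounded_nonneg C f -> (forall y, y < 0 -> f y = 0) ->
  (\int[P]_(w in survival c N `&` G B M) (f (walk c N w))%:E =
   (iter N Q f c)%:E * \prod_(i < M) P [set w | B i (xi i w)])%E.
Proof.
elim: N => [|N IH] in B C f *.
  move=> _ mB _ bf f0.
  rewrite (_ : survival c 0 = setT) ?setTI; last by apply/seteqP; split => w.
  under eq_integral => w _ do rewrite /walk big_ord0 subr0.
  by rewrite integral_cst/= ?xi_independent//; exact: mG.
move=> NM mB BN bf f0.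
have [mf fC] := bf.
have mE : measurable (survival c N.+1 `&` G B M).
  by apply: measurableI; [exact: measurable_survival|exact: mG].
have survS w : survival c N.+1 w <-> survival c N w /\ 0 <= walk c N w.
  split=> [h|[h1 h2] k]; first by split=> [k kN|]; apply: h => //; exact: ltnW.
  by rewrite ltnS leq_eqVlt => /predU1P[->//|]; exact: h1.
have BNT : B N = setT by exact: BN.
pose B' (D : set R) i := if (i == N)%N then D else B i.
have mB' D i : measurable D -> measurable (B' D i) by rewrite /B'; case: eqP.
have NM' : (N <= M)%N by exact: ltnW.
have prodB' D : measurable D -> (\prod_(i < M) P [set w | B' D i (xi i w)] =
    P (xi N @^-1` D) * \prod_(i < M) P [set w | B i (xi i w)])%E.
  move=> mD; rewrite (bigD1 (Ordinal NM))//= [in RHS](bigD1 (Ordinal NM))//=.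
  rewrite {1}/B' eqxx BNT (_ : [set w | setT (xi N w)] = setT); last first.
    by apply/seteqP; split.
  rewrite probability_setT mul1e; congr (_ * _)%E; apply: eq_bigr => i /eqP iN.
  by rewrite /B'; case: eqP => // h; exfalso; apply: iN; exact: val_inj.
(* The induction hypothesis with the indicator of A, cut to [0, +oo[, as test function and D as the
   event of index N, which is free because [B N] is [setT]. Independence follows by comparing D with
   [setT]. *)
have PE (A D : set R) : measurable A -> measurable D ->
    P (survival c N.+1 `&` G B M `&` walk c N @^-1` A `&` xi N @^-1` D) =
    ((iter N Q (\1_(A `&` `[0%R, +oo[) : R -> R) c)%:E *
      (P (xi N @^-1` D) * \prod_(i < M) P [set w | B i (xi i w)]))%E.
  move=> mA mD; rewrite -prodB'//.
  have mA0 : measurable (A `&` `[0%R, +oo[ : set R) by exact: measurableI.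
  rewrite -(IH (B' D) 1 _ NM').
  - rewrite (_ : (fun w => _) = (fun w => (\1_(walk c N @^-1` (A `&` `[0%R, +oo[)) w)%:E)).
      rewrite integral_indic//; last 2 first.
      + by apply: measurableI; [exact: measurable_survival|apply: mG => i; exact: mB'].
      + by rewrite -[X in measurable X]setTI; exact: measurable_walk.
      congr (P _); apply/seteqP; split => w /=.
        move=> [[[/survS[s1 s2] g] a] x]; split; first by rewrite in_itv/= andbT.
        split => // i iM; rewrite /B'; case: eqP => [->//|_]; exact: g.
      rewrite in_itv/= andbT => -[[a w0] [s g]].
      split; last by have := g N NM; rewrite /B' eqxx.
      split=> //; split; first exact/survS.
      move=> i iM; have := g i iM; rewrite /B'; case: eqP => // -> _.
      by rewrite BNT.
    by apply/funext => w; rewrite !indicE.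
  - by move=> i; exact: mB'.
  - move=> i iN; rewrite /B'; case: eqP => [h|_]; first by rewrite h ltnn in iN.
    by apply: BN; exact: ltnW.
  - split; first exact: measurable_indic.
    by move=> y; rewrite indicE; case: (_ \in _); rewrite ?lexx ler01.
  - move=> y y0; rewrite indicE (_ : _ \in _ = false)//.
    by apply/negbTE/negP; rewrite inE/= in_itv/= andbT leNgt y0 => -[].
have ind (A D : set R) : measurable A -> measurable D ->
    P (survival c N.+1 `&` G B M `&` walk c N @^-1` A `&` xi N @^-1` D) =
    (P (survival c N.+1 `&` G B M `&` walk c N @^-1` A) * P (xi N @^-1` D))%E.
  move=> mA mD; rewrite PE//.
  have := PE A setT mA measurableT; rewrite preimage_setT setIT => ->.
  rewrite probability_setT mul1e -muleA; congr (_ * _)%E; exact: muleC.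
pose h (z : R * R) := (f (z.1 - z.2))%:E.
have mh : measurable_fun setT h.
  by apply/measurable_EFinP; apply: (measurableT_comp mf); mfun.
have h0 z : (0 <= h z)%E by rewrite lee_fin; case/andP: (fC (z.1 - z.2)).
rewrite (_ : (fun w => _) = (fun w => h (walk c N w, xi N w))); last first.
  apply/funext => w; rewrite /h/= /walk big_ord_recr/=; congr (f _)%:E; ring.
rewrite (ge0_integral_independent mE (measurable_walk c N) (mxi N) mh h0 ind).
have bQ : bounded_nonneg C (Q f) by exact: killed_step_bounded.
rewrite iterSr -(IH B C (Q f) NM' mB _ bQ); last 2 first.
- by move=> i iN; apply: BN; exact: ltnW.
- by move=> y; exact: killed_step_lt0.
transitivity (\int[P]_(w in survival c N `&` G B M `&` walk c N @^-1` `[0%R, +oo[)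
    (Q f (walk c N w))%:E)%E.
  rewrite (_ : survival c N.+1 `&` G B M = survival c N `&` G B M `&` walk c N @^-1` `[0%R, +oo[).
    apply: eq_integral => w; rewrite inE/= in_itv/= andbT => -[_ w0].
    rewrite (killed_step_EFin _ _ _ _ bf)// w0 mul1e.
    have mf' : measurable_fun setT (fun x : R => (f (walk c N w - x))%:E).
      by apply/measurable_EFinP; apply: (measurableT_comp mf); mfun.
    rewrite /h/= (ge0_integral_same_law N mf').
      by apply: eq_integral => v _; rewrite mulN1r.
    by move=> x; rewrite lee_fin; case/andP: (fC (walk c N w - x)).
  apply/seteqP; split => w /=; rewrite in_itv/= andbT.
    by move=> [/survS[s1 s2] g].
  by move=> [[s1 g] s2]; split=> //; exact/survS.
rewrite integral_mkcondr; apply: eq_integral => w _; rewrite patchE.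
case: ifP => // /negbT; rewrite notin_setE/= in_itv/= andbT => /negP; rewrite -ltNge => w0.
by rewrite killed_step_lt0.
Qed.

Lemma killed_walk_integral c N C f : bounded_nonneg C f ->
  (forall y, y < 0 -> f y = 0) ->
  (\int[P]_(w in survival c N) (f (walk c N w))%:E = (iter N Q f c)%:E)%E.
Proof.
move=> bf f0; have := killed_walk_with_events c (leqnn N) (fun=> measurableT) (fun _ _ => erefl) bf f0.
rewrite (_ : G _ _ = setT) ?setIT; last by apply/seteqP; split => w.
rewrite big1 ?mule1// => i _.
by rewrite (_ : [set w | setT (xi i w)] = setT) ?probability_setT//; apply/seteqP; split.
Qed.

End killed_walk.

(** * Discounted exponentials and the undershoot *)

Section exponential_decomposition.
Context d (T : measurableType d) (R : realType) (P : probability T R).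
Variables (zeta : T -> R) (Lam : R -> R).
Hypothesis mzeta : measurable_fun setT zeta.
Hypothesis zeta_integrable : forall th, 0 <= th ->
  P.-integrable setT (EFin \o (fun w => expR (- (th * zeta w)))).
Hypothesis zeta_laplace : forall th, 0 <= th ->
  \int[P]_w expR (- (th * zeta w)) = Lam th.
Hypothesis Lam_ge1 : forall th, 0 <= th -> 1 <= Lam th.

Definition killed_exp (th y : R) : R := (0 <= y)%R%:R * expR (- (th * y)).

(* Laplace transform of the position after a step that leaves [0, +oo[. *)
Definition undershoot (th y : R) : R :=
  (0 <= y)%R%:R * \int[P]_w ((y + zeta w < 0)%R%:R * expR (- (th * (y + zeta w)))).

Notation Q := (killed_step P zeta 1).

Let Lam_gt0 th : 0 <= th -> 0 < Lam th.
Proof. by move=> th0; exact: lt_le_trans (Lam_ge1 th0). Qed.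

Let measurable_lt0 : measurable_fun setT (fun y : R => (y < 0)%R%:R : R).
Proof.
rewrite (_ : (fun y => _) = (\1_(`]-oo, 0[%classic : set R) : R -> R)).
  exact: measurable_indic.
apply/funext => y; rewrite indicE; congr (nat_of_bool _)%:R.
by apply/idP/idP; rewrite inE/= in_itv/=.
Qed.

Lemma killed_exp_bounded th : 0 <= th -> bounded_nonneg 1 (killed_exp th).
Proof.
move=> th0; split.
  by apply: measurable_funM; [exact: measurable_ge0|mfun].
move=> y; rewrite /killed_exp; case: (leP 0 y) => y0; last by rewrite mul0r lexx ler01.
by rewrite mul1r expR_ge0 -[leRHS]expR0 ler_expR oppr_le0 mulr_ge0.
Qed.

Let under_integrand th (y : R) : 0 <= th ->
  measurable_fun setT (fun w => (y + zeta w < 0)%R%:R * expR (- (th * (y + zeta w)))) /\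
  P.-integrable setT (EFin \o
    (fun w => (y + zeta w < 0)%R%:R * expR (- (th * (y + zeta w))))).
Proof.
move=> th0.
have mf : measurable_fun setT (fun w => (y + zeta w < 0)%R%:R * expR (- (th * (y + zeta w)))).
  apply: measurable_funM; last by mfun.
  by apply: (measurableT_comp measurable_lt0); mfun.
split=> //.
apply: (@integrable_le _ _ _ P _ measurableT _ (fun w => expR (- (th * y)) * expR (- (th * zeta w)))) => //.
  move=> w _; rewrite ger0_norm ?mulr_ge0 ?expR_ge0//.
  rewrite -[leRHS]mul1r -expRD ler_pM ?expR_ge0//; first by case: (_ < _).
  by rewrite ler_expR; lra.
rewrite (_ : _ \o _ = (fun w => (expR (- (th * y)))%:E * (EFin \o (fun w => expR (- (th * zeta w))%R)) w)%E)//.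
by apply: integrableZl => //; exact: zeta_integrable.
Qed.

Lemma undershoot_bounded th : 0 <= th -> bounded_nonneg (Lam th) (undershoot th).
Proof.
move=> th0; split.
  apply: measurable_funM; first exact: measurable_ge0.
  have : measurable_fun setT (fun z : R * T =>
      (z.1 + zeta z.2 < 0)%R%:R * expR (- (th * (z.1 + zeta z.2))) : R).
    have mz : measurable_fun setT (fun z : R * T => z.1 + zeta z.2).
      by apply: measurable_funD; [mfun|exact: measurableT_comp].
    by apply: measurable_funM; [exact: (measurableT_comp measurable_lt0 mz)|mfun].
  exact: (@measurable_Rintegral _ _ _ _ _ P setT (fun (y : R) w =>
    (y + zeta w < 0)%R%:R * expR (- (th * (y + zeta w)))) measurableT).
move=> y; rewrite /undershoot; case: (leP 0 y) => y0; last first.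
  by rewrite mul0r lexx ltW// Lam_gt0.
have [mf if_] := under_integrand y th0.
rewrite mul1r; apply/andP; split.
  by apply: Rintegral_ge0 => w _; rewrite mulr_ge0 ?expR_ge0.
rewrite -zeta_laplace//; apply: le_Rintegral => //; first exact: zeta_integrable.
move=> w _; rewrite -[leRHS]mul1r ler_pM ?expR_ge0//; first by case: (_ < _).
by rewrite ler_expR lerN2 ler_wpM2l// lerDr.
Qed.

(** An unrestricted step multiplies exp (- th y) by [Lam th]; of the result, [Q] keeps the part in
    [0, +oo[ and [undershoot] the part below. The coefficients 1 and 0 give both sides the form of
    [iter_killed_step_linear]. *)
Lemma killed_exp_step th : 0 <= th ->
  (fun y => 1 * Q (killed_exp th) y + 1 * undershoot th y) =
  (fun y => Lam th * killed_exp th y + 0 * killed_exp th y).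
Proof.
move=> th0; apply/funext => y; rewrite !mul1r mul0r addr0.
have [mf if_] := under_integrand y th0.
have iQ := killed_step_integrable P mzeta 1 y (killed_exp_bounded th0).
rewrite /killed_step /undershoot /killed_exp -mulrDr mulrCA; congr (_ * _).
rewrite -RintegralD// -zeta_laplace// mulrC -RintegralZl//; last exact: zeta_integrable.
apply: eq_Rintegral => w _; rewrite /killed_exp mul1r.
rewrite -mulrDl (_ : _%:R + _%:R = 1) ?mul1r -?expRD; last by case: ltP => _; rewrite ?add0r ?addr0.
by congr expR; ring.
Qed.

Variables (th y : R).
Hypothesis th0 : 0 <= th.

Definition discounted n := (Lam th) ^- n * iter n Q (killed_exp th) y.

Lemma discounted_bounds n : 0 <= discounted n <= (Lam th) ^- n.
Proof.
have [_ /(_ y)/andP[h0 h1]] :=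
  iter_killed_step_bounded P mzeta 1 n (killed_exp_bounded th0).
have l0 : 0 <= (Lam th) ^- n by rewrite invr_ge0 exprn_ge0// ltW// Lam_gt0.
by rewrite mulr_ge0//= -[leRHS]mulr1 ler_wpM2l.
Qed.

(** Optional stopping for the martingale (Lam th)^-j exp (- th Y_j): by [killed_exp_step] under
    [iter j], the term of index j is the drop from [discounted j] to [discounted j.+1], and the sum
    telescopes. *)
Lemma discounted_sum N M : (N <= M)%N ->
  \sum_(N <= j < M) (Lam th) ^- j.+1 * iter j Q (undershoot th) y =
  discounted N - discounted M.
Proof.
move=> NM; rewrite (eq_bigr (fun j => - (discounted j.+1 - discounted j))).
  by rewrite sumrN telescope_sumr// opprB.
move=> j _; have l0 : Lam th != 0 by rewrite gt_eqF// Lam_gt0.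
have bk := killed_exp_bounded th0.
have bQ : bounded_nonneg 1 (Q (killed_exp th)) by exact: killed_step_bounded.
have bu := undershoot_bounded th0.
have L0 : 0 <= Lam th by rewrite ltW// Lam_gt0.
have := congr1 (fun f => iter j Q f y) (killed_exp_step th0).
rewrite (iter_killed_step_linear P mzeta 1 j ler01 ler01 bQ bu).
rewrite (iter_killed_step_linear P mzeta 1 j L0 (lexx 0) bk bk).
rewrite /discounted iterSr !mul1r mul0r addr0 => H.
have -> : iter j Q (undershoot th) y =
    Lam th * iter j Q (killed_exp th) y - iter j Q (Q (killed_exp th)) y.
  by rewrite -H addrAC subrr add0r.
by rewrite exprS; field; rewrite l0 expf_neq0.
Qed.

Variables (p eps : R).
Hypothesis thp : th <= p.

Let p0 : 0 <= p. Proof. exact: le_trans thp. Qed.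

Let eta := Lam p * expR (- ((p - th) * eps)).

Let eta0 : 0 <= eta. Proof. by rewrite mulr_ge0 ?expR_ge0// ltW// Lam_gt0. Qed.

(* An undershoot exceeding eps has probability at most Lam p exp (- p eps), by
   Markov's inequality with parameter p. *)
Lemma undershoot_le z : undershoot 0 z <= undershoot th z <=
  expR (th * eps) * undershoot 0 z + eta.
Proof.
rewrite /undershoot; case: (leP 0 z) => z0; last by rewrite !mul0r mulr0 add0r lexx eta0.
rewrite !mul1r.
have [m0 i0] := under_integrand z (lexx 0).
have [mt it] := under_integrand z th0.
have ip := zeta_integrable p0.
apply/andP; split.
  apply: le_Rintegral => // w _; case: ltP => zw; last by rewrite !mul0r.
  by rewrite !mul1r ler_expR mul0r oppr0 oppr_ge0 mulr_ge0_le0// ltW.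
pose f0 w := (z + zeta w < 0)%R%:R * expR (- (0 * (z + zeta w))).
have i1 : P.-integrable setT (EFin \o (fun w => expR (th * eps) * f0 w)).
  rewrite (_ : _ \o _ = (fun w => (expR (th * eps))%:E * (EFin \o f0) w)%E)//.
  exact: integrableZl.
have i2 : P.-integrable setT (EFin \o (fun w =>
    expR (- ((p - th) * eps)) * expR (- (p * zeta w)))).
  rewrite (_ : _ \o _ = (fun w => (expR (- ((p - th) * eps)))%:E *
    (EFin \o (fun w => expR (- (p * zeta w))%R)) w)%E)//.
  exact: integrableZl.
have -> : expR (th * eps) * (\int[P]_w f0 w) + eta =
    \int[P]_w (expR (th * eps) * f0 w + expR (- ((p - th) * eps)) * expR (- (p * zeta w))).
  by rewrite RintegralD// !RintegralZl// zeta_laplace// [X in _ + X]mulrC.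
apply: le_Rintegral => //.
  rewrite (_ : _ \o _ = (fun w => (EFin \o (fun w => expR (th * eps) * f0 w)%R) w +
    (EFin \o (fun w => expR (- ((p - th) * eps)) * expR (- (p * zeta w)))%R) w)%E)//.
  exact: integrableD.
move=> w _; rewrite /f0; case: ltP => zw; last first.
  by rewrite !mul0r mulr0 add0r mulr_ge0 ?expR_ge0.
rewrite !mul1r mul0r oppr0 expR0 mulr1 -expRD.
have [ez|ez] := leP (- eps) (z + zeta w).
  rewrite -[leLHS]addr0 lerD ?expR_ge0// ler_expR -mulrN ler_wpM2l//.
  by rewrite lerNl.
rewrite -[leLHS]add0r lerD ?expR_ge0// ler_expR.
have h1 : 0 <= (p - th) * (- eps - (z + zeta w)).
  by rewrite mulr_ge0 ?subr_ge0// ltW.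
have h2 : 0 <= p * z by rewrite mulr_ge0.
have -> : - ((p - th) * eps) + - (p * zeta w) =
  - (th * (z + zeta w)) + ((p - th) * (- eps - (z + zeta w)) + p * z) by ring.
by rewrite lerDl addr_ge0.
Qed.

(** [undershoot 0] is the probability of leaving at the next step, so S discounts exit probabilities
    only. Putting it in place of [undershoot th] costs a factor exp (th eps) and an error [eta] per
    step, since the operators preserve bounds and the discounts are at most 1. *)
Lemma discounted_sum_bounds N M (S : R) : (N <= M)%N ->
  S = \sum_(N <= j < M) (Lam th) ^- j.+1 * iter j Q (undershoot 0) y ->
  S <= discounted N - discounted M <= expR (th * eps) * S + M%:R * eta.
Proof.
move=> NM ->; rewrite -discounted_sum//.
have b0 := undershoot_bounded (lexx 0).
have bt := undershoot_bounded th0.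
have b1 : bounded_nonneg 1 (fun=> 1 : R).
  by split; [exact: measurable_cst|move=> z; rewrite ler01 lexx].
have l0 j : 0 <= (Lam th) ^- j.+1 by rewrite invr_ge0 exprn_ge0// ltW// Lam_gt0.
have l1 j : (Lam th) ^- j.+1 <= 1.
  by rewrite invf_le1 ?exprn_gt0 ?Lam_gt0// exprn_ege1// Lam_ge1.
pose B z := expR (th * eps) * undershoot 0 z + eta * 1.
have bB : bounded_nonneg (expR (th * eps) * Lam 0 + eta) B.
  have [mu0 hu0] := b0; split.
    by apply: measurable_funD; [apply: measurable_funM => //|].
  move=> z; have /andP[u0 u1] := hu0 z; rewrite /B mulr1; apply/andP; split.
    by rewrite addr_ge0// mulr_ge0 ?expR_ge0.
  by rewrite lerD2r ler_wpM2l ?expR_ge0.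
apply/andP; split.
  apply: ler_sum => j _; rewrite ler_wpM2l//.
  have u0t z : undershoot 0 z <= undershoot th z by case/andP: (undershoot_le z).
  have h := iter_killed_step_le P mzeta 1 j b0 bt u0t y.
  exact: h.
have H j : (Lam th) ^- j.+1 * iter j Q (undershoot th) y <=
   expR (th * eps) * ((Lam th) ^- j.+1 * iter j Q (undershoot 0) y) + eta.
  apply: (@le_trans _ _ ((Lam th) ^- j.+1 * iter j Q B y)).
    have utB z : undershoot th z <= B z by rewrite /B mulr1; case/andP: (undershoot_le z).
    rewrite ler_wpM2l//; exact: (iter_killed_step_le P mzeta 1 j bt bB utB y).
  rewrite (iter_killed_step_linear P mzeta 1 j (expR_ge0 _) eta0 b0 b1).
  rewrite mulrDr mulrCA lerD2l.
  have [_ /(_ y)/andP[i0 i1]] := iter_killed_step_bounded P mzeta 1 j b1.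
  rewrite mulrCA -[leRHS]mulr1 ler_wpM2l//.
  by rewrite -[leRHS]mulr1 ler_pM.
apply: (@le_trans _ _ (\sum_(N <= j < M)
   (expR (th * eps) * ((Lam th) ^- j.+1 * iter j Q (undershoot 0) y) + eta))).
  by apply: ler_sum => j _; exact: H.
rewrite big_split/= -mulr_sumr lerD2l big_const_nat iter_addr addr0 [leRHS]mulr_natl.
by apply: ler_wpMn2l => //; exact: leq_subr.
Qed.


End exponential_decomposition.

(** * Vanishing mesh *)

Section squeeze.
Context {R : realType}.
Variables (S A E r : nat -> R) (L : R).
Hypothesis S_A : \forall n \near \oo, S n <= A n <= E n * S n + r n.
Hypothesis E_gt0 : forall n, 0 < E n.
Hypothesis E1 : E n @[n --> \oo] --> (1 : R).
Hypothesis r0 : r n @[n --> \oo] --> (0 : R).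

(** The sandwich serves in both directions: for the whole sum the limit of A is known, for the tail
    the limit of S is. *)
Lemma cvg_squeeze_lower : A n @[n --> \oo] --> L -> S n @[n --> \oo] --> L.
Proof.
move=> AL; apply: (@squeeze_cvgr _ _ _ _ (fun n => (A n - r n) / E n) A) => //.
  near=> n; have /andP[h1 h2] : S n <= A n <= E n * S n + r n by near: n.
  by rewrite h1 andbT ler_pdivrMr// lerBlDr mulrC.
rewrite -[X in _ --> X]subr0 -[X in _ --> X]divr1; apply: cvgM; first exact: cvgB.
by apply: cvgV => //; rewrite oner_neq0.
Unshelve. all: by end_near. Qed.

Lemma cvg_squeeze_upper : S n @[n --> \oo] --> L -> A n @[n --> \oo] --> L.
Proof.
move=> SL; apply: (@squeeze_cvgr _ _ _ _ S (fun n => E n * S n + r n)) => //.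
by rewrite -[X in _ --> X]addr0 -[X in _ --> X + _]mul1r; apply: cvgD => //; exact: cvgM.
Qed.

End squeeze.

(** * Exponential transforms on finer and finer skeletons *)

Section killed_exp_limit.
Context d (T : measurableType d) (R : realType) (P : probability T R).
Notation mu := (@lebesgue_measure R).
Variables (a t : R) (zeta : nat -> T -> R).
Hypothesis a1 : 1 < a.
Hypothesis a2 : a < 2.
Hypothesis t0 : 0 < t.
Let b := a^-1.
Let del n := t / 2 ^+ n.
Hypothesis mzeta : forall n, measurable_fun setT (zeta n).
Hypothesis zeta_integrable : forall n th, 0 <= th ->
  P.-integrable setT (EFin \o (fun w => expR (- (th * zeta n w)))).
Hypothesis zeta_laplace : forall n th, 0 <= th ->
  \int[P]_w expR (- (th * zeta n w)) = expR (del n * th `^ a).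

Let Lam n th := expR (del n * th `^ a).
Let Q n := killed_step P (zeta n) 1.
Let disc n th y j := (Lam n th) ^- j * iter j (Q n) (killed_exp th) y.
Let w n th y j := (Lam n th) ^- j.+1 * iter j (Q n) (undershoot P (zeta n) 0) y.

Let a0 : 0 < a. Proof. exact: lt_trans a1. Qed.
Let b0 : 0 < b. Proof. by rewrite invr_gt0. Qed.
Let b_half : 2^-1 < b. Proof. by rewrite ltf_pV2 ?posrE. Qed.
Let b_lt1 : b < 1. Proof. by rewrite invf_lt1. Qed.
Let del0 n : 0 < del n. Proof. by rewrite divr_gt0// exprn_gt0. Qed.
Let Lam_ge1 n th : 0 <= th -> 1 <= Lam n th.
Proof. by move=> th0; rewrite -[leLHS]expR0 ler_expR mulr_ge0 ?powR_ge0// ltW. Qed.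

Let powRb (x : R) : 0 <= x -> (x `^ b) `^ a = x.
Proof. by move=> x0; rewrite -powRrM /b mulVf ?gt_eqF// powRr1. Qed.

(* For p = s^2 and eps = 1/s, Lam p = e and the error is of order
   4^n exp (- s), while 4^n is polynomial in s. *)
Let s n : R := (2 ^+ n / t) `^ (b / 2).

Let pow2t n : 0 < 2 ^+ n / t.
Proof. by rewrite divr_gt0// exprn_gt0. Qed.

Let s_gt0 n : 0 < s n. Proof. by rewrite powR_gt0. Qed.

Let s2a n : (s n ^+ 2) `^ a = 2 ^+ n / t.
Proof.
have -> : s n ^+ 2 = (2 ^+ n / t) `^ b.
  by rewrite -powR_mulrn ?powR_ge0// -powRrM divfK.
by rewrite powRb// ltW.
Qed.

Let sVE n : (s n)^-1 = t `^ (b / 2) * ((2^-1) `^ (b / 2)) ^+ n.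
Proof.
apply: (mulfI (lt0r_neq0 (s_gt0 n))); rewrite mulfV ?gt_eqF//.
have -> : ((2^-1 : R) `^ (b / 2)) ^+ n = ((2^-1) ^+ n) `^ (b / 2).
  by rewrite -powR_mulrn ?powR_ge0// -powRrM mulrC powRrM powR_mulrn// invr_ge0.
rewrite /s -!powRM ?(ltW t0) ?(ltW (pow2t _)) ?mulr_ge0 ?(ltW t0) ?exprn_ge0 ?invr_ge0//.
rewrite (_ : _ * _ = 1) ?powR1// exprVn; field.
by rewrite expf_neq0//= gt_eqF.
Qed.

Let sV_cvg : (s n)^-1 @[n --> \oo] --> (0 : R).
Proof.
rewrite -[X in _ --> X](mulr0 (t `^ (b / 2))).
under eq_fun do rewrite sVE.
apply: cvgM; first exact: cvg_cst.
apply: cvg_expr; rewrite ger0_norm ?powR_ge0//.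
have p1 : 1 `^ (b / 2) = 1 :> R by rewrite powR1.
rewrite -[ltRHS]p1 gt0_ltr_powR ?nnegrE ?divr_gt0 ?invr_ge0//.
by rewrite invf_lt1// ltr1n.
Qed.

Let s_large (x : R) : \forall n \near \oo, x <= s n.
Proof.
have x0 : 0 < `|x| + 1 by rewrite ltr_wpDl.
have xV : 0 < (`|x| + 1)^-1 by rewrite invr_gt0.
move/cvgrPdist_le : sV_cvg => /(_ _ xV); apply: filterS => n.
rewrite sub0r normrN gtr0_norm ?invr_gt0// lef_pV2 ?posrE//; apply: le_trans.
by rewrite (le_trans (ler_norm _))// lerDl.
Qed.

Let error_bound th : 0 < th -> exists2 C, 0 <= C & \forall n \near \oo,
  th <= s n ^+ 2 /\
  (4 ^ n)%N%:R * (Lam n (s n ^+ 2) * expR (- ((s n ^+ 2 - th) * (s n)^-1))) <= C * (s n)^-1.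
Proof.
(* Here 9 is 8 + 1: 4^n <= t^2 s^8 because (s^2)^a = 2^n / t and a < 2, and one more power of s is
   spent on the rate 1 / s. *)
move=> th0; have p9 : 0 <= 9%:R :> R by [].
have [C C0 hC] := powR_le_expR p9.
exists (t ^+ 2 * expR (1 + th) * C); first by rewrite !mulr_ge0 ?expR_ge0 ?exprn_ge0// ltW.
near=> n.
have s1 : 1 <= s n by near: n; exact: s_large.
have sth : th <= s n by near: n; exact: s_large.
have s0 := s_gt0 n.
have s2 : s n <= s n ^+ 2 by rewrite expr2 ler_peMl// ltW.
split; first exact: le_trans s2.
rewrite /Lam s2a (_ : del n * (2 ^+ n / t) = 1); last first.
  by rewrite /del; field; rewrite gt_eqF//= expf_neq0.
have h4 : (4 ^ n)%N%:R <= t ^+ 2 * s n ^+ 8.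
  have -> : (4 ^ n)%N%:R = t ^+ 2 * (2 ^+ n / t) ^+ 2 :> R.
    rewrite -exprMn mulrCA mulfV ?gt_eqF// mulr1 natrX (_ : 4%:R = 2 ^+ 2 :> R).
      by rewrite -!exprM mulnC.
    by rewrite -natrX.
  rewrite ler_wpM2l ?exprn_ge0 ?(ltW t0)// -s2a (_ : s n ^+ 8 = ((s n ^+ 2) ^+ 2) ^+ 2).
    rewrite ler_sqr ?nnegrE ?powR_ge0 ?exprn_ge0 ?(ltW s0)//.
    rewrite -[leRHS]powR_mulrn ?exprn_ge0 ?(ltW s0)//.
    by rewrite ler_powR ?(le_trans s1)// ltW.
  by rewrite -!exprM.
have h8 : s n ^+ 8 * expR (- s n) <= C * (s n)^-1.
  rewrite ler_pdivlMr// mulrAC -exprSr expRN ler_pdivrMr ?expR_gt0//.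
  rewrite -powR_mulrn ?(ltW s0)//; apply: le_trans (hC _ (ltW s0)) _.
  by rewrite ler_wpM2l// ler_expR; move: s0; lra.
have he : expR (- ((s n ^+ 2 - th) * (s n)^-1)) <= expR th * expR (- s n).
  rewrite -expRD ler_expR.
  have -> : - ((s n ^+ 2 - th) * (s n)^-1) = th * (s n)^-1 - s n by field; rewrite gt_eqF.
  by rewrite lerD2r -[leRHS]mulr1 ler_wpM2l ?(ltW th0)// invf_le1.
apply: (@le_trans _ _ ((t ^+ 2 * s n ^+ 8) * (expR 1 * (expR th * expR (- s n))))).
  apply: ler_pM => //.
  by rewrite ler_wpM2l ?expR_ge0.
rewrite (_ : _ * _ = t ^+ 2 * expR (1 + th) * (s n ^+ 8 * expR (- s n))).
  by rewrite -[leRHS]mulrA ler_wpM2l// mulr_ge0 ?expR_ge0 ?exprn_ge0// ltW.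
by rewrite [in RHS]expRD; ring.
Unshelve. all: by end_near. Qed.

Let LamE n th j : (Lam n th) ^- j = expR (- (j%:R * (del n * th `^ a))).
Proof. by rewrite expRN expRM_natl. Qed.

Let sum_disc th y (N : nat -> nat) : 0 < th -> (forall n, (N n <= 4 ^ n)%N) ->
  exists r : nat -> R, r n @[n --> \oo] --> (0 : R) /\
  \forall n \near \oo,
    let S := \sum_(N n <= j < 4 ^ n) w n th y j in
    (S <= disc n th y (N n) - disc n th y (4 ^ n) <=
      expR (th * (s n)^-1) * S + r n).
Proof.
move=> th0 NM; have [C C0 hC] := error_bound th0.
exists (fun n => C * (s n)^-1); split.
  by rewrite -[X in _ --> X](mulr0 C); apply: cvgM; [exact: cvg_cst|exact: sV_cvg].
apply: filterS hC => n [h1 h2].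
have /andP[d1 d2] := discounted_sum_bounds (y := y) (mzeta n) (zeta_integrable n)
  (zeta_laplace n) (Lam_ge1 n) (ltW th0) (s n)^-1 h1 (NM n) erefl.
by rewrite d1/= (le_trans d2)// lerD2l.
Qed.

Let E1 th : expR (th * (s n)^-1) @[n --> \oo] --> (1 : R).
Proof.
rewrite -expR0; apply: (continuous_cvg _ (@continuous_expR _ _)).
by rewrite -[X in _ --> X](mulr0 th); apply: cvgM; [exact: cvg_cst|exact: sV_cvg].
Qed.

(** After 4^n steps of length t / 2^n the elapsed time is 2^n t, so the discount exp (- 2^n t th^a)
    tends to 0. *)
Let disc_cvg0 th y : 0 < th -> disc n th y (4 ^ n)%N @[n --> \oo] --> (0 : R).
Proof.
move=> th0; have tha : 0 < t * th `^ a by rewrite mulr_gt0// powR_gt0.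
apply: (@squeeze_cvgr _ _ _ _ (fun=> 0) (fun n => (t * th `^ a)^-1 * (2^-1) ^+ n)).
- near=> n.
  have /andP[-> h] := discounted_bounds P (mzeta n) (Lam_ge1 n) y (ltW th0) (4 ^ n)%N.
  have l0 : 0 < Lam n th ^+ (4 ^ n) by rewrite exprn_gt0// expR_gt0.
  have r0 : 0 < t * th `^ a * 2 ^+ n by rewrite mulr_gt0// exprn_gt0.
  rewrite (le_trans h)//= exprVn -invfM lef_pV2 ?posrE//.
  have e4 : (4 ^ n)%N%:R * (del n * th `^ a) = t * th `^ a * 2 ^+ n.
    rewrite /del (_ : (4 ^ n)%N%:R = 2 ^+ n * 2 ^+ n :> R).
      by field; rewrite expf_neq0.
    by rewrite -exprMn natrX; congr (_ ^+ _); rewrite -natrM.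
  by rewrite -expRM_natl e4 (le_trans _ (expR_ge1Dx _))// lerDr.
- exact: cvg_cst.
- rewrite -[X in _ --> X](mulr0 (t * th `^ a)^-1); apply: cvgM; first exact: cvg_cst.
  by apply: cvg_expr; rewrite ger0_norm ?invr_ge0// invf_lt1// ltr1n.
Unshelve. all: by end_near. Qed.

(** Put q = th^a. The exit times weighted by exp (- q s) have a known limiting transform at every
    integer, hence converging tails after t. By [discounted_sum] the tail is, in the limit, the
    discounted exponential at time t, and multiplication by exp (q t) undoes the discount. *)
Lemma killed_exp_limit y th : 0 < y -> 0 < th ->
  iter (2 ^ n)%N (killed_step P (zeta n) 1) (killed_exp th) y @[n --> \oo] -->
  pi^-1 * \int[mu]_(u in `]0, +oo[)
    (expR (- (u * t)) * stable_kernel b y u / (u + th `^ a)).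
Proof.
move=> y0 th0; set q := th `^ a; have q0 : 0 < q by rewrite powR_gt0.
pose h x := expR (- (q * x)) * stable_density b y x.
have qh : quadratic_decay h by exact: stable_density_decay.
pose sj n j := del n * j.+1%:R.
have w0 n j : 0 <= w n th y j.
  have [_ /(_ y)/andP[u0 _]] := iter_killed_step_bounded P (mzeta n) 1 j
    (undershoot_bounded (mzeta n) (zeta_integrable n) (zeta_laplace n) (Lam_ge1 n) (lexx 0)).
  by rewrite mulr_ge0// invr_ge0 exprn_ge0// expR_ge0.
have sj0 n j : 0 <= sj n j by rewrite mulr_ge0// ltW.
have lap (i : nat) : \sum_(j < 4 ^ n) w n th y j * expR (- (i%:R * sj n j)) @[n --> \oo] -->
    \int[mu]_(x in `]0, +oo[) (expR (- (i%:R * x)) * h x).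
  have qi : 0 < q + i%:R by rewrite ltr_wpDr.
  have -> : \int[mu]_(x in `]0, +oo[) (expR (- (i%:R * x)) * h x) = expR (- (y * (q + i%:R) `^ b)).
    rewrite -stable_density_laplace//; apply: eq_Rintegral => x _.
    by rewrite /h mulrA -expRD; congr (expR _ * _); ring.
  (* Since thi^a = q + i, the factor exp (- i s_j) is a change of parameter in the discount. *)
  pose thi := (q + i%:R) `^ b.
  have thi0 : 0 < thi by rewrite powR_gt0.
  have [r [r0 hr]] := sum_disc y thi0 (N := fun=> 0%N) (fun=> leq0n _).
  have -> : (fun n => \sum_(j < 4 ^ n) w n th y j * expR (- (i%:R * sj n j))) =
    (fun n => \sum_(0 <= j < 4 ^ n) w n thi y j).
    apply/funext => n; rewrite big_mkord; apply: eq_bigr => j _.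
    rewrite /w mulrAC; congr (_ * _).
    rewrite !LamE -expRD /sj /thi powRb ?(ltW qi)//.
    by congr expR; rewrite /q; ring.
  apply: (cvg_squeeze_lower hr (fun=> expR_gt0 _) (E1 thi) r0).
  rewrite -[X in _ --> X]subr0; apply: cvgB; last exact: disc_cvg0.
  rewrite (_ : (fun n => _) = (fun=> expR (- (y * thi)))); first exact: cvg_cst.
  apply/funext => n; rewrite /disc expr0 invr1 mul1r /= /killed_exp (ltW y0) mul1r.
  by rewrite mulrC.
have N4 n : (2 ^ n <= 4 ^ n)%N.
  by rewrite -[4%N]/(2 * 2)%N expnMn leq_pmulr// expn_gt0.
have := tail_sum_cvg w0 sj0 qh lap (ltW t0).
have -> : (fun n => \sum_(j < 4 ^ n | t < sj n j) w n th y j) =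
    (fun n => \sum_(2 ^ n <= j < 4 ^ n) w n th y j).
  apply/funext => n; rewrite -(big_mkord (fun j => t < sj n j)).
  (* An exit during step j + 1 is dated at the end of the step, so the exits strictly after t are
     those with j >= 2^n. *)
  have tsj j : (t < sj n j) = (2 ^ n <= j)%N.
    rewrite /sj /del mulrAC ltr_pdivlMr ?exprn_gt0// ltr_pM2l//.
    by rewrite -natrX ltr_nat ltnS.
  rewrite (big_cat_nat (leq0n _) (N4 n))/=.
  rewrite big_nat_cond big_pred0 ?add0r; last first.
    by move=> j; rewrite tsj; apply/negbTE/negP => /andP[/= j1 j2]; rewrite ltnNge j2 in j1.
  rewrite big_nat_cond [RHS]big_nat_cond; apply: eq_bigl => j.
  by rewrite tsj andbT; case: (leqP (2 ^ n) j); rewrite /= ?andbT ?andbF.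
rewrite (stable_density_tail b_half b_lt1 y0 q0 t0) => cS.
have [r [r0 hr]] := sum_disc y th0 N4.
have cA := cvg_squeeze_upper hr (E1 th) r0 cS.
have cE : expR (q * t) * (disc n th y (2 ^ n) - disc n th y (4 ^ n) +
    disc n th y (4 ^ n)) @[n --> \oo] --> expR (q * t) * (expR (- (q * t)) *
    (pi^-1 * \int[mu]_(u in `]0, +oo[) (expR (- (u * t)) * stable_kernel b y u / (u + q))) + 0).
  by apply: cvgM; [exact: cvg_cst|apply: cvgD; [exact: cA|exact: disc_cvg0]].
move: cE; rewrite addr0 mulrA -expRD subrr expR0 mul1r.
apply: cvg_trans; apply: near_eq_cvg; near=> n.
rewrite /= subrK /disc LamE [LHS]mulrA -expRD.
rewrite (_ : q * t + _ = 0) ?expR0 ?mul1r//.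
by rewrite /del natrX /q; field; rewrite expf_neq0.
Unshelve. all: by end_near. Qed.

End killed_exp_limit.

(** * The killed probability of an interval *)

Section killed_density_integral.
Context d (T : measurableType d) (R : realType) (P : probability T R).
Notation mu := (@lebesgue_measure R).
Variables (a t : R) (zeta : nat -> T -> R).
Hypothesis a1 : 1 < a.
Hypothesis a2 : a < 2.
Hypothesis t0 : 0 < t.
Let b := a^-1.
Hypothesis mzeta : forall n, measurable_fun setT (zeta n).
Hypothesis zeta_integrable : forall n th, 0 <= th ->
  P.-integrable setT (EFin \o (fun w => expR (- (th * zeta n w)))).
Hypothesis zeta_laplace : forall n th, 0 <= th ->
  \int[P]_w expR (- (th * zeta n w)) = expR (t / 2 ^+ n * th `^ a).

(** The claimed density in the variable y = 1 - x, the distance below the level. *)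
Definition killed_stable_density (y : R) : R := pi^-1 *
  \int[mu]_(u in `]0, +oo[) (expR (- (u * t)) * stable_kernel b y u *
                             mittag_leffler a a (- u)).

Let a0 : 0 < a. Proof. exact: lt_trans a1. Qed.
Let b0 : 0 < b. Proof. by rewrite invr_gt0. Qed.
Let b_half : 2^-1 < b. Proof. by rewrite ltf_pV2 ?posrE. Qed.
Let b_lt1 : b < 1. Proof. by rewrite invf_lt1. Qed.
Let b01 : 0 < b < 1. Proof. by rewrite b0 b_lt1. Qed.
Let pi0 : 0 < pi :> R. Proof. exact: pi_gt0. Qed.

Let ml u := mittag_leffler a a (- u).

Let mml : measurable_fun setT ml.
Proof.
apply: (measurableT_comp (continuous_measurable_fun (mittag_leffler_continuous a1))).
by mfun.
Qed.

Let ml_le u : 0 < u -> `|ml u| <= expR (2 * (u + 1) `^ b).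
Proof.
move=> u0; have := mittag_leffler_le a1 (- u) (@ltr01 R).
by rewrite powR1 mul1r mulr1 normrN (gtr0_norm u0); exact.
Qed.

Let density_integrand_le Y : 0 <= Y -> exists2 K, 0 <= K & forall y u, 0 <= y <= Y -> 0 < u ->
  `|expR (- (u * t)) * stable_kernel b y u * ml u| <= K / oneDsqr u.
Proof.
move=> Y0; have Y2 : 0 <= Y + 2 by rewrite addr_ge0.
have [K K0 hK] := expR_powR_decay t0 Y2 b01.
exists K => // y u yY u0; apply: le_trans (hK _ (ltW u0)).
have -> : expR (- (t * u) + (Y + 2) * (u + 1) `^ b) =
    expR (- (u * t)) * expR (Y * (u + 1) `^ b) * expR (2 * (u + 1) `^ b).
  by rewrite -!expRD; congr expR; ring.
rewrite normrM; apply: ler_pM => //; last exact: ml_le.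
rewrite normrM (ger0_norm (expR_ge0 _)) ler_wpM2l ?expR_ge0//.
by apply: stable_kernel_le => //; exact: ltW.
Qed.

Let measurable_integrand : measurable_fun setT (fun z : R * R =>
  expR (- (z.2 * t)) * stable_kernel b z.1 z.2 * ml z.2).
Proof.
apply: measurable_funM; last exact: (measurableT_comp mml measurable_snd).
by apply: measurable_funM; [mfun|exact: measurable_stable_kernel].
Qed.

Lemma measurable_killed_stable_density : measurable_fun setT killed_stable_density.
Proof.
apply: measurable_funM => //.
exact: (@measurable_Rintegral _ _ _ _ _ mu _
  (fun y u => expR (- (u * t)) * stable_kernel b y u * ml u)).
Qed.

Lemma killed_stable_density_integrable y : 0 <= y ->
  mu.-integrable `]0, +oo[ (EFin \o (fun u =>
    expR (- (u * t)) * stable_kernel b y u * mittag_leffler a a (- u))).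
Proof.
move=> y0; have [K K0 hK] := density_integrand_le y0.
apply: integrable_le (integrable_oneDsqrV K) => //.
  exact: (measurableT_comp measurable_integrand (measurable_pair1 y)).
by move=> u; rewrite /= in_itv/= andbT => u0; apply: hK => //; rewrite y0 lexx.
Qed.

Lemma killed_stable_density_bounded Y : 0 <= Y ->
  exists C, forall y, 0 <= y <= Y -> `|killed_stable_density y| <= C.
Proof.
move=> Y0; have [K K0 hK] := density_integrand_le Y0.
exists (pi^-1 * \int[mu]_(u in `]0, +oo[) (K / oneDsqr u)) => y yY.
rewrite normrM (gtr0_norm (_ : 0 < pi^-1)) ?invr_gt0// ler_pM2l ?invr_gt0//.
apply: Rintegral_norm_le => //; last exact: integrable_oneDsqrV.
  exact: (measurableT_comp measurable_integrand (measurable_pair1 y)).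
by move=> u; rewrite /= in_itv/= andbT => u0; exact: hK.
Qed.

Lemma killed_stable_density_continuous y : 0 < y ->
  {for y, continuous killed_stable_density}.
Proof.
move=> y0; have Y0 : 0 <= y + 1 by rewrite addr_ge0// ltW.
have [K K0 hK] := density_integrand_le Y0.
apply: cvgM; first exact: cvg_cst.
have yy1 x : 0 < x -> x < y + 1 -> 0 <= x <= y + 1 by move=> h1 h2; rewrite !ltW.
apply: (@continuity_under_integral _ _ _ mu
  (fun y u => expR (- (u * t)) * stable_kernel b y u * ml u) `]0, +oo[%classic
  (measurable_itv _) 0 (y + 1) _ _ (fun u => K / oneDsqr u)).
- move=> x; rewrite /= in_itv/= => /andP[x0 xy].
  by apply: killed_stable_density_integrable; exact: ltW.
- apply: aeW => u _ x _.
  change {for x, continuous (fun x => expR (- (u * t)) * stable_kernel b x u * ml u)}.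
  apply: continuous_mul; last exact: cvg_cst.
  apply: continuous_mul; first exact: cvg_cst.
  rewrite /stable_kernel; apply: continuous_mul.
    apply: (continuous_comp (f := fun x : R => - (x * u `^ b * cos (pi * b)))); last exact: continuous_expR.
    by cfun.
  apply: (continuous_comp (f := fun x : R => x * u `^ b * sin (pi * b))); last exact: continuous_sin.
  by cfun.
- exact: integrable_oneDsqrV.
- move=> x; rewrite /= in_itv/= => /andP[x0 xy].
  by apply: aeW => u; rewrite /= in_itv/= andbT => u0; apply: hK => //; exact: yy1.
- by rewrite inE/= in_itv/= y0 ltrDl ltr01.
Qed.

Variables (y1 y2 : R).
Hypothesis y1_ge0 : 0 <= y1.
Hypothesis y12 : y1 < y2.

Let y2_gt0 : 0 < y2. Proof. exact: le_lt_trans y12. Qed.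

(** Closed on the left and open on the right, so that c |-> [band (c - z)] is right-continuous. *)
Definition band (y : R) : R := (y1 <= y < y2)%R%:R.

Lemma bandE : band = (\1_(`[y1, y2[%classic : set R) : R -> R).
Proof.
apply/funext => y; rewrite indicE; congr (nat_of_bool _)%:R.
by apply/idP/idP; rewrite inE/= in_itv.
Qed.

Lemma band_bounded : bounded_nonneg 1 band.
Proof.
split; first by rewrite bandE; exact: measurable_indic.
by move=> y; rewrite /band; case: (_ <= _ < _); rewrite ?lexx ?ler01.
Qed.

Lemma band_lt0 y : y < 0 -> band y = 0.
Proof.
by move=> y0; rewrite /band leNgt (lt_le_trans y0)// .
Qed.

Variable K : R -> R.
Let U n c := iter (2 ^ n)%N (killed_step P (zeta n) (-1)) band c.
Hypothesis UK : forall c, 0 < c -> U n c @[n --> \oo] --> K c.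
Hypothesis mK : measurable_fun setT K.
Hypothesis Kr : K c @[c --> 1^'+] --> K 1.

Let V n th y := iter (2 ^ n)%N (killed_step P (zeta n) 1) (killed_exp th) y.

Let U_bounded n : bounded_nonneg 1 (U n).
Proof. by apply: iter_killed_step_bounded => //; exact: band_bounded. Qed.

Let V_bounded n th : 0 <= th -> bounded_nonneg 1 (V n th).
Proof. by move=> th0; apply: iter_killed_step_bounded => //; exact: killed_exp_bounded. Qed.

Let cst_integrable (C : R) : mu.-integrable `]y1, y2[ (EFin \o (fun=> C)).
Proof.
apply: measurable_bounded_integrable => //.
  by rewrite /= lebesgue_measure_itv/= lte_fin y12 -EFinB ltry.
by exists `|C|; split=> [|M CM x _]; [exact: num_real|exact: ltW].
Qed.

(** Duality turns the transform in the level c, with the final position in the band, into an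
    integral over starting points y in the band, for which [killed_exp_limit] gives the limit. *)
Let UV n th : 0 < th ->
  \int[mu]_(c in `]0, +oo[) (expR (- (th * c)) * U n c) =
  \int[mu]_(y in `]y1, y2[) V n th y.
Proof.
move=> th0.
have bk := killed_exp_bounded (ltW th0).
have [mU _] := U_bounded n.
have [mV _] := V_bounded n (ltW th0).
have k0 y : y < 0 -> killed_exp th y = 0 by move=> y0; rewrite /killed_exp leNgt y0 mul0r.
have := killed_step_duality P (mzeta n) (2 ^ n) band_bounded bk band_lt0 k0.
move=> /(congr1 fine) H.
have iU : mu.-integrable `]0, +oo[ (EFin \o (fun c => expR (- (th * c)) * U n c)).
  have [K2 K20 hK2] := expR_decay th0.
  apply: integrable_le (integrable_oneDsqrV K2) => //; first by apply: measurable_funM; [mfun|].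
  move=> c; rewrite /= in_itv/= andbT => c0; have [_ /(_ c)/andP[h1 h2]] := U_bounded n.
  rewrite normrM (ger0_norm (expR_ge0 _)) (ger0_norm h1).
  by apply: le_trans (hK2 _ (ltW c0)); rewrite -[leRHS]mulr1 ler_wpM2l// expR_ge0.
have iV : mu.-integrable `]y1, y2[ (EFin \o V n th).
  apply: integrable_le (cst_integrable 1) => // y _.
  by have [_ /(_ y)/andP[v0 v1]] := V_bounded n (ltW th0); rewrite ger0_norm.
rewrite (Rintegral_itv_obnd_cbnd iU) (Rintegral_itv_obnd_cbnd iV).
rewrite Rintegral_mkcond [RHS]Rintegral_mkcond.
transitivity (\int[mu]_c (killed_exp th c * U n c)).
  apply: eq_Rintegral => c _; rewrite patchE /killed_exp.
  case: ifPn; rewrite ?inE ?notin_setE/= in_itv/= andbT; first by move=> ->; rewrite mul1r.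
  by move=> /negP/negbTE ->; rewrite !mul0r.
transitivity (\int[mu]_y (band y * V n th y)); first exact: H.
apply: eq_Rintegral => y _; rewrite patchE /band.
case: ifPn; rewrite ?inE ?notin_setE/= in_itv/=; first by move=> ->; rewrite mul1r.
by move=> /negP/negbTE ->; rewrite mul0r.
Qed.

Let w u := pi^-1 * (expR (- (u * t)) * \int[mu]_(y in `]y1, y2[) stable_kernel b y u).

Let kernel_integrable u : 0 < u ->
  mu.-integrable `]y1, y2[ (EFin \o (fun y => stable_kernel b y u)).
Proof.
move=> u0; apply: integrable_le (cst_integrable (expR (y2 * (u + 1) `^ b))) => //.
  by rewrite /stable_kernel; mfun.
move=> y; rewrite /= in_itv/= => /andP[y1y yy2]; apply: stable_kernel_le => //; last exact: ltW.
by rewrite (ltW yy2) (le_trans y1_ge0)// ltW.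
Qed.

(** Serves twice: with g u = 1 / (u + th^a) for the transform of K, and with g u = E_(a, a)(- u) for
    the conclusion. *)
Let fubini_kernel (g : R -> R) C : measurable_fun setT g -> 0 <= C ->
  (forall u, 0 < u -> `|g u| <= expR (C * (u + 1) `^ b)) ->
  \int[mu]_(y in `]y1, y2[) (pi^-1 * \int[mu]_(u in `]0, +oo[)
     (expR (- (u * t)) * stable_kernel b y u * g u)) =
  \int[mu]_(u in `]0, +oo[) (w u * g u).
Proof.
move=> mg C0 hg; have Y0 : 0 <= y2 + C by rewrite addr_ge0// ltW.
have [K2 K20 hK] := expR_powR_decay t0 Y0 b01.
have pV : 0 <= pi^-1 :> R by rewrite invr_ge0 ltW.
have bound y u : y1 < y < y2 -> 0 < u ->
    `|expR (- (u * t)) * stable_kernel b y u * g u| <= K2 / oneDsqr u.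
  move=> /andP[y1y yy2] u0; apply: le_trans (hK _ (ltW u0)).
  have -> : expR (- (t * u) + (y2 + C) * (u + 1) `^ b) =
      expR (- (u * t)) * expR (y2 * (u + 1) `^ b) * expR (C * (u + 1) `^ b).
    by rewrite -!expRD; congr expR; ring.
  rewrite normrM; apply: ler_pM => //; last exact: hg.
  rewrite normrM (ger0_norm (expR_ge0 _)) ler_wpM2l ?expR_ge0//.
  apply: stable_kernel_le => //; last exact: ltW.
  by rewrite (ltW yy2) (le_trans y1_ge0)// ltW.
have mG : measurable_fun setT (fun z : R * R =>
    pi^-1 * (expR (- (z.2 * t)) * stable_kernel b z.1 z.2 * g z.2)).
  apply: measurable_funM => //; apply: measurable_funM.
    by apply: measurable_funM; [mfun|exact: measurable_stable_kernel].
  exact: (measurableT_comp mg measurable_snd).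
transitivity (\int[mu]_(y in `]y1, y2[) \int[mu]_(u in `]0, +oo[)
    (pi^-1 * (expR (- (u * t)) * stable_kernel b y u * g u))).
  apply: eq_Rintegral => y; rewrite inE/= in_itv/= => yy; rewrite RintegralZl//.
  apply: integrable_le (integrable_oneDsqrV K2) => //.
    by apply: measurable_funM => //; rewrite /stable_kernel; mfun.
  by move=> u; rewrite /= in_itv/= andbT => u0; exact: bound.
rewrite (@Rfubini _ _ _ _ _ mu mu _ _ (measurable_itv _) (measurable_itv _)
  (fun y u => pi^-1 * (expR (- (u * t)) * stable_kernel b y u * g u))
  (fun=> pi^-1) (fun u => K2 / oneDsqr u)) => //.
- apply: eq_Rintegral => u; rewrite inE/= in_itv/= andbT => u0.
  transitivity (\int[mu]_(y in `]y1, y2[) (pi^-1 * expR (- (u * t)) * g u * stable_kernel b y u)).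
    by apply: eq_Rintegral => y _; ring.
  by rewrite RintegralZl//; [rewrite /w; ring|exact: kernel_integrable].
- exact: integrable_oneDsqrV.
- move=> y u; rewrite /= !in_itv/= andbT => yy u0.
  by rewrite normrM (ger0_norm pV) ler_wpM2l// bound.
Qed.

(** [laplace_inversion] for [K] with the weight [w], the kernel integrated over the band. The
    identity of transforms that it requires is the limit of [UV], by dominated convergence on both
    sides. *)
Lemma killed_band_integral : K 1 = \int[mu]_(y in `]y1, y2[) killed_stable_density y.
Proof.
have mw : measurable_fun setT w.
  apply: measurable_funM => //; apply: measurable_funM; first by mfun.
  apply: (@measurable_Rintegral _ _ _ _ _ mu _ (fun u y => stable_kernel b y u)) => //.
  by rewrite /stable_kernel; mfun.
have wB u : 0 < u -> `|w u| <= pi^-1 * (y2 - y1) * expR (- (t * u) + y2 * (u + 1) `^ b).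
  move=> u0; rewrite /w !normrM (gtr0_norm (_ : 0 < pi^-1)) ?invr_gt0//.
  rewrite (ger0_norm (expR_ge0 _)) -mulrA ler_pM2l ?invr_gt0// expRD (mulrC u) mulrCA.
  rewrite ler_pM2l ?expR_gt0//.
  rewrite (_ : (y2 - y1) * _ = \int[mu]_(y in `]y1, y2[) expR (y2 * (u + 1) `^ b)); last first.
    rewrite Rintegral_cst//= lebesgue_measure_itv/= lte_fin y12 -EFinB/=.
    by rewrite mulrC.
  apply: Rintegral_norm_le => //.
    by rewrite /stable_kernel; mfun.
  move=> y; rewrite /= in_itv/= => /andP[y1y yy2]; apply: stable_kernel_le => //; last exact: ltW.
  by rewrite (ltW yy2) (le_trans y1_ge0)// ltW.
have Un1 n c : 0 <= U n c <= 1 by case: (U_bounded n) => _; apply.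
have K1 c : 0 < c -> `|K c| <= 1.
  move=> c0; have cv : `|U n c| @[n --> \oo] --> `|K c| by apply: cvg_norm; exact: UK.
  rewrite -(cvg_lim (@Rhausdorff _) cv); apply: limr_le; first exact: cvgP cv.
  by near=> n; have /andP[h1 h2] := Un1 n c; rewrite ger0_norm.
have LK th : 1 <= th ->
    \int[mu]_(c in `]0, +oo[) (expR (- (th * c)) * K c) =
    \int[mu]_(u in `]0, +oo[) (w u / (u + th `^ a)).
  move=> th1; have th0 : 0 < th := lt_le_trans ltr01 th1.
  have [K2 K20 hK2] := expR_decay th0.
  have mN : measurable_fun setT (fun y => pi^-1 * \int[mu]_(u in `]0, +oo[)
      (expR (- (u * t)) * stable_kernel b y u / (u + th `^ a))).
    apply: measurable_funM => //.
    apply: (@measurable_Rintegral _ _ _ _ _ mu _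
      (fun y u => expR (- (u * t)) * stable_kernel b y u / (u + th `^ a))) => //.
    by apply: measurable_funM; [apply: measurable_funM;
      [mfun|exact: measurable_stable_kernel]|mfun].
  have mU n : measurable_fun setT (fun c => expR (- (th * c)) * U n c).
    by apply: measurable_funM; [mfun|case: (U_bounded n)].
  have mK' : measurable_fun setT (fun c => expR (- (th * c)) * K c).
    by apply: measurable_funM; [mfun|exact: mK].
  have mV n : measurable_fun setT (V n th) by case: (V_bounded n (ltW th0)).
  have [|||_ c1] := @Rdominated_cvg _ _ _ mu `]0, +oo[%classic (measurable_itv _)
    (fun n c => expR (- (th * c)) * U n c) _ (fun c => K2 / oneDsqr c) mU mK'.
  - move=> c; rewrite /= in_itv/= andbT => c0.
    by apply: cvgM; [exact: cvg_cst|exact: UK].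
  - move=> n c; rewrite /= in_itv/= andbT => c0.
    have /andP[h1 h2] := Un1 n c.
    rewrite normrM (ger0_norm (expR_ge0 _)) (ger0_norm h1).
    by apply: le_trans (hK2 _ (ltW c0)); rewrite -[leRHS]mulr1 ler_wpM2l// expR_ge0.
  - exact: integrable_oneDsqrV.
  have [|||_ c2] := @Rdominated_cvg _ _ _ mu `]y1, y2[%classic (measurable_itv _)
    (fun n => V n th) _ (fun=> 1) mV mN.
  - move=> y; rewrite /= in_itv/= => /andP[y1y _].
    by apply: (killed_exp_limit a1 a2 t0 mzeta zeta_integrable zeta_laplace) => //; exact: le_lt_trans y1y.
  - move=> n y _; have [_ /(_ y)/andP[v0 v1]] := V_bounded n (ltW th0).
    by rewrite ger0_norm.
  - exact: cst_integrable.
  have c12 : (fun n => \int[mu]_(c in `]0, +oo[) (expR (- (th * c)) * U n c)) =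
      (fun n => \int[mu]_(y in `]y1, y2[) V n th y).
    by apply/funext => n; exact: UV.
  rewrite c12 in c1; rewrite -(cvg_lim (@Rhausdorff _) c1) (cvg_lim (@Rhausdorff _) c2).
  have tha : 1 <= th `^ a.
    have p1a : 1 `^ a = 1 :> R by rewrite powR1.
    by rewrite -[leLHS]p1a ge0_ler_powR ?nnegrE ?(ltW th0)// ltW.
  apply: (@fubini_kernel (fun u => (u + th `^ a)^-1) 1) => //; first by mfun.
  move=> u u0; have ua : 1 <= u + th `^ a by rewrite (le_trans tha)// lerDr ltW.
  rewrite normfV gtr0_norm ?(lt_le_trans ltr01 ua)//.
  apply: (@le_trans _ _ 1); first by rewrite invf_le1// (lt_le_trans ltr01 ua).
  by rewrite -[leLHS]expR0 ler_expR mul1r powR_ge0.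
have B0 : 0 <= pi^-1 * (y2 - y1).
  by rewrite mulr_ge0 ?invr_ge0 ?(ltW pi0)// subr_ge0 ltW.
rewrite (laplace_inversion a1 t0 B0 (ltW y2_gt0) mw wB mK K1 LK Kr).
by rewrite -(@fubini_kernel ml 2)//; exact: ml_le.
Unshelve. all: by end_near. Qed.

End killed_density_integral.

(** * The killed process *)

Lemma dyadic_exceeds (R : realType) (Z : R -> R) (c s t : R) :
  (forall u, 0 <= u -> Z v @[v --> u^'+] --> Z u) ->
  0 <= s -> s < t -> c < Z s ->
  \forall n \near \oo, exists2 k, (k < 2 ^ n)%N & c < Z (k%:R * (t / 2 ^+ n)).
Proof.
move=> Zr s0 st cZ; have t0 : 0 < t := le_lt_trans s0 st.
have e0 : 0 < Z s - c by rewrite subr_gt0.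
have /cvgrPdist_lt/(_ _ e0)/nbhs_ballP[r /= r0 hr] := Zr s s0.
have r0' : 0 < Num.min r (t - s) by rewrite lt_min r0 subr_gt0.
have : t / 2 ^+ n @[n --> \oo] --> (0 : R).
  rewrite -[X in _ --> X](mulr0 t); apply: cvgM; first exact: cvg_cst.
  under eq_fun do rewrite -exprVn.
  by apply: cvg_expr; rewrite ger0_norm ?invr_ge0// invf_lt1// ltr1n.
move=> /cvgrPdist_lt/(_ _ r0'); apply: filterS => n.
set del := t / 2 ^+ n; have del0 : 0 < del by rewrite divr_gt0// exprn_gt0.
rewrite sub0r normrN gtr0_norm// lt_min => /andP[dr ds].
(* The first grid point strictly after s is within one mesh of s, hence before t and in the right
   neighbourhood where Z exceeds c. *)
have k1 : s < (Num.truncn (s / del)).+1%:R * del by rewrite -ltr_pdivrMr// truncnS_gt.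
have sd0 : 0 <= s / del by rewrite divr_ge0// ltW.
have k2 : (Num.truncn (s / del)).+1%:R * del <= s + del.
  rewrite -natr1 mulrDl mul1r lerD2r -ler_pdivlMr//.
  by have /andP[] := truncn_itv sd0.
exists (Num.truncn (s / del)).+1.
  rewrite -(ltr_nat R) natrX -(ltr_pM2r del0).
  have -> : 2 ^+ n * del = t by rewrite /del; field; rewrite expf_neq0.
  by rewrite (le_lt_trans k2)// -ltrBrDl.
have : `|Z s - Z ((Num.truncn (s / del)).+1%:R * del)| < Z s - c.
  apply: (hr _ _ k1); rewrite /ball/= distrC gtr0_norm ?subr_gt0//.
  by rewrite ltrBlDl (le_lt_trans k2)// ltrD2l.
by move/(le_lt_trans (ler_norm _)); set z := Z (_ * _); lra.
Qed.

Lemma measurable_forall_le d (T : measurableType d) (R : realType)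
    (Z : R -> T -> R) (c t : R) : 0 < t ->
  (forall s, measurable_fun setT (Z s)) ->
  (forall w u, 0 <= u -> Z v w @[v --> u^'+] --> Z u w) ->
  measurable [set w | forall s, 0 <= s <= t -> Z s w <= c].
Proof.
move=> t0 mZ Zr.
have mle s : measurable (Z s @^-1` `]-oo, c]).
  by rewrite -[X in measurable X]setTI; exact: mZ.
(* The grids stop strictly before t, so [Z t] is tested separately. *)
rewrite (_ : [set w | _] = (Z t @^-1` `]-oo, c]) `&`
  \bigcap_n \bigcap_(k in [set k | (k < 2 ^ n)%N]) (Z (k%:R * (t / 2 ^+ n)) @^-1` `]-oo, c])).
  apply: measurableI => //; apply: bigcap_measurableType => n _.
  by apply: bigcap_measurableType => k _.
apply/seteqP; split => w /=.
  move=> all_le; split; first by rewrite in_itv/= all_le// lexx ltW.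
  move=> n _ k /= kn; rewrite in_itv/=; apply: all_le.
  rewrite mulr_ge0 ?divr_ge0 ?exprn_ge0 ?(ltW t0)//= mulrCA ler_piMr ?(ltW t0)//.
  by rewrite ler_pdivrMr ?exprn_gt0// mul1r -natrX ler_nat ltnW.
rewrite in_itv/= => -[Zt dyadic] s /andP[s0]; rewrite le_eqVlt => /predU1P[->//|st].
rewrite leNgt; apply/negP => cZ.
have [n _ /(_ n (leqnn n))[k kn]] := dyadic_exceeds (Zr w) s0 st cZ.
by have := dyadic n I k kn; rewrite /= in_itv/= => h1 h2; have := lt_le_trans h2 h1; rewrite ltxx.
Qed.

Lemma probability_setI1 d (T : measurableType d) (R : realType) (P : probability T R)
    (A N : set T) : measurable A -> measurable N -> P N = 1%E -> P (A `&` N) = P A.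
Proof.
move=> mA mN PN.
have PNC : P (~` N) = 0%E by rewrite probability_setC// PN subee.
have mNC : measurable (~` N) by exact: measurableC.
have mAN : measurable (A `&` N) by exact: measurableI.
have mANC : measurable (A `&` ~` N) by exact: measurableI.
have PA : P (A `&` ~` N) = 0%E by exact: (subset_measure0 _ _ _ PNC).
have dis : A `&` N `&` (A `&` ~` N) = set0 by rewrite setIACA setICr setI0.
have AE : A = (A `&` N) `|` (A `&` ~` N) by rewrite -setIUr setUv setIT.
have -> : P A = (P (A `&` N) + P (A `&` ~` N))%E by rewrite {1}AE measureU.
by rewrite PA adde0.
Qed.

(** * From the skeletons to the process *)

Section levy_band.
Context d (T : measurableType d) (R : realType) (P : probability T R).
Notation mu := (@lebesgue_measure R).
Variables (a t : R) (X : R -> {RV P >-> R}).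
Hypothesis a1 : 1 < a.
Hypothesis a2 : a < 2.
Hypothesis t0 : 0 < t.
Hypothesis levyX : levy_process X.
Hypothesis laplaceX : forall t q : R, 0 < t -> 0 <= q ->
  ('E_P[fun w => expR (- q * X t w)%R] = (expR (t * q `^ a))%:E)%E.

Let del n := t / 2 ^+ n.
Let zeta n w := X (del n) w.
Let xi n i w := X (i.+1%:R * del n) w - X (i%:R * del n) w.
(** X 0 = 0 holds only almost surely, whereas the walk starts exactly at the level; [Y] starts at 0
    for every w. *)
Let Y s w := X s w - X 0 w.

Let del0 n : 0 < del n. Proof. by rewrite divr_gt0// exprn_gt0. Qed.

Let mX s : measurable_fun setT (X s : T -> R).
Proof. exact: measurable_funP. Qed.

Let mzeta n : measurable_fun setT (zeta n). Proof. exact: mX. Qed.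

Let mxi n i : measurable_fun setT (xi n i).
Proof. by apply: measurable_funB; exact: mX. Qed.

Let mY s : measurable_fun setT (Y s).
Proof. by apply: measurable_funB; exact: mX. Qed.

Let zeta_laplace_ereal n th : 0 <= th ->
  (\int[P]_w (expR (- (th * zeta n w)))%:E = (expR (del n * th `^ a))%:E)%E.
Proof.
move=> th0; rewrite -laplaceX// unlock; apply: eq_integral => w _.
by rewrite mulNr.
Qed.

Let zeta_integrable n th : 0 <= th ->
  P.-integrable setT (EFin \o (fun w => expR (- (th * zeta n w)))).
Proof.
move=> th0; apply/integrableP; split.
  by apply/measurable_EFinP; mfun.
under eq_integral => w _ do rewrite /= ger0_norm ?expR_ge0//.
by rewrite zeta_laplace_ereal// ltry.
Qed.

Let zeta_laplace n th : 0 <= th ->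
  \int[P]_w expR (- (th * zeta n w)) = expR (t / 2 ^+ n * th `^ a).
Proof. by move=> th0; rewrite /Rintegral zeta_laplace_ereal. Qed.

Let xi_independent n m (A : nat -> set R) : (forall i, measurable (A i)) ->
  P [set w | forall i, (i < m)%N -> A i (xi n i w)] =
  (\prod_(i < m) P [set w | A i (xi n i w)])%E.
Proof.
move=> mA; have [_ ind _ _] := levyX.
apply: (ind m (fun i => i%:R * del n)) => //; first by rewrite mul0r.
by move=> i; rewrite ler_pM2r// ler_nat.
Qed.

Let xi_law n i A : measurable A ->
  P [set w | A (xi n i w)] = P [set w | A (zeta n w)].
Proof.
move=> mA; have [_ _ st _] := levyX.
have s0 : 0 <= i%:R * del n by rewrite mulr_ge0// ltW.
rewrite -(st _ _ A s0 (ltW (del0 n)) mA).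
by rewrite /xi -natr1 mulrDl mul1r.
Qed.

Let walkE n c k w : walk (xi n) c k w = c - Y (k%:R * del n) w.
Proof.
have X0 : X 0 w = X (0%:R * del n) w by rewrite mul0r.
rewrite /walk; congr (c - _); rewrite /Y X0.
have := telescope_sumr (fun i => X (i%:R * del n) w) (leq0n k).
by rewrite big_mkord.
Qed.

Variables (y1 y2 : R).
Hypothesis y1_ge0 : 0 <= y1.
Hypothesis y12 : y1 < y2.

Let phi := band y1 y2.

Let below c w := `[< forall s, 0 <= s <= t -> Y s w <= c >].
Let g c w := phi (c - Y t w) * (below c w)%:R.
Let K c := \int[P]_w g c w.

Let surv n c w := \1_(survival (xi n) c (2 ^ n)) w * phi (c - Y t w).

Let msurv n c : measurable_fun setT (surv n c).
Proof.
apply: measurable_funM.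
  by apply: measurable_indic; exact: measurable_survival.
have [mphi _] := band_bounded y1 y2.
by apply: (measurableT_comp mphi); apply: measurable_funB => //; exact: mY.
Qed.

Let surv_bounds n c w : 0 <= surv n c w <= 1.
Proof.
have [_ /(_ (c - Y t w))/andP[h1 h2]] := band_bounded y1 y2.
rewrite /surv indicE; case: (_ \in _); last by rewrite mul0r lexx ler01.
by rewrite mul1r h1.
Qed.

Let survE n c : iter (2 ^ n)%N (killed_step P (zeta n) (-1)) phi c = \int[P]_w surv n c w.
Proof.
have := killed_walk_integral (mxi n) (mzeta n) (@xi_independent n) (@xi_law n) c (2 ^ n)
  (band_bounded y1 y2) (@band_lt0 _ y1 y2 y1_ge0).
move=> /(congr1 fine)/= <-; rewrite /Rintegral; congr fine.
rewrite [LHS]integral_mkcond; apply: eq_integral => w _.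
rewrite patchE /surv indicE walkE (_ : (2 ^ n)%N%:R * del n = t); last first.
  by rewrite /del natrX; field; rewrite expf_neq0.
by case: ifP => _; rewrite ?mul1r ?mul0r.
Qed.

Let Y_right s w : 0 <= s -> Y u w @[u --> s^'+] --> Y s w.
Proof.
move=> s0; have [_ _ _ /(_ w)[rc _]] := levyX.
by apply: cvgB; [exact: rc|exact: cvg_cst].
Qed.

(** If the final position is outside the band, both sides are 0. Otherwise Y t <= c, so a passage
    above c happens strictly before t, and fine grids detect it by right-continuity. *)
Let surv_cvg c w : surv n c w @[n --> \oo] --> g c w.
Proof.
rewrite /surv /g; have [phi0|phi0] := eqVneq (phi (c - Y t w)) 0.
  by rewrite phi0 mul0r; under eq_fun do rewrite mulr0; exact: cvg_cst.
have Yt : Y t w <= c.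
  rewrite -subr_ge0 leNgt; apply/negP => h.
  by move: phi0; rewrite /phi band_lt0// eqxx.
rewrite mulrC; apply: cvgM; last exact: cvg_cst.
apply: cvg_near_cst; rewrite /below.
have kt n k : (k < 2 ^ n)%N -> 0 <= k%:R * del n <= t.
  move=> kn; rewrite mulr_ge0 ?(ltW (del0 n))//= /del mulrCA ler_piMr ?(ltW t0)//.
  by rewrite ler_pdivrMr ?exprn_gt0// mul1r -natrX ler_nat ltnW.
case: asboolP => [all_le|/existsNP[s /not_implyP[/andP[s0 st] /negP]]].
  apply: nearW => n; have sv : survival (xi n) c (2 ^ n) w.
    by move=> k kn; rewrite walkE subr_ge0; apply: all_le; exact: kt.
  by rewrite indicE mem_set.
rewrite -ltNge => cY.
have st' : s < t.
  by rewrite lt_neqAle st andbT; apply/eqP => e; move: cY; rewrite e ltNge Yt.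
have := dyadic_exceeds (fun u u0 => @Y_right u w u0) s0 st' cY.
apply: filterS => n [k kn cYk].
have sv : ~ survival (xi n) c (2 ^ n) w.
  by move=> sv; have := sv k kn; rewrite walkE subr_ge0 leNgt cYk.
by rewrite indicE memNset.
Qed.

Let mg c : measurable_fun setT (g c).
Proof.
apply: (@measurable_fun_cvg _ _ _ setT (surv ^~ c)).
  by move=> n; exact: msurv.
by move=> w _; exact: surv_cvg.
Qed.

Let g_bounds c w : 0 <= g c w <= 1.
Proof.
have [_ /(_ (c - Y t w))/andP[h1 h2]] := band_bounded y1 y2.
by rewrite /g; case: below; rewrite ?mulr1 ?mulr0 ?h1// lexx ler01.
Qed.

Let one_integrable : P.-integrable setT (EFin \o (fun=> 1 : R)).
Proof.
apply: (@probability_bounded_integrable _ _ _ P 1) => // w.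
by rewrite normr1.
Qed.

Let UK c :
  iter (2 ^ n)%N (killed_step P (zeta n) (-1)) phi c @[n --> \oo] --> K c.
Proof.
under eq_fun do rewrite survE.
have [|||_ cv] := @Rdominated_cvg _ _ _ P setT measurableT
  (surv ^~ c) (g c) (fun=> 1) (msurv ^~ c) (mg c) => //.
  by move=> n w _; have /andP[h1 h2] := surv_bounds n c w; rewrite ger0_norm.
Qed.

Let mK : measurable_fun setT K.
Proof.
have mU n : measurable_fun setT (fun c => iter (2 ^ n)%N (killed_step P (zeta n) (-1)) phi c).
  by case: (iter_killed_step_bounded P (mzeta n) (-1) (2 ^ n) (band_bounded y1 y2)).
exact: (measurable_fun_cvg mU (fun c _ => @UK c)).
Qed.

Let phi_right w : \forall c \near 1^'+, phi (c - Y t w) = phi (1 - Y t w).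
Proof.
rewrite /phi /band; case: (ltP (1 - Y t w) y1) => [h|h] /=.
  near=> c; have c1 : c < y1 + Y t w.
    by near: c; apply: nbhs_right_lt; rewrite -ltrBlDr.
  by rewrite leNgt ltrBlDr c1.
have [h2|h2] := ltP (1 - Y t w) y2; near=> c.
  have c1 : c < y2 + Y t w.
    by near: c; apply: nbhs_right_lt; rewrite -ltrBlDr.
  by rewrite ltrBlDr c1 (le_trans h)// lerD2r ltW.
have c1 : 1 < c by [].
by rewrite [X in _ && X]ltNge (le_trans h2) ?andbF// lerD2r ltW.
Unshelve. all: by end_near. Qed.

Let below_right w : \forall c \near 1^'+, below c w = below 1 w.
Proof.
have [all_le|] := pselect (forall s, 0 <= s <= t -> Y s w <= 1).
  have -> : below 1 w = true by apply/asboolP.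
  near=> c; apply/asboolP => s st; rewrite (le_trans (all_le s st))// ltW//.
move=> nall; have -> : below 1 w = false by apply/asboolPn.
move/existsNP : nall => [s /not_implyP[s0t /negP]].
rewrite -ltNge => cY; near=> c; apply/negbTE/asboolPn => /(_ s s0t); apply/negP.
rewrite -ltNge; near: c; exact: nbhs_right_lt.
Unshelve. all: by end_near. Qed.

Let g_right w : g c w @[c --> 1^'+] --> g 1 w.
Proof.
apply: cvg_near_cst; apply: filterS2 (phi_right w) (below_right w) => c h1 h2.
by rewrite /g h1 h2.
Qed.

Let Kr : K c @[c --> 1^'+] --> K 1.
Proof.
apply/cvg_at_rightP => u [u1 cu].
have [|||_ cv] := @Rdominated_cvg _ _ _ P setT measurableT
  (fun n => g (u n)) (g 1) (fun=> 1) (fun n => mg (u n)) (mg 1) => //.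
- by move=> w _; have /cvg_at_rightP h := @g_right w; exact: h.
- by move=> n w _; have /andP[h1 h2] := g_bounds (u n) w; rewrite ger0_norm.
Qed.

Let X_right w u : 0 <= u -> X v w @[v --> u^'+] --> X u w.
Proof. by move=> u0; have [_ _ _ /(_ w)[rc _]] := levyX; exact: rc. Qed.

Lemma running_sup_leP c w :
  (running_sup X t w <= c%:E)%E <-> forall s, 0 <= s <= t -> X s w <= c.
Proof.
split=> [h s st|h].
  rewrite -lee_fin; apply: le_trans h; apply: ereal_sup_ubound.
  by exists s => //; rewrite /= in_itv.
apply: ge_ereal_sup => _ [s st <-]; rewrite lee_fin h//.
Qed.

Lemma measurable_running_sup_le c :
  measurable [set w | (running_sup X t w <= c%:E)%E].
Proof.
rewrite (_ : [set w | _] = [set w | forall s, 0 <= s <= t -> X s w <= c]).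
  by apply: measurable_forall_le => //; exact: X_right.
by apply/seteqP; split => w /running_sup_leP.
Qed.

(** [K 1] is expressed with [Y]; the two events agree where X 0 = 0, a set of full probability. The
    half-open interval is the image of [y1, y2[ under y |-> 1 - y. *)
Lemma killed_probability_band :
  P [set w | `](1 - y2), (1 - y1)]%classic (X t w) /\ (running_sup X t w <= 1%:E)%E] =
  (\int[mu]_(y in `]y1, y2[) killed_stable_density a t y)%:E.
Proof.
rewrite -(killed_band_integral a1 a2 t0 mzeta zeta_integrable zeta_laplace
  y1_ge0 y12 (fun c _ => @UK c) mK Kr).
set E := [set w | _].
have mE : measurable E.
  apply: (@measurableI _ _ (X t @^-1` `](1 - y2), (1 - y1)]) [set w | (running_sup X t w <= 1%:E)%E]).
    by rewrite -[X in measurable X]setTI; exact: mX.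
  exact: measurable_running_sup_le.
pose E' : set T := [set w | `](1 - y2), (1 - y1)]%classic (Y t w) /\ forall s, 0 <= s <= t -> Y s w <= 1].
have mE' : measurable E'.
  apply: (@measurableI _ _ (Y t @^-1` `](1 - y2), (1 - y1)]) [set w | forall s, 0 <= s <= t -> Y s w <= 1]).
    by rewrite -[X in measurable X]setTI; exact: mY.
  by apply: measurable_forall_le => // w u; exact: Y_right.
pose N : set T := [set w | X 0 w = 0].
have mN : measurable N.
  by have := mX 0 measurableT (measurable_set1 0); rewrite setTI.
have PN : P N = 1%E by case: levyX.
have EE' : E `&` N = E' `&` N.
  apply/seteqP; split => w /= [[h1 h2] X0]; split => //; split.
  - by rewrite /Y X0 subr0.
  - by move=> s st; rewrite /Y X0 subr0; move/running_sup_leP : h2; apply.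
  - by move: h1; rewrite /Y X0 subr0.
  - by apply/running_sup_leP => s st; have := h2 s st; rewrite /Y X0 subr0.
rewrite -(probability_setI1 mE mN PN) EE' (probability_setI1 mE' mN PN).
rewrite /K (_ : (fun w => _) = (fun w => \1_E' w)); last first.
  apply/funext => w; rewrite /g indicE -natrM mulnb; congr (nat_of_bool _)%:R.
  apply/andP/idP => [[/andP[h1 h2] /asboolP h3]|].
    rewrite inE; split => //=; rewrite in_itv/=; apply/andP; split.
      by rewrite ltrBlDr addrC -ltrBlDr.
    by rewrite lerBrDr addrC -lerBrDr.
  rewrite inE => -[/=]; rewrite in_itv/= => /andP[h1 h2] h3; split; last exact/asboolP.
  apply/andP; split.
    by rewrite lerBrDr addrC -lerBrDr.
  by rewrite ltrBlDr addrC -ltrBlDr.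
rewrite /Rintegral integral_indic// setIT fineK//.
exact: fin_num_measure.
Qed.

End levy_band.

(** * The law on the half-line below the level *)

Section killed_law.
Context d (T : measurableType d) (R : realType) (P : probability T R).
Notation mu := (@lebesgue_measure R).
Variables (a t : R) (X : R -> {RV P >-> R}).
Hypothesis a1 : 1 < a.
Hypothesis a2 : a < 2.
Hypothesis t0 : 0 < t.
Hypothesis levyX : levy_process X.
Hypothesis laplaceX : forall t q : R, 0 < t -> 0 <= q ->
  ('E_P[fun w => expR (- q * X t w)%R] = (expR (t * q `^ a))%:E)%E.

Let f := killed_stable_density a t.

Let mf : measurable_fun setT f.
Proof. exact: measurable_killed_stable_density. Qed.

Let E : set T := [set w | (running_sup X t w <= 1%:E)%E].

Let mE : measurable E.
Proof. exact: measurable_running_sup_le. Qed.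

Let band_prob y1 y2 : 0 <= y1 -> y1 < y2 ->
  P [set w | `](1 - y2), (1 - y1)]%classic (X t w) /\ (running_sup X t w <= 1%:E)%E] =
  (\int[mu]_(y in `]y1, y2[) f y)%:E.
Proof. by move=> h1 h2; exact: killed_probability_band. Qed.

Let f_integrable y1 y2 (i1 i2 : bool) : 0 <= y1 -> y1 < y2 ->
  mu.-integrable [set` Interval (BSide i1 y1) (BSide i2 y2)] (EFin \o f).
Proof.
move=> h1 h2; have [C hC] := killed_stable_density_bounded a1 a2 t0 (le_trans h1 (ltW h2)).
apply: measurable_bounded_integrable => //.
- by rewrite /= lebesgue_measure_itv/= lte_fin h2 -EFinB ltry.
- exact: measurable_funTS.
- exists C; split=> [|M CM y]; first exact: num_real.
  move=> yy; apply: le_trans (ltW CM); apply: hC; move: yy.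
  by case: i1; case: i2; rewrite /= in_itv/= => /andP[l1 l2];
    apply/andP; split; move: h1 l1 l2; lra.
Qed.

(** The sign is invisible in the oscillating integral; it comes from the probabilities of small
    intervals and from continuity. *)
Lemma killed_stable_density_ge0 y : 0 < y -> 0 <= killed_stable_density a t y.
Proof.
move=> y0; rewrite -/f; have yr : y < y + 1 by rewrite ltrDl.
apply: (Rintegral_ge0_right_limit yr).
- exact: f_integrable (ltW y0) yr.
- move=> s /[dup] ys' /andP[ys sy].
  rewrite -Rintegral_itv_bndo_bndc; last exact: f_integrable (ltW y0) ys.
  by rewrite -lee_fin -band_prob ?measure_ge0// ltW.
- by apply: cvg_at_right_filter; exact: killed_stable_density_continuous.
Qed.

Let F (x : R) : \bar R := ((x < 1)%R%:R * f (1 - x))%:E.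

Let F_ge0 x : (0 <= F x)%E.
Proof.
rewrite lee_fin; case: ltP => x1; last by rewrite mul0r.
by rewrite mul1r killed_stable_density_ge0// subr_gt0.
Qed.

Let mF : measurable_fun setT F.
Proof.
apply/measurable_EFinP; apply: measurable_funM.
  rewrite (_ : (fun x => _) = (\1_(`]-oo, 1[%classic : set R) : R -> R)).
    exact: measurable_indic.
  apply/funext => y; rewrite indicE; congr (nat_of_bool _)%:R.
  by apply/idP/idP; rewrite inE/= in_itv/=.
by apply: (measurableT_comp mf); mfun.
Qed.

Let law A := P (X t @^-1` A `&` E).

Let mXA A : measurable A -> measurable (X t @^-1` A).
Proof.
by move=> mA; rewrite -[X in measurable X]setTI; exact: (measurable_funP (X t)).
Qed.

Let E_le1 w : E w -> X t w <= 1.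
Proof. by move=> /running_sup_leP; apply; rewrite lexx ltW. Qed.

Let law_interval p q : law `]p, q] = (\int[mu]_(x in `]p, q]) F x)%E.
Proof.
have [pq|qp] := ltP p q; last first.
  by rewrite set_itv_ge ?bnd_simp -?leNgt// integral_set0 /law preimage_set0 set0I measure0.
have [p1|p1] := leP 1 p.
  rewrite integral0_eq; last first.
    move=> x /=; rewrite in_itv/= => /andP[px _]; rewrite /F ltNge.
    by rewrite (le_trans p1 (ltW px)) mul0r.
  rewrite /law (_ : _ `&` _ = set0) ?measure0//.
  apply/seteqP; split => w //= -[]; rewrite in_itv/= => /andP[pX _] /E_le1.
  by rewrite leNgt (le_lt_trans p1 pX).
(* On [E] the final position is at most 1, so the interval may be cut at 1, which makes the bound 1
   - q0 of the band nonnegative. *)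
pose q0 := Num.min q 1.
have y1 : 0 <= 1 - q0 by rewrite subr_ge0 ge_min lexx orbT.
have y12 : 1 - q0 < 1 - p by rewrite ltrD2l ltrN2 lt_min pq.
have -> : law `]p, q] = P [set w | `](1 - (1 - p)), (1 - (1 - q0))]%classic (X t w) /\
    (running_sup X t w <= 1%:E)%E].
  rewrite /law !subKr; congr (P _); apply/seteqP; split => w /=; rewrite !in_itv/=.
    by move=> [/andP[-> Xq] Ew]; split => //; rewrite le_min Xq; exact: E_le1.
  by move=> [/andP[-> Xq] Ew]; split => //; rewrite (le_trans Xq)// ge_min lexx.
rewrite band_prob//.
pose G := F \_ `]p, q].
have G0 x : (0 <= G x)%E by rewrite /G patchE; case: ifP => // _; exact: F_ge0.
have mG : measurable_fun setT G by apply/(measurable_restrictT _ _).1 => //; exact: measurable_funTS.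
rewrite integral_mkcond -/G -(ge0_integral_reflection 1 mG G0).
have mGr : measurable_fun setT (fun y : R => G (1 - y)%R).
  by apply: (measurableT_comp mG); mfun.
transitivity (\int[mu]_(y in `[(1 - q0)%R, (1 - p)%R[) G (1 - y)%R)%E; last first.
  rewrite integral_mkcond; apply: eq_integral => y _; rewrite patchE.
  case: ifPn => //; rewrite notin_setE/= in_itv/= => /negP h.
  rewrite /G patchE; case: ifPn => //; rewrite inE/= in_itv/= => /andP[h1 h2].
  rewrite /F; case: ltP; last by rewrite mul0r.
  move=> h3; exfalso; move: h; rewrite -[_ && _]negbK => /negPn; apply/negP; rewrite negbK.
  apply/andP; split; last by rewrite ltrBrDl -ltrBrDr.
  by rewrite lerBlDr -lerBlDl le_min h2 ltW.
rewrite -integral_itv_obnd_cbnd; last exact: measurable_funTS.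
have yy y : 1 - q0 < y -> y < 1 - p -> G (1 - y) = (f y)%:E.
  move=> h1 h2; have : 1 - y < q0 by rewrite ltrBlDr -ltrBlDl.
  rewrite lt_min => /andP[h3 h4].
  rewrite /G patchE ifT; first by rewrite /F h4 mul1r subKr.
  by rewrite inE/= in_itv/= (ltW h3) andbT ltrBrDr -ltrBrDl.
transitivity (\int[mu]_(y in `](1 - q0)%R, (1 - p)%R[) (f y)%:E)%E.
  rewrite /Rintegral fineK//.
  exact: (integrable_fin_num _ (f_integrable false true y1 y12)).
by apply: eq_integral => y; rewrite inE/= in_itv/= => /andP[h1 h2]; rewrite yy.
Qed.

Let Eoo : (P E < +oo)%E.
Proof. by rewrite (le_lt_trans (probability_le1 _ mE))// ltry. Qed.

(** Both sides are measures on the line, finite on each ]-n, n], and by [law_interval] they agree on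
    half-open intervals, a generating pi-system. *)
Lemma killed_law (A : set R) : measurable A -> A `<=` `]-oo, 1[ ->
  P [set w | A (X t w) /\ (running_sup X t w <= 1%:E)%E] =
  (\int[mu]_(x in A) (killed_stable_density a t (1 - x)%R)%:E)%E.
Proof.
move=> mA A1; rewrite -/f.
have mX : @measurable_fun _ _ T (measurableTypeR R) setT (X t) :=
  measurable_funP (X t).
pose M1 := pushforward_measure (mfrestr mE Eoo) mX.
pose m2 (B : set (measurableTypeR R)) := (\int[mu]_(x in B) F x)%E.
have m20 : m2 set0 = 0%E by rewrite /m2 integral_set0.
have m2_ge0 B : (0 <= m2 B)%E by apply: integral_ge0 => x _; exact: F_ge0.
have m2_add : semi_sigma_additive m2.
  exact: (@semi_sigma_additive_nng_induced _ _ _ mu F mF F_ge0).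
pose M2 : {measure set (measurableTypeR R) -> \bar R} :=
  HB.pack m2 (isMeasure.Build _ _ _ m2 m20 m2_ge0 m2_add).
have M12 B : measurable B -> M1 B = M2 B.
  apply: (@measure_unique _ R (measurableTypeR R) (@ocitv R)
    (fun n : nat => `](- n%:R : R), (n%:R : R)]%classic) _ _ _ _ M1 M2) => //.
  - exact: ocitvI.
  - by move=> n; exact: is_ocitv.
  - apply/seteqP; split => x // _.
    exists (Num.truncn `|x|).+1 => //=; rewrite in_itv/=.
    have := truncnS_gt `|x|; rewrite ltr_norml => /andP[-> h]; exact: ltW.
  - move=> _ [[p q] _ <-]; exact: law_interval.
  - move=> n; apply: le_lt_trans Eoo; apply: le_measure => //.
    + by rewrite inE; apply: measurableI => //; exact: mXA.
    + by rewrite inE.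
transitivity (M1 A); first by [].
rewrite M12//; apply: eq_integral => x; rewrite inE => /A1.
by rewrite /= in_itv/= => x1; rewrite /F x1 mul1r.
Qed.

End killed_law.

(** The two integrals over each ]x, s] with s below c are the same probability; continuity at x then
    forces equal values. *)
Lemma killed_density_unique d (T : measurableType d) (R : realType)
    (P : probability T R) (X : R -> {RV P >-> R}) (c t x : R) (g1 g2 : R -> R) :
  killed_density X c t g1 -> killed_density X c t g2 -> x < c -> g1 x = g2 x.
Proof.
move=> [cg1 p1 i1] [cg2 p2 i2] xc.
pose r := (x + c) / 2.
have xr : x < r by rewrite /r; lra.
have rc : r < c by rewrite /r; lra.
have gi (g : R -> R) s : (forall x, x < c -> {for x, continuous g}) -> x < s <= r ->
    (@lebesgue_measure R).-integrable `]x, s] (EFin \o g).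
  move=> cg /andP[xs sr].
  have ig : (@lebesgue_measure R).-integrable `[x, s] (EFin \o g).
    apply: continuous_compact_integrable; first exact: segment_compact.
    apply: continuous_in_subspaceT => y; rewrite inE/= in_itv/= => /andP[_ ys].
    by apply: cg; rewrite (le_lt_trans ys)// (le_lt_trans sr).
  by apply: integrableS ig => // y /=; rewrite !in_itv/= => /andP[/ltW -> ->].
have xrr : x < r <= r by rewrite xr lexx.
apply/eqP; rewrite -subr_eq0; apply/eqP.
apply: (@Rintegral_zero_right_limit R (fun y => g1 y - g2 y) x r xr).
- rewrite (_ : _ \o _ = (EFin \o g1) \- (EFin \o g2))%E//.
  by apply: integrableB => //; exact: gi.
- move=> s xs; rewrite RintegralB//; [|exact: gi|exact: gi].
  have sub : `]x, s]%classic `<=` `]-oo, c[.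
    move=> y; rewrite /= !in_itv/= => /andP[_ ys]; case/andP: xs => _ sr.
    by rewrite (le_lt_trans ys)// (le_lt_trans sr).
  by rewrite /Rintegral -i1// -i2// subrr.
- by apply: cvg_at_right_filter; apply: cvgB; [exact: cg1|exact: cg2].
Qed.

Unset Implicit Arguments.
Set Strict Implicit.
Set Printing Implicit Defensive.

(* The first conjunct says that h_1 exists; the second is the formula for it. *)
Theorem corollary2 (R : realType) (d : measure_display) (T : measurableType d)
    (P : probability T R) (alpha : R) (X : R -> {RV P >-> R})
    (alpha_gt1 : 1 < alpha) (alpha_lt2 : alpha < 2)
    (stableX : stable_process alpha X)
    (laplaceX : forall t q : R, 0 < t -> 0 <= q ->
      ('E_P[fun w => expR (- q * X t w)%R] = (expR (t * q `^ alpha))%:E)%E) :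
  (exists h : R -> R -> R,
     forall t, 0 < t -> killed_density X 1 t (fun x => h x t)) /\
  (forall h : R -> R -> R,
     (forall t, 0 < t -> killed_density X 1 t (fun x => h x t)) ->
     forall x t : R, x < 1 -> 0 < t ->
       (h x t)%:E =
       ((pi^-1)%:E * \int[lebesgue_measure]_(s in `]0%R, +oo[)
          (expR (- (s * t) - (1 - x) * s `^ alpha^-1 * cos (pi / alpha))
           * sin ((1 - x) * s `^ alpha^-1 * sin (pi / alpha))
           * mittag_leffler alpha alpha (- s))%R%:E)%E).
Proof.
have [levyX _] := stableX.
have ksd t : 0 < t -> killed_density X 1 t (fun x => killed_stable_density alpha t (1 - x)).
  move=> t0; split.
  - move=> x x1; apply: (continuous_comp (f := fun x : R => 1 - x)).
      by apply: cvgB; [exact: cvg_cst|exact: cvg_id].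
    by apply: killed_stable_density_continuous => //; rewrite subr_gt0.
  - move=> x x1; apply: (killed_stable_density_ge0 alpha_gt1 alpha_lt2 t0 levyX laplaceX).
    by rewrite subr_gt0.
  - move=> A mA A1; exact: (killed_law alpha_gt1 alpha_lt2 t0 levyX laplaceX).
split; first by exists (fun x t => killed_stable_density alpha t (1 - x)).
move=> h hh x t x1 t0.
rewrite (killed_density_unique (hh t t0) (ksd t t0) x1).
have x0 : 0 <= 1 - x by rewrite subr_ge0 ltW.
have ik := killed_stable_density_integrable alpha_gt1 alpha_lt2 t0 x0.
(* Integrability makes the integral finite, so [fine] can be removed and the extended integral of
   the statement recovered. *)
rewrite /killed_stable_density EFinM /Rintegral fineK; last first.
  exact: (integrable_fin_num _ ik).
congr (_ * _)%E; apply: eq_integral => s _; congr EFin; congr (_ * _).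
by rewrite /stable_kernel mulrA -expRD.
Qed.
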